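(* Let $k\ge0$ and $\Delta(T)=T_1\cdots T_n$. (1) For each $\eta\in\mathbb N_0^n$ there is $a_\eta\in\mathbb R$ such that $\Delta(T)E_\eta=a_\eta E_{\eta-\underline1}$ if $\eta_i\ge1$ for all $i$, and $\Delta(T)E_\eta=0$ (set $a_\eta=0$) if $\eta_i=0$ for some $i$. (2) The map $\eta\mapsto a_\eta$ is $\mathcal S_n$-invariant. (3) $\Delta(T)L_\eta=d_\eta L_{\eta-\underline1}$ for $\eta\in\mathbb N_0^n$ and $\Delta(T)C_\lambda=d_\lambda C_{\lambda-\underline1}$ for $\lambda\in\Lambda_n^+$, where $d_\eta=\frac{|\eta|!}{|\eta-\underline1|!}$ if $\eta_i\ne0$ for all $i$, and $d_\eta=0$ otherwise (the right-hand side being $0$ in that case). (4) Let $p\le q+1$, $\mu\in\mathbb C^p$, $\nu\in\mathbb C^q$ with $\nu_i\notin\{0,k,\dots,k(n-1)\}-\mathbb N_0$ for all $i$, and $w\in\mathbb C^n$. Then, with $\Delta(T)$ acting in the second variable (on the domain where the series converge), $$\Delta(T)\,{}_pK_q(\mu;\nu;w,\cdot)=\frac{[\mu]_{\underline1}}{[\nu]_{\underline1}}\,\Delta(w)\,{}_pK_q(\mu+\underline1;\nu+\underline1;w,\cdot),$$ where $\mu+\underline1,\nu+\underline1$ mean adding $1$ to each component, $[\mu]_{\underline1}=1$ if $p=0$ and $[\nu]_{\underline1}=1$ if $q=0$. The same identity holds with ${}_pF_q$ in place of ${}_pK_q$.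
   Context: $s_{ij}$ transposition of coordinates; Dunkl operators $T_\xi f(x)=\partial_\xi f(x)+k\sum_{i<j}(\xi_i-\xi_j)\frac{f(x)-f(s_{ij}x)}{x_i-x_j}$, $T_j=T_{e_j}$ (commuting). $\underline1=(1,\dots,1)$; $\Delta(w)=\prod w_j$; $[\mu]_\eta=\prod_{j=1}^n(\mu-k(j-1))_{\eta_j}$ and for vectors $[\mu]_\lambda=\prod_i[\mu_i]_\lambda$. Jack polynomials: $\Lambda_n^+$ partitions of length $\le n$; $\eta_+$ decreasing rearrangement, $|\eta|=\sum\eta_i$. Order $\prec$ on $\mathbb N_0^n$: $\kappa\prec\eta$ iff $\kappa_+$ strictly below $\eta_+$ in dominance order, or $\kappa_+=\eta_+$ and $w_\eta<w_\kappa$ in Bruhat order ($w_\eta$ shortest permutation with $w_\eta\eta_+=\eta$). With $\mathcal D_j=x_jT_j+k(1-n)+k\sum_{i>j}s_{ij}$, $\overline\eta_j=\eta_j-k\#\{i<j:\eta_i\ge\eta_j\}-k\#\{i>j:\eta_i>\eta_j\}$, $E_\eta$ is the unique polynomial $x^\eta+\sum_{\kappa\prec\eta}c_{\eta\kappa}x^\kappa$ with $\mathcal D_jE_\eta=\overline\eta_jE_\eta$. Let $c_\eta$ be the unique scalars with $(z_1+\dots+z_n)^m=\sum_{|\eta|=m}c_\eta E_\eta(z)$ for all $m$, $L_\eta=c_\eta E_\eta$, $C_\lambda=\sum_{\eta\in\mathcal S_n\lambda}L_\eta$. ${}_pK_q(\mu;\nu;z,w)=\sum_{\eta\in\mathbb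 N_0^n}\frac{[\mu]_{\eta_+}}{[\nu]_{\eta_+}}\frac{L_\eta(z)L_\eta(w)}{|\eta|!L_\eta(\underline1)}$, ${}_pF_q(\mu;\nu;z,w)=\sum_{\lambda\in\Lambda_n^+}\frac{[\mu]_\lambda}{[\nu]_\lambda}\frac{C_\lambda(z)C_\lambda(w)}{|\lambda|!C_\lambda(\underline1)}$ (entire if $p\le q$, convergent for $\|z\|_\infty\|w\|_\infty<1$ if $p=q+1$). *)

(* Defs.v *)
From HB Require Import structures.
From mathcomp Require Import all_boot all_order all_algebra all_fingroup.
From mathcomp Require Import all_classical all_reals all_analysis.
From mathcomp Require Import complex.
Set Implicit Arguments. Unset Strict Implicit. Unset Printing Implicit Defensive.
Import Order.TTheory GRing.Theory Num.Theory.
Import numFieldNormedType.Exports.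
Local Open Scope ring_scope.

(* C viewed as a normed space over itself (needed for derivatives / limits). *)
Notation Co R := ((R[i])^o).
Notation Fn R n := ('rV[R[i]]_n -> Co R).

Definition rc {R : realType} (x : R) : R[i] := (x%:C)%C.

Definition mi (n : nat) := {ffun 'I_n -> nat}.
Definition msize {n} (e : mi n) : nat := (\sum_(i < n) e i)%N.
Definition ones {n} : mi n := [ffun _ => 1%N].
Definition minus1 {n} (e : mi n) : mi n := [ffun i => (e i - 1)%N].
Definition allpos {n} (e : mi n) : bool := [forall i, (0 < e i)%N].
Definition pact {n} (s : 'S_n) (e : mi n) : mi n := [ffun i => e ((s^-1)%g i)].
Definition etaplus {n} (e : mi n) : mi n :=
  [ffun i : 'I_n => nth 0%N (sort geq [seq e j | j <- enum 'I_n]) i].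
Definition ispart {n} (l : mi n) : bool :=
  [forall i : 'I_n, forall j : 'I_n, (i <= j)%N ==> (l j <= l i)%N].
Definition inorbit {n} (e l : mi n) : bool := [exists s : 'S_n, pact s l == e].

(* finite enumeration of the compositions of size m *)
Definition bnd (n m : nat) := {ffun 'I_n -> 'I_m.+1}.
Definition tomi {n m} (x : bnd n m) : mi n := [ffun i => nat_of_ord (x i)].
Definition sumdeg {R : realType} (n m : nat) (F : mi n -> R[i]) : R[i] :=
  \sum_(x : bnd n m | msize (tomi x) == m) F (tomi x).
Arguments sumdeg {R} n m F.

Definition dom_lt {n} (l m : mi n) : bool :=
  [&& msize l == msize m,
      [forall j : 'I_n, (\sum_(i < n | (i <= j)%N) l i <= \sum_(i < n | (i <= j)%N) m i)%N]
    & l != m].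
Definition ninv {n} (s : 'S_n) : nat :=
  #|[set p : 'I_n * 'I_n | (p.1 < p.2)%N && (s p.2 < s p.1)%N]|.
Definition bstep {n} : rel 'S_n :=
  fun u v => [exists i : 'I_n, exists j : 'I_n, (v == (u * tperm i j)%g) && (ninv u < ninv v)%N].
Definition bruhat_lt {n} (u v : 'S_n) : bool :=
  [exists w, bstep u w && connect bstep w v].
Definition is_wmin {n} (e : mi n) (w : 'S_n) : bool :=
  (pact w (etaplus e) == e) &&
  [forall w' : 'S_n, (pact w' (etaplus e) == e) ==> (ninv w <= ninv w')%N].
Definition prec {n} (x e : mi n) : bool :=
  dom_lt (etaplus x) (etaplus e) ||
  ((etaplus x == etaplus e) &&
   [exists we : 'S_n, exists wx : 'S_n, [&& is_wmin e we, is_wmin x wx & bruhat_lt we wx]]).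

Definition mono {R : realType} {n} (e : mi n) (z : 'rV[R[i]]_n) : R[i] :=
  \prod_(i < n) z 0 i ^+ e i.
Definition swapv {R : realType} {n} (i j : 'I_n) (z : 'rV[R[i]]_n) : 'rV[R[i]]_n :=
  \row_l z 0 (tperm i j l).
Definition unitv {R : realType} {n} (j : 'I_n) : 'rV[R[i]]_n :=
  \row_l (if l == j then 1 else 0).
(* divided difference (f(x) - f(s_ij x))/(x_i - x_j), extended on the
   hyperplane x_i = x_j by its limit (d_i - d_j) f(x) *)
Definition dd {R : realType} {n} (i j : 'I_n) (f : Fn R n) (z : 'rV[R[i]]_n) : R[i] :=
  if z 0 i != z 0 j then (f z - f (swapv i j z)) / (z 0 i - z 0 j)
  else 'D_(unitv i - unitv j) f z.
Definition Dunkl {R : realType} {n} (k : R) (xi : 'rV[R[i]]_n) (f : Fn R n) : Fn R n :=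
  fun z => ('D_xi f z : R[i]) + rc k *
    \sum_(i < n) \sum_(j < n | (i < j)%N) (xi 0 i - xi 0 j) * dd i j f z.
Definition Tj {R : realType} {n} (k : R) (j : 'I_n) (f : Fn R n) : Fn R n :=
  Dunkl k (unitv j) f.
Definition DeltaT {R : realType} {n} (k : R) (f : Fn R n) : Fn R n :=
  foldr (fun j g => Tj k j g) f (enum 'I_n).
Definition Dcal {R : realType} {n} (k : R) (j : 'I_n) (f : Fn R n) : Fn R n :=
  fun z => z 0 j * Tj k j f z + rc k * (1 - n%:R) * f z
           + rc k * \sum_(i < n | (j < i)%N) f (swapv i j z).
Definition etabar {R : realType} {n} (k : R) (e : mi n) (j : 'I_n) : R :=
  (e j)%:R - k * #|[set i : 'I_n | (i < j)%N && (e j <= e i)%N]|%:R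
           - k * #|[set i : 'I_n | (j < i)%N && (e j < e i)%N]|%:R.

Definition IsE {R : realType} {n} (k : R) (e : mi n) (f : Fn R n) : Prop :=
  (exists c : mi n -> R[i], forall z,
      f z = mono e z + sumdeg n (msize e)
                         (fun x => if prec x e then c x * mono x z else 0)) /\
  (forall j z, Dcal k j f z = rc (etabar k e j) * f z).
Definition E {R : realType} {n} (k : R) (e : mi n) : Fn R n :=
  match pselect (exists f, IsE k e f) with
  | left h => proj1_sig (cid h)
  | right _ => fun _ => 0
  end.
Definition IsCoef {R : realType} {n} (k : R) (c : mi n -> R[i]) : Prop :=
  forall (m : nat) (z : 'rV[R[i]]_n),
    (\sum_(i < n) z 0 i) ^+ m = sumdeg n m (fun e => c e * E k e z).
Definition cco {R : realType} {n} (k : R) : mi n -> R[i] :=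
  match pselect (exists c, IsCoef k c) with
  | left h => proj1_sig (cid h)
  | right _ => fun _ => 0
  end.
Definition L {R : realType} {n} (k : R) (e : mi n) : Fn R n :=
  fun z => cco k e * E k e z.
Definition Cl {R : realType} {n} (k : R) (l : mi n) : Fn R n :=
  fun z => sumdeg n (msize l) (fun e => if inorbit e l then L k e z else 0).

Definition poch {R : realType} (a : R[i]) (m : nat) : R[i] :=
  \prod_(t < m) (a + t%:R).
Definition gpoch {R : realType} {n} (k : R) (a : R[i]) (e : mi n) : R[i] :=
  \prod_(j < n) poch (a - rc k * j%:R) (e j).
Definition vpoch {R : realType} {n p} (k : R) (mu : 'I_p -> R[i]) (e : mi n) : R[i] :=
  \prod_(l < p) gpoch k (mu l) e.
Definition shift1 {R : realType} {p} (mu : 'I_p -> R[i]) : 'I_p -> R[i] :=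
  fun l => mu l + 1.

Definition onesv {R : realType} {n} : 'rV[R[i]]_n := const_mx 1.
Definition Kser {R : realType} {n p q} (k : R) (mu : 'I_p -> R[i]) (nu : 'I_q -> R[i])
  (w : 'rV[R[i]]_n) : Fn R n :=
  fun z => limn (series (fun m : nat => (sumdeg n m (fun e =>
     vpoch k mu (etaplus e) / vpoch k nu (etaplus e) *
     (L k e w * L k e z) / ((msize e)`!%:R * L k e onesv)) : Co R))).
Definition Fser {R : realType} {n p q} (k : R) (mu : 'I_p -> R[i]) (nu : 'I_q -> R[i])
  (w : 'rV[R[i]]_n) : Fn R n :=
  fun z => limn (series (fun m : nat => (sumdeg n m (fun l =>
     if ispart l then
       vpoch k mu l / vpoch k nu l *
       (Cl k l w * Cl k l z) / ((msize l)`!%:R * Cl k l onesv)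
     else 0) : Co R))).

Definition supn {R : realType} {n} (z : 'rV[R[i]]_n) : R[i] :=
  \big[Num.max/0]_(i < n) `|z 0 i|.
Definition dcoef {R : realType} {n} (e : mi n) : R[i] :=
  if allpos e then (msize e)`!%:R / (msize (minus1 e))`!%:R else 0.

(* Main.v *)
Require Import Defs.
From HB Require Import structures.
From mathcomp Require Import all_boot all_order all_algebra all_fingroup.
From mathcomp Require Import all_classical all_reals all_analysis.
From mathcomp Require Import complex.
From mathcomp Require Import zify ring lra.
Import Order.TTheory GRing.Theory Num.Theory.
Import numFieldNormedType.Exports.
Set Implicit Arguments. Unset Strict Implicit. Unset Printing Implicit Defensive.
Local Open Scope ring_scope.

(* Let [Phi] be the raising operator [f(z) |-> z_n f(z_n, z_1, ..., z_{n-1})].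
   Every composition is reached from [0] by raising and by swapping adjacent
   parts [eta_i < eta_{i+1}], so all [E_eta] are built by [Phi] and by the intertwiners
   [s_i + d], whose coefficients are nonnegative for [k >= 0].  The Cherednik
   operators are triangular for [prec] and have simple joint spectrum, hence
   [E_eta] is unique, and its coefficients sum in absolute value to
   [E_eta(1) > 0].  With [Psi] the operator [T_n] followed by the inverse cyclic
   shift, [T_1 ... T_n = Psi ^ n] and [Psi E_eta] is a multiple of the [E] of the
   lowered composition, since [z_n T_n = D_n + k (n - 1)]; parts (1) to (3)
   follow, the scalars [c_eta] being controlled by [Psi p_1^(m+1) = (m+1) p_1^m].
   Both hypergeometric series have the form [sum A_eta chi_eta(w) L_eta(z) / |eta|!]
   with [|chi_eta(w)| <= |w|^|eta|] and [chi_eta = Delta(w) chi_{eta - 1}]; a bound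
   on [L_eta(1)] allows termwise application of [T_1 ... T_n]. *)

(** * Complex modulus and geometrically dominated series *)

Section ComplexModulus.
Context {R : realType}.
Implicit Types (x y : R[i]) (r : R).

(** Two obstacles shape the development. On the hyperplanes [x_i = x_j] the divided difference is a
    derivative, and the series are known only as limits, so [T_j] requires differentiating infinite
    sums at every point. Hence Taylor remainders of homogeneous polynomials are bounded through the
    sum of the absolute values of the coefficients, and the series of a given coefficient growth are
    shown to be stable under [T_j]. Secondly, convergence depends on the size of [L_eta(1)], which
    is known only by recursion: [L_eta(1) / |eta|!] times a generalized Pochhammer symbol of [eta_+]
    is unchanged by raising, while an adjacent swap multiplies it by [(g + k) / (g - k)], with [g]
    the difference of the two eigenvalues. A product of powers of differences of parts absorbs these
    factors, so the loss is polynomial in [|eta|] and leaves the radius of convergence intact. The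
    factor [Delta(w)] arises because [n] raisings multiply by all the coordinates. The cyclic shift
    needs a last variable, hence [n.+1] variables throughout and a separate treatment of [n = 0]. *)

Definition cabs x : R := Normc.normc x.

Lemma cabsE x : `|x| = rc (cabs x).
Proof. by []. Qed.

Lemma cabs0 : cabs 0 = 0.
Proof. exact: Normc.normc0. Qed.

Lemma cabs1 : cabs 1 = 1.
Proof. exact: Normc.normc1. Qed.

Lemma cabsM x y : cabs (x * y) = cabs x * cabs y.
Proof. exact: Normc.normcM. Qed.

Lemma cabsV x : cabs x^-1 = (cabs x)^-1.
Proof. exact: Normc.normcV. Qed.

Lemma cabsN x : cabs (- x) = cabs x.
Proof. exact: normcN. Qed.

Lemma cabsD x y : cabs (x + y) <= cabs x + cabs y.
Proof. exact: le_normcD. Qed.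

Lemma cabs_ge0 x : 0 <= cabs x.
Proof. by case: x => a b; exact: sqrtr_ge0. Qed.

Lemma cabs_eq0 x : (cabs x == 0) = (x == 0).
Proof.
by apply/eqP/eqP => [/Normc.eq0_normc //|->]; exact: cabs0.
Qed.

Lemma cabs_gt0 x : (0 < cabs x) = (x != 0).
Proof. by rewrite lt_def cabs_ge0 andbT cabs_eq0. Qed.

Lemma cabs_rc r : cabs (rc r) = `|r|.
Proof. by rewrite /cabs /rc /= expr0n addr0 sqrtr_sqr. Qed.

Lemma rcD r (s : R) : rc (r + s) = rc r + rc s.
Proof. exact: rmorphD. Qed.

Lemma rcB r (s : R) : rc (r - s) = rc r - rc s.
Proof. exact: rmorphB. Qed.

Lemma rcM r (s : R) : rc (r * s) = rc r * rc s.
Proof. exact: rmorphM. Qed.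

Lemma rcV r : rc r^-1 = (rc r)^-1.
Proof. exact: fmorphV. Qed.

Lemma rc_nat m : rc m%:R = m%:R :> R[i].
Proof. exact: rmorph_nat. Qed.

Lemma rc0 : rc 0 = 0 :> R[i].
Proof. by []. Qed.

Lemma rc1 : rc 1 = 1 :> R[i].
Proof. by []. Qed.

Lemma rc_inj : injective (@rc R).
Proof. exact: complexI. Qed.

Lemma rc_eq0 r : (rc r == 0) = (r == 0).
Proof. exact: fmorph_eq0. Qed.

Lemma cabs_nat m : cabs (m%:R : R[i]) = m%:R.
Proof. by rewrite -rc_nat cabs_rc ger0_norm. Qed.

Lemma cabs_sum (I : Type) (s : seq I) (P : pred I) (F : I -> R[i]) :
  cabs (\sum_(i <- s | P i) F i) <= \sum_(i <- s | P i) cabs (F i).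
Proof.
elim/big_ind2: _ => [|x r y s' h1 h2|//]; first by rewrite cabs0.
by apply: le_trans (cabsD _ _) _; apply: lerD.
Qed.

Lemma cabs_prod (I : Type) (s : seq I) (P : pred I) (F : I -> R[i]) :
  cabs (\prod_(i <- s | P i) F i) = \prod_(i <- s | P i) cabs (F i).
Proof.
elim/big_ind2: _ => [|x r y s' h1 h2|//]; first by rewrite cabs1.
by rewrite cabsM h1 h2.
Qed.

Lemma Re_le_cabs x : `|complex.Re x| <= cabs x.
Proof. by rewrite -lecR; exact: normc_ge_Re. Qed.

Lemma Im_le_cabs x : `|complex.Im x| <= cabs x.
Proof.
case: x => a b /=; rewrite -sqrtr_sqr ler_sqrt ?addr_ge0 ?sqr_ge0 //.
by rewrite lerDr sqr_ge0.
Qed.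

Lemma cabs_le_ReIm x : cabs x <= `|complex.Re x| + `|complex.Im x|.
Proof.
rewrite {1}[x]complexE; apply: le_trans (cabsD _ _) _.
rewrite cabsM -/(rc _) -/(rc _) !cabs_rc.
suff -> : cabs 'i%C = 1 by rewrite mul1r.
by rewrite /cabs /= expr0n expr1n add0r sqrtr1.
Qed.

Lemma ReB x y : complex.Re (x - y) = complex.Re x - complex.Re y.
Proof. by case: x y => [a b] [c d]. Qed.

Lemma ImB x y : complex.Im (x - y) = complex.Im x - complex.Im y.
Proof. by case: x y => [a b] [c d]. Qed.

Lemma Re_sum (I : Type) (s : seq I) (P : pred I) (F : I -> R[i]) :
  complex.Re (\sum_(i <- s | P i) F i) = \sum_(i <- s | P i) complex.Re (F i).
Proof. by apply: big_morph => // -[a b] [c d]. Qed.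

Lemma Im_sum (I : Type) (s : seq I) (P : pred I) (F : I -> R[i]) :
  complex.Im (\sum_(i <- s | P i) F i) = \sum_(i <- s | P i) complex.Im (F i).
Proof. by apply: big_morph => // -[a b] [c d]. Qed.

End ComplexModulus.

Section ComplexSeries.
Context {R : realType}.
Implicit Types (u v : nat -> R[i]) (C t : R).
Local Open Scope classical_set_scope.

(** A positive element of [R[i]] is real, so the complex epsilons of the topology of [Co R] reduce
    to real ones. *)
Lemma cvg_cabsP u (l : R[i]) :
  ((u : nat -> Co R) @ \oo --> (l : Co R)) <->
  (forall e : R, 0 < e -> \forall m \near \oo, cabs (l - u m) < e).
Proof.
split=> [/cvgrPdist_lt h e e0|h].
  have := h (rc e); rewrite ltcR => /(_ e0).
  by apply: filterS => m; rewrite /= ltcR.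
apply/cvgrPdist_lt => e e0.
have /complex_realP[x ex] := gtr0_real e0.
move: e0; rewrite ex ltcR => x0; apply: filterS (h _ x0) => m.
by rewrite ltcR.
Qed.

Definition csum u : R[i] := limn (series (u : nat -> Co R)).

Definition geobounded u C t := [/\ 0 <= C, 0 <= t, t < 1 & forall m, cabs (u m) <= C * t ^+ m].

Lemma geometric_summable C t (u : nat -> R) :
  0 <= t -> t < 1 -> (forall m, `|u m| <= C * t ^+ m) -> cvgn (series u).
Proof.
move=> t0 t1 h; apply: normed_cvg.
apply: (@series_le_cvg _ _ (geometric C t)) => [m|m||] /=.
  exact: normr_ge0.
  exact: le_trans (normr_ge0 _) (h m).
  exact: h.
by apply: is_cvg_geometric_series; rewrite ger0_norm.
Qed.

Lemma csum_unique u (l : R[i]) :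
  series (u : nat -> Co R) @ \oo --> (l : Co R) -> csum u = l.
Proof. by move=> h; apply: cvg_lim h; exact: norm_hausdorff. Qed.

(** The real and imaginary parts are real series dominated by a geometric one; they converge
    separately and are recombined. *)
Lemma cvg_csum u C t : geobounded u C t ->
  series (u : nat -> Co R) @ \oo --> (csum u : Co R).
Proof.
case=> C0 t0 t1 hu.
suff h : series (u : nat -> Co R) @ \oo --> ((limn (series (fun m => complex.Re (u m)))
   +i* limn (series (fun m => complex.Im (u m))))%C : Co R).
  by rewrite (csum_unique h).
have hr : cvgn (series (fun m => complex.Re (u m))).
  by apply: geometric_summable t0 t1 _ => m; apply: le_trans (Re_le_cabs _) (hu m).
have hi : cvgn (series (fun m => complex.Im (u m))).
  by apply: geometric_summable t0 t1 _ => m; apply: le_trans (Im_le_cabs _) (hu m).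
apply/cvg_cabsP => e e0.
have e20 : 0 < e / 2 by rewrite divr_gt0.
have /cvgrPdist_lt/(_ _ e20) h1 := hr.
have /cvgrPdist_lt/(_ _ e20) h2 := hi.
apply: filterS2 h1 h2 => m h1 h2.
apply: le_lt_trans (cabs_le_ReIm _) _.
rewrite [e]splitr; apply: ltrD.
- move: h1; rewrite !seriesEnat /=; congr (`| _ | < _).
  by rewrite ReB Re_sum.
- move: h2; rewrite !seriesEnat /=; congr (`| _ | < _).
  by rewrite ImB Im_sum.
Qed.

Lemma eq_csum u v : u =1 v -> csum u = csum v.
Proof. by move=> /funext ->. Qed.

Lemma csumD u v C C' t t' : geobounded u C t -> geobounded v C' t' ->
  csum (fun m => u m + v m) = csum u + csum v.
Proof.
move=> /cvg_csum hu /cvg_csum hv; apply: csum_unique.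
have -> : series ((fun m => u m + v m) : nat -> Co R) = series u + series v.
  by apply/funext => m; rewrite /series /= big_split.
exact: (@cvgD _ (Co R) _ _ _ _ _ _ _ hu hv).
Qed.

Lemma csumZ u (a : R[i]) C t : geobounded u C t ->
  csum (fun m => a * u m) = a * csum u.
Proof.
move=> /cvg_csum hu; apply: csum_unique.
have hZ := @cvgZl_tmp _ (Co R) _ _ _ a _ _ hu.
suff -> : series ((fun m => a * u m) : nat -> Co R) = a \*: series (u : nat -> Co R).
  exact: hZ.
by apply/funext => m; rewrite /series /= -mulr_sumr.
Qed.

Lemma csum0 : csum (fun=> 0) = 0.
Proof.
apply: csum_unique; rewrite (_ : series _ = cst 0); first exact: cvg_cst.
by apply/funext => m; rewrite seriesEnat /= big1.
Qed.

Lemma cabs_csum_le u C t : geobounded u C t -> cabs (csum u) <= C / (1 - t).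
Proof.
move=> hu; have /cvg_cabsP hc := cvg_csum hu.
case: hu => C0 t0 t1 hu.
apply/ler_addgt0Pr => e e0; near \oo => m.
have h1 : cabs (csum u - series (u : nat -> Co R) m) < e by near: m; apply: hc.
have t1' : 0 < 1 - t by rewrite subr_gt0.
have h2 : cabs (series (u : nat -> Co R) m) <= C / (1 - t).
  rewrite seriesEnat /=; apply: le_trans (cabs_sum _ _ _) _.
  apply: (@le_trans _ _ (\sum_(0 <= i < m) C * t ^+ i)); first exact: ler_sum.
  rewrite -mulr_sumr ler_wpM2l // -[leRHS]mul1r ler_pdivlMr //.
  have := subrX1 t m; rewrite -[X in _ = X]opprK -mulNr opprB => e1.
  rewrite big_mkord mulrC -[X in X <= _]opprK -e1 opprB lerBlDr lerDl.
  exact: exprn_ge0.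
have -> : csum u = (csum u - series (u : nat -> Co R) m) + series (u : nat -> Co R) m.
  by rewrite subrK.
by apply: le_trans (cabsD _ _) _; rewrite addrC; apply: lerD => //; exact: ltW.
Unshelve. all: by end_near.
Qed.

End ComplexSeries.

(* [Dv], [dq], [Td], [Dch] and [EF] are opaque copies of ['D_v], [dd], [Tj], [Dcal] and [E]
   on functions into [R[i]] itself rather than into its normed copy [Co R]. *)
HB.lock Definition Dv (R : realType) (n : nat) (v : 'rV[R[i]]_n)
  (f : 'rV[R[i]]_n -> R[i]) (z : 'rV[R[i]]_n) : R[i] := 'D_v (f : Fn R n) z.

(** * First-order expansions along a direction *)

Section DirectionalDerivative.
Context {R : realType} {n : nat}.
Implicit Types (f g : 'rV[R[i]]_n -> R[i]) (z v : 'rV[R[i]]_n) (d a h : R[i]).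
Local Open Scope classical_set_scope.

(* Taylor's formula to first order with a quadratic remainder: stronger than
   differentiability along [v], and easier to manipulate. *)
Definition isD f z v d := exists K r : R, 0 < r /\
  forall h, cabs h < r -> cabs (f (z + h *: v) - f z - h * d) <= K * cabs h ^+ 2.

(** Normal form for estimates: with [cabs h < 1] the higher powers of [cabs h] that products create
    are absorbed in the quadratic term. *)
Lemma isD_K f z v d : isD f z v d -> exists K r : R, [/\ 0 <= K, 0 < r, r <= 1 &
  forall h, cabs h < r -> cabs (f (z + h *: v) - f z - h * d) <= K * cabs h ^+ 2].
Proof.
case=> K [r [r0 H]]; exists `|K|, (Num.min r 1); split=> //.
- by rewrite lt_min r0 ltr01.
- by rewrite ge_min lexx orbT.
move=> h; rewrite lt_min => /andP[hr _]; apply: le_trans (H h hr) _.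
by rewrite ler_wpM2r ?sqr_ge0 ?ler_norm.
Qed.

Lemma isD_derive f z v d : isD f z v d -> Dv v f z = d.
Proof.
case/isD_K=> K [r [K0 r0 r1 H]]; rewrite Dv.unlock /derive.
apply: (@cvg_lim (Co R)); first exact: norm_hausdorff.
apply/cvgrPdist_lt => e e0.
have /complex_realP[x ex] := gtr0_real e0.
move: e0; rewrite ex ltcR => x0.
have m0 : 0 < Num.min r (x / (K + 1)).
  by rewrite lt_min r0 divr_gt0 // ltr_wpDl.
exists (rc (Num.min r (x / (K + 1)))); first by rewrite /= ltcR.
move=> h /=; rewrite sub0r normrN cabsE ltcR lt_min => /andP[h1 h2] hn0.
rewrite cabsE ltcR.
have ch0 : 0 < cabs h by rewrite cabs_gt0.
rewrite ltr_pdivlMr ?ltr_wpDl // in h2.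
have := H h h1; rewrite [z + _]addrC => H1.
have -> : d - h^-1 *: (f (h *: v + z) - f z) =
    - (h^-1 * (f (h *: v + z) - f z - h * d)).
  by rewrite /GRing.scale /=; field.
rewrite cabsN cabsM cabsV mulrC ltr_pdivrMr //.
apply: le_lt_trans H1 _; rewrite expr2 mulrA ltr_pM2r //.
by apply: le_lt_trans h2; rewrite mulrDr mulr1 mulrC lerDl ltW.
Qed.

Lemma isD_cst a z v : isD (fun=> a) z v 0.
Proof.
exists 0, 1; split=> // h _.
by rewrite subrr mulr0 subr0 cabs0 mul0r.
Qed.

Lemma isDD f g z v d d' : isD f z v d -> isD g z v d' ->
  isD (fun z => f z + g z) z v (d + d').
Proof.
case=> K [r [r0 H]] [K' [r' [r0' H']]].
exists (K + K'), (Num.min r r'); split; first by rewrite lt_min r0.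
move=> h; rewrite lt_min => /andP[h1 h2].
have -> : f (z + h *: v) + g (z + h *: v) - (f z + g z) - h * (d + d') =
  (f (z + h *: v) - f z - h * d) + (g (z + h *: v) - g z - h * d') by ring.
by apply: le_trans (cabsD _ _) _; rewrite mulrDl; apply: lerD; [exact: H|exact: H'].
Qed.

Lemma isDZ a f z v d : isD f z v d -> isD (fun z => a * f z) z v (a * d).
Proof.
case=> K [r [r0 H]]; exists (cabs a * K), r; split=> // h /H H1.
have -> : a * f (z + h *: v) - a * f z - h * (a * d) =
  a * (f (z + h *: v) - f z - h * d) by ring.
by rewrite cabsM -mulrA ler_wpM2l ?cabs_ge0.
Qed.

Lemma isD_coordM (l : 'I_n) f z v d : isD f z v d ->
  isD (fun z => z 0 l * f z) z v (v 0 l * f z + z 0 l * d).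
Proof.
case/isD_K=> K [r [K0 r0 r1 H]].
exists (cabs (z 0 l) * K + cabs (v 0 l) * (K + cabs d)), r; split=> // h hr.
have H1 := H h hr; set D := _ - _ - _ in H1.
rewrite !mxE.
have -> : (z 0 l + h * v 0 l) * f (z + h *: v) - z 0 l * f z -
  h * (v 0 l * f z + z 0 l * d) = z 0 l * D + h * v 0 l * (D + h * d).
  by rewrite /D; ring.
apply: le_trans (cabsD _ _) _; rewrite mulrDl !cabsM.
have h1 : cabs h <= 1 by apply: ltW; apply: lt_le_trans r1.
apply: lerD; first by rewrite -mulrA ler_wpM2l ?cabs_ge0.
rewrite [cabs h * _]mulrC -!mulrA ler_wpM2l ?cabs_ge0 //.
have : cabs (D + h * d) <= (K + cabs d) * cabs h.
  apply: le_trans (cabsD _ _) _; rewrite mulrDl cabsM [cabs h * _]mulrC lerD2r.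
  apply: le_trans H1 _; rewrite ler_wpM2l // expr2 ler_piMl // cabs_ge0 //.
move=> H2; rewrite expr2 mulrA [X in _ <= X]mulrC; apply: ler_wpM2l => //.
exact: cabs_ge0.
Qed.

Lemma isDN f z v d : isD f z v d -> isD f z (- v) (- d).
Proof.
case=> K [r [r0 H]]; exists K, r; split=> // h hr.
have := H (- h); rewrite cabsN => /(_ hr).
by rewrite scalerN scaleNr mulNr mulrN.
Qed.

End DirectionalDerivative.

Section Permutation.
Context {R : realType} {n : nat}.
Implicit Types (f g : 'rV[R[i]]_n -> R[i]) (z v : 'rV[R[i]]_n) (s t : 'S_n).

Definition pv s z : 'rV[R[i]]_n := \row_l z 0 (s l).

Lemma swapvE (i j : 'I_n) z : swapv i j z = pv (tperm i j) z.
Proof. by []. Qed.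

Lemma pvD s z v : pv s (z + v) = pv s z + pv s v.
Proof. by apply/rowP => l; rewrite !mxE. Qed.

Lemma pvZ s (a : R[i]) z : pv s (a *: z) = a *: pv s z.
Proof. by apply/rowP => l; rewrite !mxE. Qed.

Lemma pvM s t z : pv s (pv t z) = pv (s * t)%g z.
Proof. by apply/rowP => l; rewrite !mxE permM. Qed.

Lemma pv1 z : pv 1%g z = z.
Proof. by apply/rowP => l; rewrite !mxE perm1. Qed.

Lemma pvK s : cancel (pv s) (pv s^-1%g).
Proof. by move=> z; rewrite pvM mulVg pv1. Qed.

Lemma pvKV s : cancel (pv s^-1%g) (pv s).
Proof. by move=> z; rewrite pvM mulgV pv1. Qed.

Lemma pv_unitv s (j : 'I_n) : pv s (unitv j) = unitv (s^-1%g j).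
Proof.
apply/rowP => l; rewrite !mxE; congr (if _ then _ else _).
by rewrite -[RHS](inj_eq (@perm_inj _ s)) permKV.
Qed.

Lemma pv_swapv s (i j : 'I_n) z :
  pv s (swapv i j z) = swapv (s^-1%g i) (s^-1%g j) (pv s z).
Proof. by rewrite !swapvE !pvM -tpermJ conjgE invgK -!mulgA mulVg mulg1. Qed.

Lemma isD_pv s f z v d : isD f (pv s z) (pv s v) d -> isD (fun z => f (pv s z)) z v d.
Proof.
case=> K [r [r0 H]]; exists K, r; split=> // h hr.
by rewrite pvD pvZ; exact: H.
Qed.

(** The pointwise version exists for sums of series, which are controlled on a polydisc only;
    polynomials satisfy [sm]. *)
Definition sm_at f z := forall v, isD f z v (Dv v f z).

Definition sm f := forall z, sm_at f z.

Lemma sm_atP f z : (forall v, exists d, isD f z v d) -> sm_at f z.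
Proof. by move=> H v; have [d hd] := H v; rewrite (isD_derive hd). Qed.

Lemma smP f : (forall z v, exists d, isD f z v d) -> sm f.
Proof. by move=> H z; exact/sm_atP/H. Qed.

Lemma sm_cst (a : R[i]) : sm (fun=> a).
Proof. by apply: smP => z v; exists 0; exact: isD_cst. Qed.

Lemma smD f g : sm f -> sm g -> sm (fun z => f z + g z).
Proof. by move=> hf hg; apply: smP => z v; eexists; exact: isDD (hf z v) (hg z v). Qed.

Lemma smZ (a : R[i]) f : sm f -> sm (fun z => a * f z).
Proof. by move=> hf; apply: smP => z v; eexists; exact: isDZ (hf z v). Qed.

Lemma sm_coordM l f : sm f -> sm (fun z => z 0 l * f z).
Proof. by move=> hf; apply: smP => z v; eexists; exact: isD_coordM (hf z v). Qed.

Lemma sm_pv s f : sm f -> sm (fun z => f (pv s z)).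
Proof. by move=> hf; apply: smP => z v; eexists; exact: isD_pv (hf _ _). Qed.

Lemma deriveN_sm f z v : sm_at f z -> Dv (- v) f z = - Dv v f z.
Proof. by move=> hf; apply/isD_derive/isDN/hf. Qed.

Lemma derive_pv s f z v : sm f -> Dv v (fun z => f (pv s z)) z = Dv (pv s v) f (pv s z).
Proof. by move=> hf; apply/isD_derive/isD_pv/hf. Qed.

Lemma derive_coordM l f z v : sm f ->
  Dv v (fun z => z 0 l * f z) z = v 0 l * f z + z 0 l * Dv v f z.
Proof. by move=> hf; apply/isD_derive/isD_coordM/hf. Qed.

Lemma deriveD_sm f g z v : sm f -> sm g ->
  Dv v (fun z => f z + g z) z = Dv v f z + Dv v g z.
Proof. by move=> hf hg; exact: isD_derive (isDD (hf _ _) (hg _ _)). Qed.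

Lemma deriveZ_sm a f z v : sm f -> Dv v (fun z => a * f z) z = a * Dv v f z.
Proof. by move=> hf; apply/isD_derive/isDZ/hf. Qed.

Lemma derive_cst_sm (a : R[i]) z v : Dv v (fun=> a) z = 0.
Proof. exact/isD_derive/isD_cst. Qed.

End Permutation.

(** * Divided differences and Dunkl operators *)

HB.lock Definition dq (R : realType) (n : nat) (i j : 'I_n)
  (f : 'rV[R[i]]_n -> R[i]) (z : 'rV[R[i]]_n) : R[i] := dd i j f z.

HB.lock Definition Td (R : realType) (n : nat) (k : R) (j : 'I_n)
  (f : 'rV[R[i]]_n -> R[i]) (z : 'rV[R[i]]_n) : R[i] := Tj k j f z.

Section DividedDifference.
Context {R : realType} {n : nat}.
Implicit Types (f g : 'rV[R[i]]_n -> R[i]) (z : 'rV[R[i]]_n) (i j l : 'I_n) (a : R[i]).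

Lemma swapvC i j z : swapv i j z = swapv j i z.
Proof. by rewrite !swapvE tpermC. Qed.

Lemma swapvK i j z : swapv i j (swapv i j z) = z.
Proof. by rewrite !swapvE pvM tperm2 pv1. Qed.

Lemma swapv_eq i j z : z 0 i = z 0 j -> swapv i j z = z.
Proof. by move=> e; apply/rowP => l; rewrite !mxE; case: tpermP => // ->. Qed.

Lemma dq_ne i j f z : z 0 i <> z 0 j ->
  dq i j f z = (f z - f (swapv i j z)) / (z 0 i - z 0 j).
Proof. by rewrite dq.unlock /dd => /eqP ->. Qed.

Lemma mulr_dq i j f z : (z 0 i - z 0 j) * dq i j f z = f z - f (swapv i j z).
Proof.
have [e|ne] := pselect (z 0 i = z 0 j); first by rewrite e subrr mul0r swapv_eq ?subrr.
by rewrite dq_ne // mulrC divfK // subr_eq0; apply/eqP.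
Qed.

Definition udiff i j : 'rV[R[i]]_n := \row_l ((unitv i : 'rV_n) 0 l - (unitv j : 'rV_n) 0 l).

Lemma dq_eq i j f z : z 0 i = z 0 j -> dq i j f z = Dv (udiff i j) f z.
Proof.
have -> : udiff i j = unitv i - unitv j by apply/rowP => l; rewrite !mxE.
by rewrite dq.unlock Dv.unlock /dd => ->; rewrite eqxx.
Qed.

Lemma udiffN i j : udiff j i = - udiff i j.
Proof. by apply/rowP => l; rewrite !mxE opprB. Qed.

Lemma pv_udiff s i j : pv s (udiff i j) = udiff (s^-1%g i) (s^-1%g j).
Proof. by rewrite /udiff -!pv_unitv; apply/rowP => l; rewrite !mxE. Qed.

Lemma dq_anti i j f z : sm_at f z -> dq j i f z = - dq i j f z.
Proof.
move=> hf; have [e|ne] := pselect (z 0 i = z 0 j).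
  rewrite !dq_eq //.
  by rewrite udiffN deriveN_sm.
rewrite !dq_ne //; last by move=> e; apply: ne.
by rewrite (swapvC j i) -(opprB (z 0 i)) invrN mulrN.
Qed.

Lemma dqD i j f g z : sm f -> sm g ->
  dq i j (fun z => f z + g z) z = dq i j f z + dq i j g z.
Proof.
move=> hf hg; have [e|ne] := pselect (z 0 i = z 0 j).
  by rewrite !dq_eq // deriveD_sm.
by rewrite !dq_ne // -mulrDl opprD addrACA.
Qed.

Lemma dqZ i j a f z : sm f -> dq i j (fun z => a * f z) z = a * dq i j f z.
Proof.
move=> hf; have [e|ne] := pselect (z 0 i = z 0 j).
  by rewrite !dq_eq // deriveZ_sm.
by rewrite !dq_ne // -mulrBr mulrA.
Qed.

Lemma dq_cst i j a z : dq i j (fun=> a) z = 0.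
Proof.
have [e|ne] := pselect (z 0 i = z 0 j); first by rewrite dq_eq // derive_cst_sm.
by rewrite dq_ne // subrr mul0r.
Qed.

Lemma dq_mull i j f z : i != j -> sm f ->
  dq i j (fun z => z 0 i * f z) z = z 0 i * dq i j f z + f (swapv i j z).
Proof.
move=> ij hf; have [e|ne] := pselect (z 0 i = z 0 j).
  rewrite !dq_eq // derive_coordM // !mxE eqxx (negPf ij) subr0 mul1r addrC.
  by rewrite swapv_eq.
rewrite !dq_ne // [swapv i j z 0 i]mxE tpermL.
have : z 0 i - z 0 j != 0 by rewrite subr_eq0; apply/eqP.
by move=> ?; field.
Qed.

Lemma dq_mulr i j f z : i != j -> sm f ->
  dq i j (fun z => z 0 j * f z) z = z 0 j * dq i j f z - f (swapv i j z).
Proof.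
move=> ij hf; rewrite dq_anti; last by apply: sm_coordM.
by rewrite dq_mull 1?eq_sym // (dq_anti _ _ (hf z)) swapvC mulrN opprD opprK.
Qed.

Lemma dq_mulo i j l f z : l != i -> l != j -> sm f ->
  dq i j (fun z => z 0 l * f z) z = z 0 l * dq i j f z.
Proof.
move=> li lj hf; have [e|ne] := pselect (z 0 i = z 0 j).
  by rewrite !dq_eq // derive_coordM // !mxE (negPf li) (negPf lj) subr0 mul0r add0r.
by rewrite !dq_ne // [swapv i j z 0 l]mxE tpermD 1?eq_sym // -mulrBr mulrA.
Qed.

Lemma dq_pv s i j f z : sm f ->
  dq i j (fun z => f (pv s z)) z = dq (s^-1%g i) (s^-1%g j) f (pv s z).
Proof.
have E l : pv s z 0 (s^-1%g l) = z 0 l by rewrite mxE permKV.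
move=> hf; have [e|ne] := pselect (z 0 i = z 0 j).
  rewrite (dq_eq _ e) (@dq_eq _ _ f (pv s z)); last by rewrite (E i) (E j).
  by rewrite (derive_pv s z (udiff i j) hf) pv_udiff.
rewrite (dq_ne _ ne) (@dq_ne _ _ f (pv s z)); last by rewrite (E i) (E j).
by rewrite (E i) (E j) pv_swapv.
Qed.

End DividedDifference.

Section DunklOperator.
Context {R : realType} {n : nat}.
Implicit Types (k : R).
Implicit Types (f g : 'rV[R[i]]_n -> R[i]) (z : 'rV[R[i]]_n) (i j l : 'I_n) (a : R[i]).

Variable k : R.
Local Notation T := (Td k).

(** For a unit vector only the pairs containing [j] survive. A pair [(i, j)] with [i < j] has weight
    [-1], absorbed by the antisymmetry of [dq]; on the hyperplane this antisymmetry is the oddness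
    of the derivative in its direction. *)
Lemma TjE j f z : sm_at f z ->
  T j f z = Dv (unitv j) f z + rc k * \sum_(i < n | i != j) dq j i f z.
Proof.
move=> hf; rewrite Td.unlock Dv.unlock /Tj /Dunkl; congr (_ + _ * _).
pose F i l : R[i] := ((unitv j : 'rV[R[i]]_n) 0 i - (unitv j : 'rV[R[i]]_n) 0 l) * dq i l f z.
transitivity (\sum_(i < n) \sum_(l < n | (i < l)%N) F i l).
  by rewrite /F dq.unlock.
have E0 i : \sum_(l < n | (i < l)%N) F i l =
   (if i == j then \sum_(l < n | (j < l)%N) dq j l f z else 0)
   + (if (i < j)%N then dq j i f z else 0).
  case: eqP => [->|/eqP ij].
    rewrite ltnn addr0; apply: eq_bigr => l jl.
    have lj : (l == j) = false by rewrite -val_eqE /= gtn_eqF.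
    by rewrite /F !mxE eqxx lj subr0 mul1r.
  rewrite add0r; case: ifPn => h.
    rewrite (bigD1 j) //= [X in _ + X]big1 ?addr0.
      by rewrite /F !mxE eqxx (negPf ij) sub0r mulN1r (dq_anti i j hf).
    by move=> l /andP[_ lj]; rewrite /F !mxE (negPf ij) (negPf lj) subrr mul0r.
  rewrite big1 // => l il; rewrite /F !mxE (negPf ij).
  by case: eqP => [e|_]; [rewrite -e il in h|rewrite subrr mul0r].
rewrite (eq_bigr _ (fun i _ => E0 i)) big_split /= -!big_mkcond /= big_pred1_eq.
rewrite [RHS](bigID (fun i : 'I_n => (j < i)%N)) /=; congr (_ + _).
  by apply: eq_bigl => i; rewrite andbC; case: ltngtP => //= h; rewrite neq_ltn h orbT.
by apply: eq_bigl => i; rewrite -leqNgt ltn_neqAle.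
Qed.

Lemma TjD j f g z : sm f -> sm g ->
  T j (fun z => f z + g z) z = T j f z + T j g z.
Proof.
move=> hf hg; rewrite (TjE j (hf z)) (TjE j (hg z)) (TjE j ((smD hf hg) z)).
rewrite (deriveD_sm z (unitv j) hf hg).
have -> : \sum_(i < n | i != j) dq j i (fun z => f z + g z) z =
    \sum_(i < n | i != j) dq j i f z + \sum_(i < n | i != j) dq j i g z.
  by rewrite -big_split; apply: eq_bigr => i _; exact: dqD.
ring.
Qed.

Lemma TjZ j a f z : sm f -> T j (fun z => a * f z) z = a * T j f z.
Proof.
move=> hf; rewrite (TjE j (hf z)) (TjE j ((smZ a hf) z)).
rewrite (deriveZ_sm a z (unitv j) hf).
have -> : \sum_(i < n | i != j) dq j i (fun z => a * f z) z =
    a * \sum_(i < n | i != j) dq j i f z.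
  by rewrite mulr_sumr; apply: eq_bigr => i _; exact: dqZ.
ring.
Qed.

Lemma Tj_cst j a z : T j (fun=> a) z = 0.
Proof.
rewrite (TjE j ((sm_cst a) z)).
by rewrite derive_cst_sm big1 ?mulr0 ?addr0 // => i _; exact: dq_cst.
Qed.

Lemma Tj_pv s j f z : sm f ->
  T j (fun z => f (pv s z)) z = T (s^-1%g j) f (pv s z).
Proof.
move=> hf; rewrite (TjE _ (hf _)) (TjE j ((sm_pv s hf) z)).
rewrite (derive_pv s z (unitv j) hf) pv_unitv.
congr (_ + _ * _); transitivity
    (\sum_(i < n | i != j) dq (s^-1%g j) (s^-1%g i) f (pv s z)).
  by apply: eq_bigr => i _; exact: dq_pv.
rewrite [RHS](reindex_inj (@perm_inj _ s^-1%g)) /=.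
by apply: eq_bigl => i; rewrite (inj_eq perm_inj).
Qed.

Lemma Tj_mulj j f z : sm f ->
  T j (fun z => z 0 j * f z) z =
  z 0 j * T j f z + f z + rc k * \sum_(i < n | i != j) f (swapv i j z).
Proof.
move=> hf; rewrite (TjE j (hf z)) (TjE j ((sm_coordM j hf) z)).
rewrite (derive_coordM j z (unitv j) hf) !mxE eqxx mul1r.
have -> : \sum_(i < n | i != j) dq j i (fun z => z 0 j * f z) z =
  z 0 j * (\sum_(i < n | i != j) dq j i f z) + \sum_(i < n | i != j) f (swapv i j z).
  rewrite mulr_sumr -big_split /=; apply: eq_bigr => i ij.
  by rewrite dq_mull 1?eq_sym // swapvC.
ring.
Qed.

Lemma Tj_mulo j l f z : l != j -> sm f ->
  T j (fun z => z 0 l * f z) z = z 0 l * T j f z - rc k * f (swapv l j z).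
Proof.
move=> lj hf; rewrite (TjE j (hf z)) (TjE j ((sm_coordM l hf) z)).
rewrite derive_coordM // !mxE (negPf lj) mul0r add0r.
have -> : \sum_(i < n | i != j) dq j i (fun z => z 0 l * f z) z =
  z 0 l * (\sum_(i < n | i != j) dq j i f z) - f (swapv l j z).
  rewrite !(bigD1 l lj) /= dq_mulr 1?eq_sym // swapvC mulrDr mulr_sumr.
  rewrite -addrA [- _ + _]addrC addrA; congr (_ + _ - _).
  by apply: eq_bigr => i /andP[ij il]; rewrite dq_mulo // eq_sym.
ring.
Qed.

Lemma Tj_mul j l f z : sm f ->
  T j (fun z => z 0 l * f z) z = z 0 l * T j f z +
   (if l == j then f z + rc k * \sum_(i < n | i != j) f (swapv i j z)
    else - (rc k * f (swapv l j z))).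
Proof. by move=> hf; case: eqP => [->|/eqP ne]; rewrite ?Tj_mulj ?Tj_mulo ?addrA. Qed.

(** The reflections created by the coordinate [j] cancel those created by all the other coordinates,
    so the sum of the variables behaves towards [T_j] as a single variable does towards its own
    derivative. *)
Lemma Tj_mulp1 j f z : sm f ->
  T j (fun z => (\sum_(l < n) z 0 l) * f z) z = (\sum_(l < n) z 0 l) * T j f z + f z.
Proof.
move=> hf.
have H (s : seq 'I_n) : sm (fun z => (\sum_(l <- s) z 0 l) * f z) /\
  T j (fun z => (\sum_(l <- s) z 0 l) * f z) z = (\sum_(l <- s) z 0 l) * T j f z +
  \sum_(l <- s) (if l == j then f z + rc k * \sum_(i < n | i != j) f (swapv i j z)
    else - (rc k * f (swapv l j z))).
  elim: s => [|l s [IH1 IH2]].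
    have -> : (fun z : 'rV_n => (\sum_(l <- [::]) z 0 l) * f z) = (fun=> 0).
      by apply/funext => y; rewrite big_nil mul0r.
    by split; [exact: sm_cst|rewrite Tj_cst !big_nil mul0r addr0].
  have -> : (fun z : 'rV_n => (\sum_(l <- l :: s) z 0 l) * f z) =
    (fun z => z 0 l * f z + (\sum_(l <- s) z 0 l) * f z).
    by apply/funext => y; rewrite big_cons mulrDl.
  split; first by apply: smD => //; exact: sm_coordM.
  rewrite TjD //; last exact: sm_coordM.
  by rewrite IH2 Tj_mul // !big_cons; ring.
have [_ ->] := H (index_enum 'I_n); congr (_ + _).
rewrite (bigD1 j) //= eqxx -[RHS]addr0 -addrA; congr (_ + _).
rewrite mulr_sumr -big_split big1 //= => l lj.
by rewrite (negPf lj) subrr.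
Qed.

End DunklOperator.

Section PointwiseSums.
Context {R : realType} {T I : Type}.
Implicit Types (s : seq I) (P : pred I) (F : I -> T -> R[i]).

Lemma fsum_ind (K : (T -> R[i]) -> Prop) s P F : K (fun=> 0) ->
  (forall f g, K f -> K g -> K (fun z => f z + g z)) -> (forall i, P i -> K (F i)) ->
  K (fun z => \sum_(i <- s | P i) F i z).
Proof.
move=> K0 KD KF; have -> : (fun z => \sum_(i <- s | P i) F i z) = \sum_(i <- s | P i) F i.
  by apply/funext => z; rewrite fct_sumE.
by apply: big_ind.
Qed.

Lemma fsum_additive (K : (T -> R[i]) -> Prop) (op : (T -> R[i]) -> R[i]) s P F : K (fun=> 0) ->
  (forall f g, K f -> K g -> K (fun z => f z + g z)) -> op (fun=> 0) = 0 ->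
  (forall f g, K f -> K g -> op (fun z => f z + g z) = op f + op g) ->
  (forall i, P i -> K (F i)) ->
  op (fun z => \sum_(i <- s | P i) F i z) = \sum_(i <- s | P i) op (F i).
Proof.
move=> K0 KD op0 opD KF.
have -> : (fun z => \sum_(i <- s | P i) F i z) = \sum_(i <- s | P i) F i.
  by apply/funext => z; rewrite fct_sumE.
suff [] : K (\sum_(i <- s | P i) F i) /\ op (\sum_(i <- s | P i) F i) = \sum_(i <- s | P i) op (F i) by [].
elim/big_ind2: _ => // [f a g b [Kf <-] [Kg <-]|i /KF //].
by split; [exact: KD|exact: opD].
Qed.

End PointwiseSums.

(** * Homogeneous polynomials and bounds by their coefficients *)

Section HomogeneousPolynomials.
Context {R : realType} {n : nat}.
Implicit Types (f g : 'rV[R[i]]_n -> R[i]) (z v : 'rV[R[i]]_n) (a h : R[i]) (m : nat)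
  (N r B : R) (l j : 'I_n).

(* [hp m N f]: [f] is a homogeneous polynomial function of degree [m] whose
   coefficients have absolute values summing up to at most [N]. *)
Inductive hp : nat -> R -> ('rV[R[i]]_n -> R[i]) -> Prop :=
| hp_cst a : hp 0 (cabs a) (fun=> a)
| hp_zero m : hp m 0 (fun=> 0)
| hp_coordM l m N f : hp m N f -> hp m.+1 N (fun z => z 0 l * f z)
| hpD m N N' f g : hp m N f -> hp m N' g -> hp m (N + N') (fun z => f z + g z)
| hp_le m N N' f : N <= N' -> hp m N f -> hp m N' f.

Lemma hp_eq m N f g : f =1 g -> hp m N f -> hp m N g.
Proof. by move=> /funext ->. Qed.

Lemma hp_ge0 m N f : hp m N f -> 0 <= N.
Proof.
elim=> {m N f} [a|//|//|m N N' f g _ h1 _ h2|m N N' f h _ h1].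
- exact: cabs_ge0.
- exact: addr_ge0.
- exact: le_trans h.
Qed.

Lemma hp_sm m N f : hp m N f -> sm f.
Proof.
elim=> {m N f} [a|m|l m N f _ h|m N N' f g _ h1 _ h2|//].
- exact: sm_cst.
- exact: sm_cst.
- exact: sm_coordM.
- exact: smD.
Qed.

Lemma hpZ a m N f : hp m N f -> hp m (cabs a * N) (fun z => a * f z).
Proof.
elim=> {m N f} [b|m|l m N f _ h|m N N' f g _ h1 _ h2|m N N' f h _ h1].
- by rewrite -cabsM; exact: hp_cst.
- by rewrite mulr0; apply: hp_eq (hp_zero m) => z; rewrite mulr0.
- by apply: hp_eq (hp_coordM l h) => z; rewrite mulrCA.
- by rewrite mulrDr; apply: hp_eq (hpD h1 h2) => z; rewrite mulrDr.
- by apply: hp_le h1; rewrite ler_wpM2l ?cabs_ge0.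
Qed.

Lemma hp_sum (I : Type) (s : seq I) (P : pred I) m (N : I -> R)
    (F : I -> 'rV[R[i]]_n -> R[i]) :
  (forall i, P i -> hp m (N i) (F i)) ->
  hp m (\sum_(i <- s | P i) N i) (fun z => \sum_(i <- s | P i) F i z).
Proof.
move=> H; elim: s => [|i s IH].
  by rewrite big_nil; apply: hp_eq (hp_zero m) => z; rewrite big_nil.
rewrite big_cons; case: ifPn => Pi.
  by apply: hp_eq (hpD (H i Pi) IH) => z; rewrite big_cons Pi.
by apply: hp_eq IH => z; rewrite big_cons (negPf Pi).
Qed.

Lemma hpB m N N' f g : hp m N f -> hp m N' g -> hp m (N + N') (fun z => f z - g z).
Proof.
move=> h1 h2; have := hpD h1 (hpZ (-1) h2).
rewrite cabsN cabs1 mul1r; apply: hp_eq => z; by rewrite mulN1r.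
Qed.

Lemma hp_pv s m N f : hp m N f -> hp m N (fun z => f (pv s z)).
Proof.
elim=> {m N f} [b|m|l m N f _ h|m N N' f g _ h1 _ h2|m N N' f h _ h1].
- exact: hp_cst.
- exact: hp_zero.
- by apply: hp_eq (hp_coordM (s l) h) => z; rewrite mxE.
- exact: hpD.
- exact: hp_le h1.
Qed.

Lemma hp_mono (e : mi n) : hp (msize e) 1 (fun z => mono e z).
Proof.
rewrite /msize /mono; elim: (index_enum _) => [|i s IH].
  by rewrite big_nil -cabs1; apply: hp_eq (hp_cst 1) => z; rewrite big_nil.
have H m : hp (m + \sum_(i <- s) e i)%N 1 (fun z => z 0 i ^+ m * \prod_(i <- s) z 0 i ^+ e i).
  elim: m => [|m IHm]; first by apply: hp_eq IH => z; rewrite mul1r.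
  by apply: hp_eq (hp_coordM i IHm) => z; rewrite exprS mulrA.
by rewrite big_cons; apply: hp_eq (H (e i)) => z; rewrite big_cons.
Qed.

Definition zbnd z r := forall l, cabs (z 0 l) <= r.

Lemma hp_bound m N f z r : hp m N f -> 0 <= r -> zbnd z r -> cabs (f z) <= N * r ^+ m.
Proof.
move=> hf r0 hz; elim: hf => {m N f} [a|m|l m N f hf h|m N N' f g _ h1 _ h2|m N N' f h hf h1].
- by rewrite expr0 mulr1.
- by rewrite cabs0 mul0r.
- rewrite cabsM exprS mulrCA; apply: ler_pM => //; exact: cabs_ge0.
- by apply: le_trans (cabsD _ _) _; rewrite mulrDl lerD.
- by apply: le_trans h1 _; rewrite ler_wpM2r ?exprn_ge0.
Qed.

(** Both sides carry an extra [r], which avoids the exponent [m - 1] and its exception at [m = 0].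
    The factor [r ^+ 2] in [hp_taylor] has the same purpose. *)
Lemma hp_lipschitz m N f z v h B r : hp m N f -> 0 <= r -> 0 <= B -> zbnd v B ->
  zbnd z r -> zbnd (z + h *: v) r ->
  cabs (f (z + h *: v) - f z) * r <= m%:R * N * (cabs h * B) * r ^+ m.
Proof.
move=> hf r0 B0 hv hz hz'.
elim: hf => {m N f} [a|m|l m N f hf IH|m N N' f g _ h1 _ h2|m N N' f hN hf h1].
- by rewrite subrr cabs0 !mul0r.
- by rewrite subrr cabs0 !mulr0 !mul0r.
- have -> : (z + h *: v) 0 l * f (z + h *: v) - z 0 l * f z =
    z 0 l * (f (z + h *: v) - f z) + h * v 0 l * f (z + h *: v).
    by rewrite !mxE; ring.
  apply: (@le_trans _ _ ((r * cabs (f (z + h *: v) - f z) + (cabs h * B) * (N * r ^+ m)) * r)).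
    rewrite ler_wpM2r //; apply: le_trans (cabsD _ _) _; rewrite !cabsM; apply: lerD.
      by rewrite ler_wpM2r ?cabs_ge0.
    apply: ler_pM; rewrite ?mulr_ge0 ?cabs_ge0 //; last exact: hp_bound.
    by rewrite ler_wpM2l ?cabs_ge0.
  rewrite mulrDl -mulrA -natr1 [r ^+ m.+1]exprS; apply: le_trans (lerD (ler_wpM2l r0 IH) (lexx _)) _.
  by rewrite le_eqVlt; apply/orP; left; apply/eqP; ring.
- have -> : f (z + h *: v) + g (z + h *: v) - (f z + g z) =
    (f (z + h *: v) - f z) + (g (z + h *: v) - g z) by ring.
  rewrite mulrDr !mulrDl; apply: le_trans (ler_wpM2r r0 (cabsD _ _)) _.
  by rewrite mulrDl lerD.
- apply: le_trans h1 _; rewrite ler_wpM2r ?exprn_ge0 // ler_wpM2r ?ler_wpM2l //.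
  by rewrite mulr_ge0 ?cabs_ge0.
Qed.

Lemma hp_taylor m N f z v h B r : hp m N f -> 0 <= r -> 0 <= B -> zbnd v B ->
  zbnd z r -> zbnd (z + h *: v) r ->
  cabs (f (z + h *: v) - f z - h * Dv v f z) * r ^+ 2 <=
    m%:R ^+ 2 * N * (cabs h * B) ^+ 2 * r ^+ m.
Proof.
move=> hf r0 B0 hv hz hz'.
elim: hf => {m N f} [a|m|l m N f hf IH|m N N' f g h1 IH1 h2 IH2|m N N' f hN hf h1].
- by rewrite derive_cst_sm mulr0 subrr subr0 cabs0 expr0n !mul0r.
- by rewrite derive_cst_sm mulr0 subrr subr0 cabs0 !mulr0 !mul0r.
- rewrite derive_coordM; last exact: hp_sm hf.
  have hB0 : 0 <= cabs h * B by rewrite mulr_ge0 ?cabs_ge0.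
  have N0 := hp_ge0 hf.
  set D := f _ - _ - _ in IH.
  have -> : (z + h *: v) 0 l * f (z + h *: v) - z 0 l * f z -
      h * (v 0 l * f z + z 0 l * Dv v f z) =
    z 0 l * D + h * v 0 l * (f (z + h *: v) - f z).
    by rewrite /D !mxE; ring.
  apply: (@le_trans _ _ (r * (cabs D * r ^+ 2) +
      r * ((cabs h * B) * (cabs (f (z + h *: v) - f z) * r)))).
    have -> : r * (cabs D * r ^+ 2) +
      r * ((cabs h * B) * (cabs (f (z + h *: v) - f z) * r)) =
      (r * cabs D + (cabs h * B) * cabs (f (z + h *: v) - f z)) * r ^+ 2 by ring.
    rewrite ler_wpM2r ?exprn_ge0 //; apply: le_trans (cabsD _ _) _; rewrite !cabsM.
    apply: lerD; first by rewrite ler_wpM2r ?cabs_ge0.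
    by rewrite ler_wpM2r ?cabs_ge0 // ler_wpM2l ?cabs_ge0.
  apply: le_trans (lerD (ler_wpM2l r0 IH)
    (ler_wpM2l r0 (ler_wpM2l hB0 (hp_lipschitz hf r0 B0 hv hz hz')))) _.
  rewrite [r ^+ m.+1]exprS -subr_ge0.
  (* The coefficient [m ^ 2] is cruder than the binomial one, but the induction only asks for
     [m ^ 2 + m <= (m + 1) ^ 2], and polynomial factors are harmless against a geometric series. *)
  have -> : m.+1%:R ^+ 2 * N * (cabs h * B) ^+ 2 * (r * r ^+ m) -
    (r * (m%:R ^+ 2 * N * (cabs h * B) ^+ 2 * r ^+ m) +
    r * (cabs h * B * (m%:R * N * (cabs h * B) * r ^+ m))) =
    (m%:R + 1) * N * (cabs h * B) ^+ 2 * (r * r ^+ m) by rewrite -natr1; ring.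
  by rewrite !mulr_ge0 ?exprn_ge0 ?addr_ge0 ?cabs_ge0.
- rewrite deriveD_sm; [|exact: hp_sm h1|exact: hp_sm h2].
  set D1 := f _ - _ - _ in IH1; set D2 := g _ - _ - _ in IH2.
  have -> : f (z + h *: v) + g (z + h *: v) - (f z + g z) -
      h * (Dv v f z + Dv v g z) = D1 + D2 by rewrite /D1 /D2; ring.
  rewrite mulrDr !mulrDl; apply: le_trans (ler_wpM2r (exprn_ge0 2 r0) (cabsD _ _)) _.
  by rewrite mulrDl lerD.
- apply: le_trans h1 _; rewrite ler_wpM2r ?exprn_ge0 // ler_wpM2r ?sqr_ge0 //.
  by rewrite ler_wpM2l ?sqr_ge0.
Qed.

Lemma hp_Dv_bound m N f z v B r : hp m N f -> 0 <= r -> 0 <= B -> zbnd v B -> zbnd z r ->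
  cabs (Dv v f z) * r <= m%:R * N * B * r ^+ m.
Proof.
move=> hf r0 B0 hv hz; elim: hf => {m N f} [a|m|l m N f hf IH|m N N' f g h1 IH1 h2 IH2|m N N' f hN hf h1].
- by rewrite derive_cst_sm cabs0 !mul0r.
- by rewrite derive_cst_sm cabs0 !mulr0 !mul0r.
- rewrite derive_coordM; last exact: hp_sm hf.
  apply: (@le_trans _ _ ((B * (N * r ^+ m) + r * cabs (Dv v f z)) * r)).
    rewrite ler_wpM2r //; apply: le_trans (cabsD _ _) _; rewrite !cabsM; apply: lerD.
      by apply: ler_pM; rewrite ?cabs_ge0 // (hp_bound hf).
    by rewrite ler_wpM2r ?cabs_ge0.
  rewrite mulrDl -(mulrA r) [r ^+ m.+1]exprS -natr1; apply: le_trans (lerD (lexx _) (ler_wpM2l r0 IH)) _.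
  by rewrite le_eqVlt; apply/orP; left; apply/eqP; ring.
- rewrite deriveD_sm; [|exact: hp_sm h1|exact: hp_sm h2].
  rewrite mulrDr !mulrDl; apply: le_trans (ler_wpM2r r0 (cabsD _ _)) _.
  by rewrite mulrDl lerD.
- apply: le_trans h1 _; rewrite ler_wpM2r ?exprn_ge0 //.
  by rewrite ler_wpM2r // ler_wpM2l.
Qed.

(** The vanishing for [m = 0] is carried along because [m.-1] is truncated: otherwise multiplying
    [T_j f] by a coordinate would give degree 1 where degree 0 is expected. Each unit of degree
    costs at most one copy of [f] and [n] reflected copies weighted by [k]. *)
Lemma hp_Td k j m N f : hp m N f ->
  (m = 0%N -> Td k j f = (fun=> 0)) /\
  hp m.-1 (m%:R * (1 + `|k| * n%:R) * N) (Td k j f).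
Proof.
elim=> {m N f} [a|m|l m N f hf [IH0 IH]|m N N' f g h1 [IH10 IH1] h2 [IH20 IH2]|m N N' f hN hf [IH0 IH]].
- have -> : Td k j (fun=> a) = fun=> 0 by apply/funext => z; rewrite Tj_cst.
  by split=> //; rewrite !mul0r; exact: hp_zero.
- have -> : Td k j (fun=> 0) = fun=> 0 by apply/funext => z; rewrite Tj_cst.
  by split=> //; rewrite !mulr0; exact: hp_zero.
- split=> //=.
  have sf := hp_sm hf; have N0 := hp_ge0 hf.
  have -> : Td k j (fun z => z 0 l * f z) = fun z => z 0 l * Td k j f z +
   (if l == j then f z + rc k * \sum_(i < n | i != j) f (swapv i j z)
    else - (rc k * f (swapv l j z))) by apply/funext => z; rewrite Tj_mul.
  have H1 : hp m (m%:R * (1 + `|k| * n%:R) * N) (fun z => z 0 l * Td k j f z).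
    case: (m) IH0 IH => [|m'] IH0 IH; last exact: hp_coordM.
    by rewrite IH0 // !mul0r; apply: hp_eq (hp_zero 0) => z; rewrite mulr0.
  have H2 : hp m ((1 + `|k| * n%:R) * N) (fun z => if l == j
     then f z + rc k * \sum_(i < n | i != j) f (swapv i j z)
     else - (rc k * f (swapv l j z))).
    case: (l == j); last first.
      apply: (@hp_le _ (cabs (- rc k) * N)); last first.
        by apply: hp_eq (hpZ (- rc k) (hp_pv (tperm l j) hf)) => z; rewrite mulNr.
      rewrite cabsN cabs_rc ler_wpM2r //.
      have : 1 <= n%:R :> R by rewrite ler1n (leq_ltn_trans _ (ltn_ord l)).
      move=> n1; rewrite (@le_trans _ _ (`|k| * n%:R)) ?lerDr //.
      by rewrite ler_peMr.
    rewrite mulrDl mul1r; apply: hpD => //.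
    rewrite -mulrA -cabs_rc; apply: hpZ.
    apply: (@hp_le _ (\sum_(i < n | i != j) N)).
      rewrite sumr_const -[X in X <= _]mulr_natl ler_wpM2r // ler_nat.
      by rewrite (leq_trans (max_card _)) ?card_ord.
    by apply: hp_sum => i _; exact: (hp_pv (tperm i j) hf).
  by rewrite -natr1 -mulrA mulrDl mul1r mulrA; apply: hpD.
- have -> : Td k j (fun z => f z + g z) = fun z => Td k j f z + Td k j g z.
    by apply/funext => z; rewrite TjD //; [exact: hp_sm h1|exact: hp_sm h2].
  split=> [m0|]; first by rewrite IH10 // IH20 //; apply/funext => z; rewrite addr0.
  by rewrite mulrDr; apply: hpD.
- split=> //; apply: hp_le IH; rewrite ler_wpM2l // mulr_ge0 // addr_ge0 // mulr_ge0 //.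
Qed.

End HomogeneousPolynomials.

(** * Power series on polydiscs and the termwise action of Dunkl operators *)

Section GeometricBounds.
Context {R : realType}.
Implicit Types (u : nat -> R[i]) (C t s r : R).

Lemma natmul_geometric_bounded t : 0 <= t -> t < 1 ->
  exists2 C : R, 0 <= C & forall M, M%:R * t ^+ M <= C.
Proof.
move=> t0 t1; have d0 : 0 < 1 - t by rewrite subr_gt0.
exists ((1 - t)^-1); first by rewrite invr_ge0 ltW.
move=> M; rewrite -[leRHS]mul1r ler_pdivlMr //.
have x1 m : t ^+ m <= 1 by apply: exprn_ile1 => //; exact: ltW.
(* This sharper form passes through the induction; it says that [M] times the smallest term is at
   most the geometric sum. *)
suff : M%:R * t ^+ M * (1 - t) <= 1 - t ^+ M.
  by move/le_trans; apply; rewrite gerBl exprn_ge0.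
elim: M => [|M IH]; first by rewrite !mul0r expr0 subrr.
have := ler_wpM2l t0 IH; have := ler_wpM2r (ltW d0) (x1 M.+1).
rewrite exprS -natr1; nra.
Qed.

Lemma natmul_geometric t s : 0 <= t -> t < s ->
  exists2 C : R, 0 <= C & forall M, M%:R * t ^+ M <= C * s ^+ M.
Proof.
move=> t0 ts; have s0 : 0 < s by exact: le_lt_trans ts.
have [|C C0 H] := @natmul_geometric_bounded (t / s) (divr_ge0 t0 (ltW s0)).
  by rewrite ltr_pdivrMr // mul1r.
exists C => // M; have := H M.
by rewrite expr_div_n mulrA ler_pdivrMr ?exprn_gt0.
Qed.

Lemma natpow_geometric (Q : nat) s (K : R) : 0 <= s -> s < K ->
  exists2 C : R, 0 <= C & forall m, m.+1%:R ^+ Q * s ^+ m <= C * K ^+ m.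
Proof.
move=> s0; elim: Q K => [|Q IH] K sK.
  exists 1 => // m; rewrite expr0 !mul1r.
  have K0 : 0 <= K by apply: ltW; apply: le_lt_trans sK.
  by apply: lerXn2r; rewrite ?nnegrE // ltW.
pose r := (s + K) / 2.
have sr : s < r by rewrite /r; lra.
have rK : r < K by rewrite /r; lra.
have r0 : 0 <= r by lra.
have [C C0 H] := IH r sr; have [C' C0' H'] := natmul_geometric r0 rK.
exists (C * (C' + 1)); first by rewrite mulr_ge0 ?addr_ge0.
move=> m; rewrite exprS -mulrA; apply: le_trans (ler_wpM2l _ (H m)) _ => //.
rewrite mulrCA -mulrA ler_wpM2l // -natr1 mulrDl mul1r mulrDl mul1r lerD //.
by rewrite lerXn2r ?nnegrE ?(ltW rK) // (le_trans r0 (ltW rK)).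
Qed.

Lemma natsqr_geometric t s : 0 <= t -> t < s ->
  exists2 C : R, 0 <= C & forall M, M%:R ^+ 2 * t ^+ M <= C * s ^+ M.
Proof.
move=> t0 ts; have [C C0 H] := natpow_geometric 2 t0 ts.
exists C => // M; apply: le_trans (H M).
by rewrite ler_wpM2r ?exprn_ge0 // lerXn2r ?nnegrE // ler_nat.
Qed.

Definition gb u := exists C t : R, geobounded u C t.

Lemma gb_le u C t (c : nat) : 0 <= C -> 0 < t -> t < 1 ->
  (forall m, cabs (u m) <= C * t ^+ (m - c)) -> geobounded u (C / t ^+ c) t.
Proof.
move=> C0 t0 t1 H; split=> //; first by rewrite divr_ge0 ?exprn_ge0 // ltW.
  exact: ltW.
move=> m; apply: le_trans (H m) _; rewrite -mulrA ler_wpM2l //.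
rewrite mulrC ler_pdivlMr ?exprn_gt0 // -exprD.
by apply: ler_wiXn2l; rewrite ?ltW //; lia.
Qed.

Lemma gbD u v : gb u -> gb v -> gb (fun m => u m + v m).
Proof.
move=> [C [t [C0 t0 t1 H]]] [C' [t' [C0' t0' t1' H']]].
exists (C + C'), (Num.max t t'); split.
- exact: addr_ge0.
- by rewrite le_max t0.
- by rewrite gt_max t1 t1'.
move=> m; apply: le_trans (cabsD _ _) _; rewrite mulrDl; apply: lerD.
  apply: le_trans (H m) _; rewrite ler_wpM2l // lerXn2r ?nnegrE ?le_max ?t0 ?lexx //.
apply: le_trans (H' m) _; rewrite ler_wpM2l // lerXn2r ?nnegrE ?le_max ?t0 ?lexx ?orbT //.
Qed.

Lemma gbZ a u : gb u -> gb (fun m => a * u m).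
Proof.
move=> [C [t [C0 t0 t1 H]]]; exists (cabs a * C), t; split=> //.
  by rewrite mulr_ge0 ?cabs_ge0.
by move=> m; rewrite cabsM -mulrA ler_wpM2l ?cabs_ge0.
Qed.

Lemma gb0 : gb (fun=> 0).
Proof.
exists 0, 0; split=> //; move=> m; by rewrite cabs0 mul0r.
Qed.

Lemma csumDg u v : gb u -> gb v -> csum (fun m => u m + v m) = csum u + csum v.
Proof. by move=> [C [t h]] [C' [t' h']]; exact: csumD h h'. Qed.

Lemma csumZg a u : gb u -> csum (fun m => a * u m) = a * csum u.
Proof. by move=> [C [t h]]; exact: csumZ h. Qed.

Lemma csum_sumg (I : Type) (s : seq I) (P : pred I) (u : I -> nat -> R[i]) :
  (forall i, P i -> gb (u i)) ->
  gb (fun m => \sum_(i <- s | P i) u i m) /\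
  csum (fun m => \sum_(i <- s | P i) u i m) = \sum_(i <- s | P i) csum (u i).
Proof.
move=> H; split; first by apply: fsum_ind => //; [exact: gb0|exact: gbD].
apply: (@fsum_additive _ _ _ gb csum) => //; [exact: gb0|exact: gbD|exact: csum0|exact: csumDg].
Qed.

End GeometricBounds.

Section TermwiseDunkl.
Context {R : realType} {n : nat}.
Implicit Types (f : 'rV[R[i]]_n -> R[i]) (z v : 'rV[R[i]]_n) (F : nat -> 'rV[R[i]]_n -> R[i])
  (c m : nat) (r K k : R).

(* Coefficient growth of the homogeneous expansion [sum_m F m], where [F m] has
   degree [m - c]; it makes the series converge on the polydisc [pdom K]. *)
Definition pser c K F := forall K', K < K' -> exists2 C, 0 <= C &
  forall m, hp (m - c) (C * K' ^+ (m - c)) (F m).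

Definition pdom K z := exists r, [/\ 0 < r, zbnd z r & K * r < 1].

Lemma pdom_pv K s z : pdom K z -> pdom K (pv s z).
Proof. by move=> [r [r0 H Hr]]; exists r; split=> // l; rewrite mxE. Qed.

Lemma zbnd_ex z : exists2 B, 0 <= B & zbnd z B.
Proof.
exists (\sum_l cabs (z 0 l)); first by apply: sumr_ge0 => l _; exact: cabs_ge0.
move=> l; rewrite (bigD1 l) //= lerDl; apply: sumr_ge0 => i _; exact: cabs_ge0.
Qed.

(** Room on both sides: [K < K'] because [pser] only speaks of rates above [K], and [r < r1] so that
    small displacements of [z] remain where the series is still dominated geometrically. *)
Lemma pdom_nbhs K z : 0 <= K -> pdom K z ->
  exists K' r r1, [/\ K < K', 0 < r < r1, zbnd z r, K' * r1 < 1 & 0 < K'].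
Proof.
move=> K0 [r [r0 hz Kr]].
have [r1 /andP[rr1 Kr1]] : exists r1, (r < r1) && (K * r1 < 1).
  exists (r + (1 - K * r) / (2 * (K + 1))).
  have k1 : 0 < 2 * (K + 1) by lra.
  rewrite ltrDl divr_gt0 ?subr_gt0 //= mulrDr.
  have : K * ((1 - K * r) / (2 * (K + 1))) < 1 - K * r.
    by rewrite mulrA ltr_pdivrMr //; nra.
  lra.
have r10 : 0 < r1 by exact: lt_trans rr1.
exists (K + (1 - K * r1) / (2 * r1)), r, r1.
have d0 : 0 < (1 - K * r1) / (2 * r1) by rewrite divr_gt0 ?subr_gt0 // mulr_gt0.
split=> //; rewrite ?ltrDl ?r0 ?ltr_wpDl //.
have -> : (K + (1 - K * r1) / (2 * r1)) * r1 = (K * r1 + 1) / 2 by field; rewrite gt_eqF.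
lra.
Qed.

Lemma pser_term_bound c K F K' r : pser c K F -> K < K' -> 0 < K' -> 0 < r -> K' * r < 1 ->
  forall z, zbnd z r -> gb (fun m => F m z).
Proof.
move=> hF KK' K'0 r0 K'r z hz; have [C C0 H] := hF _ KK'.
have t0 : 0 < K' * r by rewrite mulr_gt0.
exists (C / (K' * r) ^+ c), (K' * r); apply: gb_le => // m.
apply: le_trans (hp_bound (H m) (ltW r0) hz) _.
by rewrite -mulrA -exprMn.
Qed.

(** The Taylor remainders of the terms are summed. Each is at most a constant times
    [M ^ 2 * (K' * r1) ^ M * cabs h ^ 2] with [M = m - c]; passing from the ratio [K' * r1] to [s],
    halfway to 1, absorbs the polynomial factor, so the sum is still quadratic in [h]. *)
Lemma isD_csum c K F f z v : 0 <= K -> pser c K F ->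
  (forall z, pdom K z -> f z = csum (fun m => F m z)) -> pdom K z ->
  gb (fun m => Dv v (F m) z) /\ isD f z v (csum (fun m => Dv v (F m) z)).
Proof.
move=> K0 hF hf hz.
have [K' [r [r1 [KK' /andP[r0 rr1] hzr K'r1 K'0]]]] := pdom_nbhs K0 hz.
have [B B0 hB] := zbnd_ex v.
have r10 : 0 < r1 by exact: lt_trans rr1.
have hzr1 : zbnd z r1 by move=> l; apply: le_trans (hzr l) (ltW rr1).
have t0 : 0 < K' * r1 by rewrite mulr_gt0.
pose s := (K' * r1 + 1) / 2.
have ts : K' * r1 < s by rewrite /s; lra.
have s1 : s < 1 by rewrite /s; lra.
have s0 : 0 < s by exact: lt_trans ts.
have [C C0 H] := hF _ KK'.
have [C1 C10 H1] := natmul_geometric (ltW t0) ts.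
have [C2 C20 H2] := natsqr_geometric (ltW t0) ts.
have gD : gb (fun m => Dv v (F m) z).
  exists ((C * B * C1 / r1) / s ^+ c), s; apply: gb_le => //.
    by rewrite !mulr_ge0 // invr_ge0 ltW.
  move=> m; rewrite mulrAC ler_pdivlMr //.
  apply: le_trans (hp_Dv_bound (H m) (ltW r10) B0 hB hzr1) _.
  have -> : (m - c)%:R * (C * K' ^+ (m - c)) * B * r1 ^+ (m - c) =
    C * B * ((m - c)%:R * (K' * r1) ^+ (m - c)) by rewrite exprMn; ring.
  by rewrite -[leRHS]mulrA ler_wpM2l // mulr_ge0.
split=> //.
(* The admissible radius keeps [cabs h * B] below [r1 - r]; the [+ 1] covers [B = 0]. *)
exists (C * B ^+ 2 * C2 / r1 ^+ 2 / s ^+ c / (1 - s)), ((r1 - r) / (B + 1)).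
have B1 : 0 < B + 1 by rewrite ltr_wpDl.
split; first by rewrite divr_gt0 ?subr_gt0.
move=> h; rewrite ltr_pdivlMr // => hh.
have hzh : zbnd (z + h *: v) r1.
  move=> l; rewrite !mxE; apply: le_trans (cabsD _ _) _; rewrite cabsM.
  have := hzr l; have := ler_wpM2l (cabs_ge0 h) (hB l); have := cabs_ge0 h; nra.
have ch := cabs_ge0 h; have r1w := ltW r10; have s0w := ltW s0.
have dh : pdom K (z + h *: v).
  exists r1; split=> //; apply: le_lt_trans K'r1; rewrite ler_wpM2r // ltW //.
have g1 := pser_term_bound hF KK' K'0 r10 K'r1 hzh.
have g2 := pser_term_bound hF KK' K'0 r10 K'r1 hzr1.
have -> : f (z + h *: v) - f z - h * csum (fun m => Dv v (F m) z) =
  csum (fun m => F m (z + h *: v) - F m z - h * Dv v (F m) z).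
  rewrite !hf //.
  have g3 := gbZ (-1) g2; have g4 := gbZ (- h) gD; have g5 := gbD g1 g3.
  have : csum (fun m => F m (z + h *: v) + -1 * F m z + - h * Dv v (F m) z) =
    csum (fun m => F m (z + h *: v)) + -1 * csum (fun m => F m z) +
    - h * csum (fun m => Dv v (F m) z).
    by rewrite (csumDg g5 g4) (csumDg g1 g3) (csumZg _ g2) (csumZg _ gD).
  rewrite mulN1r mulNr => <-.
  by apply: eq_csum => m; rewrite mulN1r mulNr.
have G : geobounded (fun m => F m (z + h *: v) - F m z - h * Dv v (F m) z)
   ((C * B ^+ 2 * C2 / r1 ^+ 2 * cabs h ^+ 2) / s ^+ c) s.
  apply: gb_le => //.
    by repeat first [assumption | apply: mulr_ge0 | apply: exprn_ge0 | rewrite invr_ge0].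
  move=> m; rewrite -(ler_pM2r (exprn_gt0 2 r10)).
  apply: le_trans (hp_taylor (H m) (ltW r10) B0 hB hzr1 hzh) _.
  have -> : (m - c)%:R ^+ 2 * (C * K' ^+ (m - c)) * (cabs h * B) ^+ 2 * r1 ^+ (m - c) =
    C * B ^+ 2 * cabs h ^+ 2 * ((m - c)%:R ^+ 2 * (K' * r1) ^+ (m - c)).
    by rewrite !exprMn; ring.
  have -> : C * B ^+ 2 * C2 / r1 ^+ 2 * cabs h ^+ 2 * s ^+ (m - c) * r1 ^+ 2 =
    C * B ^+ 2 * cabs h ^+ 2 * (C2 * s ^+ (m - c)) by field; rewrite gt_eqF.
  by rewrite ler_wpM2l // !mulr_ge0 ?exprn_ge0 ?cabs_ge0.
apply: le_trans (cabs_csum_le G) _.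
rewrite le_eqVlt; apply/orP; left; apply/eqP.
by field; rewrite !gt_eqF ?exprn_gt0 ?subr_gt0.
Qed.

(** Off a hyperplane the divided difference also uses the expansion at the reflected point, which
    lies in the same polydisc; on the hyperplane it is a directional derivative and [isD_csum]
    applies. *)
Lemma Td_csum k j c K F f z : 0 <= K -> pser c K F ->
  (forall z, pdom K z -> f z = csum (fun m => F m z)) -> pdom K z ->
  Td k j f z = csum (fun m => Td k j (F m) z).
Proof.
move=> K0 hF hf hz.
have hD v := (isD_csum v K0 hF hf hz).
have sF m : sm (F m).
  have K1 : K < K + 1 by rewrite ltrDl ltr01.
  by have [C C0 H] := hF _ K1; exact: hp_sm (H m).
have sf : sm_at f z by apply: sm_atP => v; eexists; exact: (hD v).2.
have gF y : pdom K y -> gb (fun m => F m y).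
  move=> /(pdom_nbhs K0)[K' [r [r1 [KK' /andP[r0 rr1] hzr K'r1 K'0]]]].
  have r10 : 0 < r1 by exact: lt_trans rr1.
  by apply: (pser_term_bound hF KK' K'0 r10 K'r1) => l; apply: le_trans (hzr l) (ltW rr1).
have hdq i : gb (fun m => dq j i (F m) z) /\ dq j i f z = csum (fun m => dq j i (F m) z).
  have [e|ne] := pselect (z 0 j = z 0 i).
    have -> : (fun m => dq j i (F m) z) = (fun m => Dv (udiff j i) (F m) z).
      by apply/funext => m; rewrite dq_eq.
    by split; [exact: (hD _).1|rewrite dq_eq // (isD_derive (hD _).2)].
  have g1 : gb (fun m => F m z) by exact: gF.
  have dz' : pdom K (swapv j i z) by exact: (pdom_pv (tperm j i)).
  have g2 : gb (fun m => F m (swapv j i z)) by exact: gF.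
  have E : (fun m => dq j i (F m) z) = (fun m => (z 0 j - z 0 i)^-1 *
     (F m z + (-1) * F m (swapv j i z))).
    by apply/funext => m; rewrite dq_ne // mulN1r mulrC.
  have g3 : gb (fun m => F m z + (-1) * F m (swapv j i z)) by apply: gbD => //; exact: gbZ.
  rewrite E; split; first exact: gbZ.
  rewrite csumZg // csumDg //; last exact: gbZ.
  by rewrite csumZg // dq_ne // !hf // mulN1r mulrC.
rewrite TjE // (isD_derive (hD _).2).
have [gs es] := csum_sumg (index_enum 'I_n) (P := fun i => i != j)
  (u := fun i m => dq j i (F m) z) (fun i _ => (hdq i).1).
have -> : \sum_(i < n | i != j) dq j i f z = csum (fun m => \sum_(i < n | i != j) dq j i (F m) z).
  by rewrite es; apply: eq_bigr => i _; exact: (hdq i).2.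
rewrite -csumZg // -csumDg //; [|exact: (hD _).1|exact: gbZ].
by apply: eq_csum => m; rewrite (TjE k j (sF m z)).
Qed.

(** The degree factor produced by [T_j] is absorbed between [K1] and [K2]. The limiting rate [K]
    does not change, which is why the operators can be iterated on the same polydisc. *)
Lemma pser_Td k j c K F : 0 <= K -> pser c K F -> pser c.+1 K (fun m => Td k j (F m)).
Proof.
move=> K0 hF K2 KK2; pose K1 := (K + K2) / 2.
have K1K : K < K1 by rewrite /K1; lra.
have K1K2 : K1 < K2 by rewrite /K1; lra.
have K10 : 0 < K1 by exact: le_lt_trans K1K.
have K20 : 0 < K2 by exact: lt_trans K1K2.
have [C C0 H] := hF _ K1K.
have [C1 C10 H1] := natmul_geometric (ltW K10) K1K2.
have k0 : 0 <= 1 + `|k| * n%:R by rewrite addr_ge0 // mulr_ge0.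
exists ((1 + `|k| * n%:R) * C * C1 * K2); first by rewrite !mulr_ge0 // ltW.
move=> m; have [h0 h1] := hp_Td k j (H m); rewrite subnS.
case E : (m - c)%N h0 h1 => [|M] h0 h1 /=.
  rewrite h0 //; apply: hp_le (hp_zero 0); rewrite !mulr_ge0 // ltW //.
apply: hp_le h1; rewrite /=.
have -> : M.+1%:R * (1 + `|k| * n%:R) * (C * K1 ^+ M.+1) =
   (1 + `|k| * n%:R) * C * (M.+1%:R * K1 ^+ M.+1) by ring.
have -> : (1 + `|k| * n%:R) * C * C1 * K2 * K2 ^+ M =
   (1 + `|k| * n%:R) * C * (C1 * K2 ^+ M.+1) by rewrite exprS; ring.
by rewrite ler_wpM2l // mulr_ge0.
Qed.

Lemma foldr_Td_csum k (s : seq 'I_n) c K F f : 0 <= K -> pser c K F ->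
  (forall z, pdom K z -> f z = csum (fun m => F m z)) ->
  pser (c + size s) K (fun m => foldr (fun j g => Td k j g) (F m) s) /\
  forall z, pdom K z -> foldr (fun j g => Td k j g) f s z =
    csum (fun m => foldr (fun j g => Td k j g) (F m) s z).
Proof.
move=> K0 hF hf; elim: s => [|j s [IH1 IH2]] /=; first by rewrite addn0.
rewrite addnS; split; first exact: pser_Td.
by move=> z hz; exact: (Td_csum k j K0 IH1 IH2 hz).
Qed.

End TermwiseDunkl.

(** * Compositions: ranks of parts, spectrum and cyclic shift *)

Section Rank.
Context {n : nat}.
Implicit Types (e x : mi n) (i j l : 'I_n) (s : 'S_n).

(** Positions are listed by decreasing part, ties from left to right. [mrank] is the place in this
    list, counted from 0, and is the multiple of [k] subtracted in [etabar]. *)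
Definition before e i j := (e j < e i)%N || ((e i == e j) && (i < j)%N).

Definition mrank e j := #|[set i | before e i j]|.

Lemma before_irr e i : before e i i = false.
Proof. by rewrite /before !ltnn andbF. Qed.

Lemma before_trans e : transitive (before e).
Proof. by move=> j i l; rewrite /before; lia. Qed.

Lemma before_total e i j : i != j -> before e i j || before e j i.
Proof. by rewrite -val_eqE /before /=; lia. Qed.

Lemma mrank_lt e i j : before e i j -> (mrank e i < mrank e j)%N.
Proof.
move=> h; apply: proper_card; apply/properP; split.
  by apply/fintype.subsetP => l; rewrite !inE => /before_trans; apply.
by exists i; rewrite !inE ?before_irr.
Qed.

Lemma mrank_inj e : injective (mrank e).
Proof.
move=> i j E; apply/eqP/negPn/negP => /(before_total e)/orP[] /mrank_lt;
by rewrite E ltnn.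
Qed.

Lemma before_mrank e i j : before e i j = (mrank e i < mrank e j)%N.
Proof.
apply/idP/idP => [/mrank_lt //|h].
have ij : i != j by apply: contraTneq h => ->; rewrite ltnn.
by case/orP: (before_total e ij) => // /mrank_lt; rewrite ltnNge ltnW.
Qed.

Lemma mrank_bound e j : (mrank e j < n)%N.
Proof.
rewrite -[X in (_ < X)%N](card_ord n) -cardsT; apply: proper_card.
by apply/properP; split=> //; exists j; rewrite !inE ?before_irr.
Qed.

Definition mrank_ord e j : 'I_n := Ordinal (mrank_bound e j).

Lemma mrank_ord_inj e : injective (mrank_ord e).
Proof. by move=> i j [] /mrank_inj. Qed.

Definition rperm e : 'S_n := perm (@mrank_ord_inj e).

Lemma rpermE e j : rperm e j = mrank e j :> nat.
Proof. by rewrite permE. Qed.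

Lemma pactE s e i : pact s e (s i) = e i.
Proof. by rewrite ffunE permK. Qed.

Lemma perm_eq_pact s e : perm_eq [seq pact s e j | j <- enum 'I_n] [seq e j | j <- enum 'I_n].
Proof.
have -> : [seq pact s e j | j <- enum 'I_n] = [seq e j | j <- [seq (s^-1)%g j | j <- enum 'I_n]].
  by rewrite -[RHS]map_comp; apply: eq_map => j /=; rewrite ffunE.
apply: perm_map; apply: uniq_perm; rewrite ?enum_uniq ?(map_inj_uniq perm_inj) ?enum_uniq //.
move=> j; rewrite mem_enum; apply/mapP; exists (s j); rewrite ?mem_enum //.
by rewrite permK.
Qed.

Lemma etaplus_pact s e : etaplus (pact s e) = etaplus e.
Proof.
apply/ffunP => i; rewrite !ffunE; congr (nth _ _ _).
apply/perm_sortP; rewrite ?perm_eq_pact //.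
- by move=> a b; rewrite /geq /= leq_total.
- by move=> a b c; rewrite /geq /=; lia.
- by move=> a b; rewrite /geq /=; lia.
Qed.

Lemma etaplus_id e : (forall i j, (i < j)%N -> (e j <= e i)%N) -> etaplus e = e.
Proof.
move=> he; apply/ffunP => i; rewrite ffunE sorted_sort.
- by rewrite (nth_map i) ?size_enum_ord // nth_ord_enum.
- by move=> a b c; rewrite /geq /=; lia.
rewrite sorted_map; apply: (@sub_sorted _ (fun i j : 'I_n => (i < j)%N)).
  by move=> a b /= ab; rewrite /geq /= he.
by have := iota_ltn_sorted 0 n; rewrite -val_enum_ord sorted_map; exact.
Qed.

Lemma etaplus_rperm e : etaplus e = pact (rperm e) e.
Proof.
rewrite -(etaplus_pact (rperm e)) etaplus_id // => i j ij; rewrite !ffunE.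
have : before e ((rperm e)^-1%g i) ((rperm e)^-1%g j).
  by rewrite before_mrank -!rpermE !permKV.
by rewrite /before; lia.
Qed.

Lemma etaplus_mrank e j : etaplus e (rperm e j) = e j.
Proof. by rewrite etaplus_rperm pactE. Qed.

Lemma etaplus_noninc e i j : (i <= j)%N -> (etaplus e j <= etaplus e i)%N.
Proof.
rewrite leq_eqVlt => /orP[/eqP/val_inj -> //|ij].
rewrite etaplus_rperm !ffunE.
have : before e ((rperm e)^-1%g i) ((rperm e)^-1%g j).
  by rewrite before_mrank -!rpermE !permKV.
by rewrite /before; lia.
Qed.

(** Expressions in the pairs (rank, part) depend on the sorted composition only; this is the source
    of every permutation invariance below. *)
Lemma big_mrank (T : Type) (idx : T) (op : Monoid.com_law idx) (F : nat -> nat -> T) e :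
  \big[op/idx]_(j < n) F (mrank e j) (e j) = \big[op/idx]_(i < n) F i (etaplus e i).
Proof.
rewrite [RHS](reindex_inj (@perm_inj _ (rperm e))) /=.
by apply: eq_bigr => j _; rewrite etaplus_mrank rpermE.
Qed.

Lemma msize_etaplus e : msize (etaplus e) = msize e.
Proof. by rewrite /msize -(@big_mrank _ _ _ (fun _ m => m) e). Qed.

Lemma etabarE (R : realType) (k : R) e j :
  etabar k e j = (e j)%:R - k * (mrank e j)%:R.
Proof.
rewrite /etabar -addrA -opprD -mulrDr -natrD; congr (_ - _ * _%:R).
rewrite -cardsUI [X in (_ + X)%N](_ : _ = 0%N) ?addn0; last first.
  by apply/eqP; rewrite cards_eq0; apply/eqP/setP => i; rewrite !inE; lia.
by apply: eq_card => i; rewrite !inE /before; case: (ltngtP i j) => [||/val_inj ->]; lia.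
Qed.

Lemma etabar_before (R : realType) (k : R) e i j : 0 <= k -> before e i j ->
  (e i)%:R - (e j)%:R + k <= etabar k e i - etabar k e j :> R.
Proof.
move=> k0 /mrank_lt h; rewrite !etabarE.
have : k * ((mrank e i)%:R + 1) <= k * (mrank e j)%:R.
  by rewrite ler_wpM2l // natr1 ler_nat.
lra.
Qed.

(** Simplicity of the joint spectrum. For [k > 0] the order of the eigenvalues recovers [before],
    hence the ranks, hence the parts; for [k = 0] the eigenvalues are the parts themselves. *)
Lemma etabar_inj (R : realType) (k : R) e x : 0 <= k ->
  etabar k e =1 etabar k x -> e = x.
Proof.
move=> k0 E; move: k0; rewrite le_eqVlt => /orP[/eqP k0|k0].
  apply/ffunP => j; have := E j; rewrite !etabarE -k0 !mul0r !subr0.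
  by move/eqP; rewrite eqr_nat => /eqP.
have H y i j : before y i j = (etabar k y j < etabar k y i).
  have lt i' j' : before y i' j' -> etabar k y j' < etabar k y i'.
    move=> b; have := etabar_before (ltW k0) b.
    have : (y j')%:R <= (y i')%:R :> R by rewrite ler_nat; move: b; rewrite /before; lia.
    lra.
  apply/idP/idP => [/lt //|h].
  have ij : i != j by apply: contraTneq h => ->; rewrite ltxx.
  by case/orP: (before_total y ij) => // /lt; rewrite ltNge ltW.
have Er j : mrank e j = mrank x j.
  by apply: eq_card => i; rewrite !inE !H !E.
apply/ffunP => j; have := E j; rewrite !etabarE Er => /addIr/eqP.
by rewrite eqr_nat => /eqP.
Qed.

Lemma adj_tperm_lt i j l l' : j = i.+1 :> nat ->
  (l, l') != (i, j) -> (l, l') != (j, i) ->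
  (tperm i j l < tperm i j l')%N = (l < l')%N.
Proof.
rewrite !xpair_eqE -!val_eqE /= => ij.
by case: tpermP => [->|->|/eqP + /eqP +]; case: tpermP => [->|->|/eqP + /eqP +];
  rewrite -?val_eqE /=; lia.
Qed.

Lemma mrank_adj e i j l : j = i.+1 :> nat -> (e i < e j)%N ->
  mrank (pact (tperm i j) e) l = mrank e (tperm i j l).
Proof.
move=> ij eij; rewrite /mrank -(card_preimset _ (@perm_inj _ (tperm i j))).
apply: eq_card => a; rewrite !inE -{1}(tpermK i j l) /before !pactE.
case: ltngtP => //= E; apply: adj_tperm_lt => //;
by apply/eqP => -[ai lj]; move: E eij; rewrite ai lj => ->; rewrite ltnn.
Qed.

Lemma etabar_adj (R : realType) (k : R) e i j l : j = i.+1 :> nat -> (e i < e j)%N ->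
  etabar k (pact (tperm i j) e) l = etabar k e (tperm i j l).
Proof. by move=> ij eij; rewrite !etabarE mrank_adj // ffunE tpermV. Qed.

Lemma etabar_adj_gap (R : realType) (k : R) e i j : 0 <= k -> j = i.+1 :> nat -> (e i < e j)%N ->
  (e j - e i)%N%:R + k <= etabar k e j - etabar k e i.
Proof.
move=> k0 ij eij; rewrite natrB; last exact: ltnW.
apply: etabar_before => //.
by rewrite /before eij.
Qed.

End Rank.

Section Cycle.
Context {n : nat}.
Implicit Types (e : mi n.+1) (i j l : 'I_n.+1).

Definition cyc : 'S_n.+1 := perm (@ordS_inj n.+1).

Lemma cycE i : cyc i = (if i == ord_max then 0 else i.+1)%N :> nat.
Proof.
rewrite permE /= -val_eqE /=; case: eqP => [->|ne]; first by rewrite modnn.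
by rewrite modn_small //; have := ltn_ord i; lia.
Qed.

Lemma cyc_max : cyc ord_max = ord0.
Proof. by apply: val_inj; rewrite /= cycE eqxx. Qed.

Lemma cycV0 : cyc^-1%g ord0 = ord_max.
Proof. by rewrite -cyc_max permK. Qed.

Lemma cycV_val i : cyc^-1%g i = (if i == ord0 then n else i.-1)%N :> nat.
Proof.
case: eqP => [->|/eqP i0]; first by rewrite cycV0.
have := cycE (cyc^-1%g i); rewrite permKV; case: eqP => [_ h|_ -> //].
by move: i0; rewrite -val_eqE /= h.
Qed.

Definition Phi e : mi n.+1 := [ffun i => e (cyc i) + (i == ord_max)]%N.

(** The truncated subtraction makes this total; it inverts [Phi] only where the last part is
    positive. *)
Definition down e : mi n.+1 := [ffun i => e (cyc^-1%g i) - (i == ord0)]%N.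

Lemma PhiK : cancel Phi down.
Proof.
move=> e; apply/ffunP => i; rewrite !ffunE permKV.
by rewrite -cycV0 (inj_eq perm_inj) addnK.
Qed.

Lemma downK e : (0 < e ord_max)%N -> Phi (down e) = e.
Proof.
move=> e0; apply/ffunP => i; rewrite !ffunE permK.
rewrite -cyc_max (inj_eq perm_inj); case: eqP => [->|_] /=; first by rewrite subnK.
by rewrite subn0 addn0.
Qed.

Lemma msize_Phi e : msize (Phi e) = (msize e).+1.
Proof.
rewrite /msize; under eq_bigr do rewrite ffunE.
rewrite big_split /= -[RHS]addn1; congr (_ + _)%N.
  by rewrite [RHS](reindex_inj (@perm_inj _ cyc)).
by rewrite (bigD1 ord_max) //= eqxx big1 // => i /negPf ->.
Qed.

Lemma msize_down e : (0 < e ord_max)%N -> msize e = (msize (down e)).+1.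
Proof. by move=> /downK e1; rewrite -{1}e1 msize_Phi. Qed.

(** A part [a] in the first place precedes exactly the other parts that are [<= a]; as [a + 1] in
    the last place it precedes exactly those that are [< a + 1]. *)
Lemma mrank_Phi e j : mrank (Phi e) j = mrank e (cyc j).
Proof.
rewrite /mrank -[in RHS](card_preimset _ (@perm_inj _ cyc)).
apply: eq_card => a; rewrite !inE /before !ffunE !cycE.
have := ltn_ord a; have := ltn_ord j.
by case: (altP (a =P ord_max)) => [->|]; case: (altP (j =P ord_max)) => [->|];
  rewrite -?val_eqE /= ?eqxx => *; lia.
Qed.

Lemma etabar_Phi (R : realType) (k : R) e j :
  etabar k (Phi e) j = etabar k e (cyc j) + (j == ord_max)%:R.
Proof. by rewrite !etabarE mrank_Phi ffunE natrD; ring. Qed.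

(** A composition with positive last part is [Phi] of one of smaller size. Otherwise the last
    nonzero part is carried to the end by adjacent swaps with zeros; [d] is its distance from the
    end. *)
Lemma mi_ind (P : mi n.+1 -> Prop) :
  P [ffun=> 0%N] -> (forall e, P e -> P (Phi e)) ->
  (forall e i j, j = i.+1 :> nat -> (e i < e j)%N -> P e -> P (pact (tperm i j) e)) ->
  forall e, P e.
Proof.
move=> P0 PPhi Padj e.
have [m] := ubnP (msize e); elim: m e => // m IHm e em.
have H d : forall e, (msize e <= m)%N -> (forall i : 'I_n.+1, (n - d < i)%N -> e i = 0%N) ->
    (0 < e (inord (n - d)))%N -> P e.
  elim: d => [|d IHd] {em e} e em ez ed.
    have e1 : (0 < e ord_max)%N by move: ed; rewrite subn0 (_ : inord n = ord_max) //; apply/val_inj; rewrite /= inordK.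
    by rewrite -(downK e1); apply/PPhi/IHm; rewrite -msize_down.
  have [dn|dn] := leqP n d.
    by apply: IHd => //; move: ez ed; rewrite (_ : (n - d.+1 = n - d)%N) //; lia.
  set i : 'I_n.+1 := inord (n - d.+1) in ed; pose j : 'I_n.+1 := inord (n - d).
  have vi : i = (n - d.+1)%N :> nat by rewrite inordK; lia.
  have vj : j = (n - d)%N :> nat by rewrite inordK; lia.
  have ij : j = i.+1 :> nat by lia.
  have ej : e j = 0%N by apply: ez; lia.
  have E : e = pact (tperm i j) (pact (tperm i j) e).
    by apply/ffunP => l; rewrite !ffunE tpermV tpermK.
  rewrite E; apply: Padj => //; first by rewrite !ffunE tpermV tpermL tpermR ej.
  apply: IHd.
  - by rewrite /msize (reindex_inj (@perm_inj _ (tperm i j))) /=; under eq_bigr do rewrite pactE.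
  - move=> l hl; rewrite ffunE tpermV tpermD; first by apply: ez; lia.
      by apply/eqP => El; move: hl; rewrite -El; lia.
    by apply/eqP => El; move: hl; rewrite -El; lia.
  - by rewrite -/j ffunE tpermV tpermR.
have [/eqP e0|] := boolP (e == [ffun=> 0%N]); first by rewrite e0.
move=> ne.
have [i0 hi0] : exists i, (0 < e i)%N.
  apply/existsP; apply: contraNT ne => /existsPn h.
  by apply/eqP/ffunP => i; rewrite ffunE; apply/eqP; move: (h i); rewrite lt0n negbK.
case: (@arg_maxnP _ i0 (fun i => 0 < e i)%N (fun i : 'I_n.+1 => nat_of_ord i) hi0) => i ei himax.
have En : (n - (n - i) = i)%N by have := ltn_ord i; lia.
apply: (H (n - i)%N); first by rewrite -ltnS.
  move=> l; rewrite En => il; apply/eqP; rewrite -leqn0 leqNgt; apply/negP => /himax.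
  by rewrite /geq /= leqNgt il.
by rewrite En inord_val.
Qed.

Lemma iter_down_val t e i : (t <= n.+1)%N ->
  iter t down e i =
  if (i < t)%N then (e (inord (n.+1 + i - t)) - 1)%N else e (inord (i - t)).
Proof.
elim: t i => [|t IH] i tn; first by rewrite /= subn0 inord_val.
rewrite iterS ffunE IH; last exact: ltnW.
rewrite cycV_val; case: eqP => [->|/eqP i0].
  have -> : (n < t)%N = false by lia.
  by rewrite /= addn0; congr (e (inord _) - _)%N; lia.
have i1 : (0 < i)%N by move: i0; rewrite -val_eqE /=; lia.
have -> : (i.-1 < t)%N = (i < t.+1)%N by lia.
by rewrite subn0; case: ifP => _; congr (e (inord _) - _)%N || congr (e (inord _)); lia.
Qed.

Lemma iter_down_max t e : (t <= n)%N -> iter t down e ord_max = e (inord (n - t)).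
Proof. by move=> tn; rewrite iter_down_val ?leqW //= ltnNge tn. Qed.

Lemma iter_down_minus1 e : iter n.+1 down e = minus1 e.
Proof.
apply/ffunP => i; rewrite iter_down_val // ltn_ord ffunE.
by congr (e _ - _)%N; rewrite addKn inord_val.
Qed.

Lemma etabar_down (R : realType) (k : R) e j : (0 < e ord_max)%N ->
  etabar k (down e) j = etabar k e (cyc^-1%g j) - (j == ord0)%:R.
Proof.
move=> /downK e1; rewrite -{2}e1 etabar_Phi permKV.
by rewrite -cycV0 (inj_eq perm_inj) addrK.
Qed.

End Cycle.

(** * Bruhat order and the triangularity order on exponents *)

Section Bruhat.
Context {n : nat}.
Implicit Types (e : mi n) (i j l p q : 'I_n) (s w u : 'S_n).

(** The inversions of the product inject into those of [w]: a pair is moved by the transposition if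
    its order is kept, and left alone otherwise. The pair [(p, q)], an inversion of [w], is not
    reached. *)
Lemma ninv_tperm_lt w p q : (p < q)%N -> (w q < w p)%N -> (ninv (tperm p q * w)%g < ninv w)%N.
Proof.
move=> pq wqp; set t := tperm p q.
pose phi (ab : 'I_n * 'I_n) := if (t ab.1 < t ab.2)%N then (t ab.1, t ab.2) else ab.
pose I w := [set ab : 'I_n * 'I_n | (ab.1 < ab.2)%N && (w ab.2 < w ab.1)%N].
have I' a b : ((a, b) \in I (t * w)%g) = (a < b)%N && (w (t b) < w (t a))%N.
  by rewrite inE /= !permM.
rewrite /ninv -/(I _) -/(I _).
have inj : {in I (t * w)%g &, injective phi}.
  move=> [a b] [a' b']; rewrite !I' /phi /= => /andP[ab _] /andP[ab' _].
  case: ifPn => h; case: ifPn => h' [].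
  - by move=> /perm_inj -> /perm_inj ->.
  - by move=> E1 E2; move: h' ; rewrite -E1 -E2 !tpermK; lia.
  - by move=> E1 E2; move: h ; rewrite E1 E2 !tpermK; lia.
  - by move=> -> ->.
rewrite -(card_in_imset inj); apply: proper_card; apply/properP; split.
  apply/fintype.subsetP => _ /imsetP[[a b] + ->]; rewrite I' /phi /= => /andP[ab wab].
  case: ifPn => h; rewrite inE /= ?h //= ab /=.
  move: ab wab h; rewrite /t.
  by case: tpermP => [->|->|_ _]; case: tpermP => [->|->|_ _]; lia.
exists (p, q); first by rewrite inE pq.
apply/negP => /imsetP[[a b]]; rewrite I' /phi /= => /andP[ab wab].
case: ifPn => h [E1 E2].
  have Ea : a = q by rewrite -(tpermK p q a) -/t -E1 tpermL.
  have Eb : b = p by rewrite -(tpermK p q b) -/t -E2 tpermR.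
  by move: ab; rewrite Ea Eb; lia.
by move: wab; rewrite -E1 -E2 /t tpermL tpermR; lia.
Qed.

Lemma pactM s u e : pact (s * u)%g e = pact u (pact s e).
Proof. by apply/ffunP => i; rewrite !ffunE invMg permM. Qed.

Lemma pact_id_of s e : (forall i, e (s i) = e i) -> pact s e = e.
Proof. by move=> h; apply/ffunP => i; rewrite ffunE -{2}(permKV s i) h. Qed.

Lemma pact_tperm_fix i j e : e i = e j -> pact (tperm i j) e = e.
Proof. by move=> eij; apply: pact_id_of => l; case: tpermP => // ->. Qed.

(* The shortest permutation sorting a composition is the one that is increasing
   on blocks of equal parts. *)
Definition winc e w := pact w (etaplus e) = e /\
  forall p q, (p < q)%N -> etaplus e p = etaplus e q -> (w p < w q)%N.

Lemma wmin_ex e : exists w, is_wmin e w.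
Proof.
have h0 : pact (rperm e)^-1%g (etaplus e) == e.
  by rewrite etaplus_rperm -pactM mulgV; apply/eqP/ffunP => i; rewrite ffunE invg1 perm1.
case: (@arg_minnP _ (rperm e)^-1%g (fun w => pact w (etaplus e) == e) (@ninv n) h0) => w hw hm.
exists w; rewrite /is_wmin hw; apply/forallP => w'; apply/implyP; exact: hm.
Qed.

Lemma wmin_winc e w : is_wmin e w -> winc e w.
Proof.
case/andP => /eqP he /forallP hm; split=> // p q pq E.
case: (ltngtP (w p) (w q)) => // [h|/val_inj/perm_inj h]; last by move: pq; rewrite h ltnn.
have Et := pact_tperm_fix E.
have := ninv_tperm_lt pq h; have := hm (tperm p q * w)%g.
by rewrite pactM Et he eqxx /=; lia.
Qed.

(** At the first disagreement [p], the smaller of the two values is taken by the other permutation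
    at some [q] in the same block of equal parts. [q < p] contradicts the choice of [p], and [q > p]
    contradicts the increase on the block. *)
Lemma winc_uniq e w w' : winc e w -> winc e w' -> w = w'.
Proof.
move=> hw hw'; apply/permP => p.
have [m] := ubnP (val p); elim: m p => // m IH p pm.
have key v v' : winc e v -> winc e v' -> (forall q, (q < p)%N -> v q = v' q) ->
    (v p < v' p)%N -> False.
  move=> [E1 h1] [E2 h2] Eq lt.
  pose q := (v'^-1)%g (v p).
  have vq : v' q = v p by rewrite /q permKV.
  have Ee : etaplus e q = etaplus e p.
    by rewrite -(pactE v' (etaplus e) q) vq E2 -{1}E1 pactE.
  case: (ltngtP q p) => [qp|pq|/val_inj qp].
  - by have := Eq q qp; rewrite vq => /perm_inj Z; move: qp; rewrite Z ltnn.
  - by have := h2 p q pq (esym Ee); rewrite vq; lia.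
  - by move: lt; rewrite -vq qp ltnn.
have IH' q : (q < p)%N -> w q = w' q by move=> qp; apply: IH; exact: leq_trans qp pm.
case: (ltngtP (w p) (w' p)) => [h|h|/val_inj //]; exfalso.
  exact: key hw hw' IH' h.
by apply: key hw' hw _ h => q /IH' ->.
Qed.

Lemma winc_wmin e w : winc e w -> is_wmin e w.
Proof.
by move=> hw; have [w0 h0] := wmin_ex e; rewrite (winc_uniq hw (wmin_winc h0)).
Qed.

(** Since neither of the two parts occurs strictly between [i] and [j], the swap keeps each block of
    equal parts increasing, so the product is again the shortest permutation and is one Bruhat step
    away. *)
Lemma swap_adj_connect e i j w : (i < j)%N -> (e j < e i)%N ->
  (forall l, (i < l < j)%N -> e l != e i /\ e l != e j) ->
  winc e w -> winc (pact (tperm i j) e) (w * tperm i j)%g /\ bstep w (w * tperm i j)%g.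
Proof.
move=> ij eij hb [E h].
have Ew p : e (w p) = etaplus e p by rewrite -{1}E pactE.
split.
  split; rewrite etaplus_pact; first by rewrite pactM E.
  move=> p q pq Epq; have := h p q pq Epq; rewrite !permM.
  have Eab : e (w p) = e (w q) by rewrite !Ew.
  move: Eab; case: tpermP => [->|->|/eqP + /eqP +]; case: tpermP => [->|->|/eqP + /eqP +];
    rewrite -?val_eqE /= => *; try lia.
  - have := hb (w q); lia.
  - have := hb (w p); lia.
apply/existsP; exists i; apply/existsP; exists j; rewrite eqxx /=.
pose p := (w^-1)%g i; pose q := (w^-1)%g j.
have pq : (p < q)%N.
  rewrite ltnNge; apply/negP => /(etaplus_noninc e); rewrite -!Ew /p /q !permKV; lia.
have Et : (w * tperm i j = tperm p q * w)%g.
  by rewrite /p /q -tpermJ conjgE invgK !mulgA mulgKV.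
have := @ninv_tperm_lt (w * tperm i j)%g p q pq.
rewrite !permM /p /q !permKV tpermL tpermR => /(_ ij).
by rewrite {1}Et mulgA tperm2 mul1g.
Qed.

Lemma tpermIf i j l : tperm i j l = if l == i then j else if l == j then i else l.
Proof.
by case: tpermP => [->|->|/eqP/negPf -> /eqP/negPf -> //]; rewrite eqxx //; case: eqP => // ->.
Qed.

Lemma pact_tpermE i j e l : pact (tperm i j) e l = e (tperm i j l).
Proof. by rewrite ffunE tpermV. Qed.

(** If a part strictly between equals one of the two exchanged parts, two shorter swaps through its
    position have the same effect on [e]; otherwise a single step suffices. The induction is on the
    distance [j - i]. *)
Lemma swap_connect e i j w : (i < j)%N -> (e j < e i)%N -> winc e w ->
  exists2 w', winc (pact (tperm i j) e) w' & connect bstep w w'.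
Proof.
have [m] := ubnP (j - i)%N; elim: m e i j w => // m IH e i j w jim ij eij hw.
have [/existsP[l /andP[/andP[il lj] hl]]|hno] := boolP [exists l : 'I_n, (i < l < j)%N && ((e l == e i) || (e l == e j))].
  have il' : i != l by rewrite -val_eqE /=; lia.
  have lj' : l != j by rewrite -val_eqE /=; lia.
  have ij' : i != j by rewrite -val_eqE /=; lia.
  case/orP: hl => /eqP hl.
    have [w1 hw1 c1] := IH e l j w ltac:(lia) lj ltac:(lia) hw.
    have h2 : (pact (tperm l j) e l < pact (tperm l j) e i)%N.
      by rewrite !pact_tpermE tpermL tpermD // eq_sym.
    have [w2 hw2 c2] := IH _ i l w1 ltac:(lia) il h2 hw1.
    exists w2; last exact: connect_trans c1 c2.
    move: hw2; rewrite -pactM conjgC tpermJ tpermR tpermD // [X in X -> _]/= 1?eq_sym //.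
    by rewrite pactM pact_tperm_fix.
  have [w1 hw1 c1] := IH e i l w ltac:(lia) il ltac:(lia) hw.
  have h2 : (pact (tperm i l) e j < pact (tperm i l) e l)%N.
    by rewrite !pact_tpermE tpermR tpermD.
  have [w2 hw2 c2] := IH _ l j w1 ltac:(lia) lj h2 hw1.
  exists w2; last exact: connect_trans c1 c2.
  move: hw2; rewrite -pactM conjgC tpermJ tpermL tpermD 1?eq_sym //.
  by rewrite pactM pact_tperm_fix.
have [|h1 h2] := @swap_adj_connect e i j w ij eij _ hw.
  move=> l hl; move/existsPn: hno => /(_ l); rewrite hl /= negb_or => /andP[]; by split.
by exists (w * tperm i j)%g => //; exact: connect1.
Qed.

End Bruhat.

Section Steps.
Context {n : nat}.
Implicit Types (e x y : mi n) (i j l : 'I_n) (v : nat).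

Lemma sum_off2 (T : nmodType) i j (F G : 'I_n -> T) : i != j ->
  (forall l, l != i -> l != j -> F l = G l) ->
  exists r, \sum_l F l = F i + F j + r /\ \sum_l G l = G i + G j + r.
Proof.
move=> ij h; exists (\sum_(l | (l != i) && (l != j)) F l).
have E H : \sum_l H l = H i + H j + \sum_(l | (l != i) && (l != j)) H l :> T.
  by rewrite (bigD1 i) //= (bigD1 j) /= ?addrA // eq_sym.
split; rewrite E //.
by congr (_ + _); apply: eq_bigr => l /andP[li lj]; rewrite h.
Qed.

Lemma sum_off2n i j (F G : 'I_n -> nat) : i != j ->
  (forall l, l != i -> l != j -> F l = G l) ->
  exists r, (\sum_l F l = F i + F j + r /\ \sum_l G l = G i + G j + r)%N.
Proof. exact: (@sum_off2 nat). Qed.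

(* Exponents of the monomials, other than [x^e] itself, appearing in the image
   of [x^e] under the Cherednik operators. *)
Inductive step e : mi n -> Prop :=
| step_swap i j : (i < j)%N -> (e j < e i)%N -> step e (pact (tperm i j) e)
| step_squeeze i j t x : (0 < t)%N -> (e j + t < e i)%N ->
    x i = (e i - t)%N -> x j = (e j + t)%N ->
    (forall l, l != i -> l != j -> x l = e l) -> step e x.

(** Counts the boxes beyond column [v]. It ignores the order of the parts, a squeeze cannot increase
    it, and all its values together determine dominance. *)
Definition excess v e := (\sum_i (e i - v))%N.
Definition sumsq e := (\sum_i e i ^ 2)%N.

Lemma pact_sum (F : nat -> nat) s e : (\sum_i F (pact s e i) = \sum_i F (e i))%N.
Proof. by rewrite (reindex_inj (@perm_inj _ s)) /=; under eq_bigr do rewrite pactE. Qed.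

Lemma msize_pact s e : msize (pact s e) = msize e.
Proof. exact: (pact_sum id). Qed.

Lemma step_msize e x : step e x -> msize x = msize e.
Proof.
case=> [i j _ _|i j t {}x t0 ht hi hj h]; first exact: msize_pact.
have ij : i != j by apply: contraTneq ht => ->; lia.
rewrite /msize; have [r [-> ->]] := sum_off2n ij h; lia.
Qed.

Lemma squeeze_excess v e i j t x : (0 < t)%N -> (e j + t < e i)%N ->
    x i = (e i - t)%N -> x j = (e j + t)%N ->
    (forall l, l != i -> l != j -> x l = e l) -> (excess v x <= excess v e)%N.
Proof.
move=> t0 ht hi hj h.
have ij : i != j by apply: contraTneq ht => ->; lia.
rewrite /excess; have [|r [-> ->]] := @sum_off2n i j (fun l => x l - v)%N (fun l => e l - v)%N ij.
  by move=> l li lj; rewrite h.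
lia.
Qed.

Lemma squeeze_sumsq e i j t x : (0 < t)%N -> (e j + t < e i)%N ->
    x i = (e i - t)%N -> x j = (e j + t)%N ->
    (forall l, l != i -> l != j -> x l = e l) -> (sumsq x < sumsq e)%N.
Proof.
move=> t0 ht hi hj h.
have ij : i != j by apply: contraTneq ht => ->; lia.
rewrite /sumsq; have [|r [-> ->]] := @sum_off2n i j (fun l => x l ^ 2)%N (fun l => e l ^ 2)%N ij.
  by move=> l li lj; rewrite h.
rewrite hi hj ltn_add2r; move: (e i) (e j) ht => a b ht.
have [c [c0 ->]] : exists c, (0 < c)%N /\ a = (b + t + c)%N.
  by exists (a - (b + t))%N; rewrite subn_gt0 ht; split=> //; lia.
have -> : (b + t + c - t = b + c)%N by lia.
have := muln_gt0 t c; rewrite t0 c0 -!mulnn; nia.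
Qed.

(* Bounded on compositions of a given size and strictly decreasing along steps. *)
Definition potential e :=
  ((n * msize e).+1 * sumsq e + \sum_(i < n) (n - i) * e i)%N.

Lemma step_potential e x : step e x -> (potential x < potential e)%N.
Proof.
move=> h; rewrite /potential (step_msize h).
(* The linear part of [potential] is at most [n * msize], so a single unit of [sumsq], weighted by
   one more than that, outweighs it; swaps leave [sumsq] fixed and lower the linear part. *)
have b y : (\sum_(i < n) (n - i) * y i <= n * msize y)%N.
  by rewrite /msize big_distrr /=; apply: leq_sum => i _; rewrite leq_mul2r leq_subr orbT.
case: h (step_msize h) => [i j ij eij|i j t {}x t0 ht hi hj h] m.
  rewrite /sumsq (pact_sum (fun m => m ^ 2)%N) ltn_add2l.
  have nij : i != j by rewrite -val_eqE /=; lia.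
  have [|r [-> ->]] := @sum_off2n i j (fun l => (n - l) * pact (tperm i j) e l)%N (fun l => (n - l) * e l)%N nij.
    by move=> l li lj; rewrite pact_tpermE tpermD // eq_sym.
  rewrite !pact_tpermE tpermL tpermR ltn_add2r.
  have := ltn_ord i; have := ltn_ord j; nia.
have := squeeze_sumsq t0 ht hi hj h; have := b x; rewrite m; nia.
Qed.

Inductive below e : mi n -> Prop :=
| below_refl : below e e
| below_step x y : below e x -> step x y -> below e y.

Lemma below_msize e x : below e x -> msize x = msize e.
Proof. by elim=> // a b _ <- /step_msize. Qed.

Lemma below_potential e x : below e x -> x = e \/ (potential x < potential e)%N.
Proof.
elim=> [|a b _ IH /step_potential ab]; [by left|right].
by case: IH => [<- //|]; exact: ltn_trans.
Qed.

Lemma excess_etaplus v e : excess v (etaplus e) = excess v e.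
Proof. by rewrite etaplus_rperm /excess (pact_sum (fun m => m - v)%N). Qed.

Lemma sumsq_etaplus e : sumsq (etaplus e) = sumsq e.
Proof. by rewrite etaplus_rperm /sumsq (pact_sum (fun m => m ^ 2)%N). Qed.

(** The sum of the [j + 1] largest parts is at most [(j + 1) * v] plus the excess over [v], for
    every [v], with equality when [v] is the part of index [j] of the sorted composition. *)
Lemma excess_dom e x : (forall v, excess v x <= excess v e)%N -> forall j,
  (\sum_(i < n | (i <= j)%N) etaplus x i <= \sum_(i < n | (i <= j)%N) etaplus e i)%N.
Proof.
move=> h j; set v := etaplus e j.
have le1 y : (\sum_(i < n | (i <= j)%N) etaplus y i <=
    \sum_(i < n | (i <= j)%N) v + excess v y)%N.
  rewrite -(excess_etaplus v y) /excess [X in (_ + X)%N](bigID (fun i : 'I_n => (i <= j)%N)) /=.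
  rewrite addnA -big_split /=; apply: leq_trans (leq_addr _ _).
  by apply: leq_sum => i _; lia.
apply: leq_trans (le1 x) _; apply: leq_trans (leq_add (leqnn _) (h v)) _.
rewrite -(excess_etaplus v e) /excess [X in (_ + X)%N](bigID (fun i : 'I_n => (i <= j)%N)) /=.
rewrite addnA -big_split /= [X in (_ + X)%N]big1 ?addn0; last first.
  by move=> i; rewrite -ltnNge => /ltnW/(etaplus_noninc e); rewrite -/v; lia.
by apply: leq_sum => i /(etaplus_noninc e); rewrite -/v; lia.
Qed.

(** A chain containing a squeeze lowers [sumsq] strictly; a chain of swaps alone stays in the orbit
    and follows the Bruhat order. These are the two alternatives in [prec]. *)
Lemma below_cases e x : below e x ->
  ((forall v, excess v x <= excess v e)%N /\ (sumsq x < sumsq e)%N) \/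
  (etaplus x = etaplus e /\ forall w, winc e w ->
     exists2 w', winc x w' & connect bstep w w').
Proof.
elim=> [|a b _ IH ab]; first by right; split=> // w hw; exists w.
case: ab => [i j ij aij|i j t {}b t0 ht hi hj h]; last first.
  left; split=> [v|]; last first.
    apply: leq_trans (squeeze_sumsq t0 ht hi hj h) _.
    by case: IH => [[_ /ltnW //]|[E _]]; rewrite -sumsq_etaplus E sumsq_etaplus.
  apply: leq_trans (squeeze_excess v t0 ht hi hj h) _.
  by case: IH => [[]//|[E _]]; rewrite -excess_etaplus E excess_etaplus.
case: IH => [[h1 h2]|[E h]]; [left|right].
  split; last by rewrite /sumsq (pact_sum (fun m => m ^ 2)%N).
  by move=> v; rewrite /excess (pact_sum (fun m => m - v)%N); exact: h1.
split; first by rewrite etaplus_pact.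
move=> w /h[w1 hw1 c1].
have [w2 hw2 c2] := swap_connect ij aij hw1.
by exists w2 => //; exact: connect_trans c1 c2.
Qed.

Lemma below_prec e x : below e x -> x = e \/ prec x e.
Proof.
move=> hb; case: (below_cases hb) => [[h1 h2]|[E h]].
  right; apply/orP; left; apply/and3P; split.
  - by rewrite !msize_etaplus (below_msize hb).
  - by apply/forallP => j; exact: excess_dom.
  - by apply: contraTneq h2 => E; rewrite -(sumsq_etaplus x) E sumsq_etaplus ltnn.
have [w hw] := wmin_ex e; have [w' hw' c] := h w (wmin_winc hw).
have [Ew|ne] := eqVneq w w'.
  by left; case: hw' => <- _; case: (wmin_winc hw) => <- _; rewrite E Ew.
right; apply/orP; right; rewrite E eqxx /=.
apply/existsP; exists w; apply/existsP; exists w'; rewrite hw winc_wmin //=.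
case/connectP: c => [[|u p] /= hp Elast]; first by rewrite Elast eqxx in ne.
case/andP: hp => wu up; apply/existsP; exists u; rewrite wu /=.
by apply/connectP; exists p.
Qed.

Lemma bstep_connect_ninv (u w : 'S_n) : connect bstep u w -> (ninv u <= ninv w)%N.
Proof.
case/connectP=> p; elim: p u => [|v p IH] u /= => [_ -> //|/andP[uv vp] E].
apply: leq_trans (IH v vp E).
by case/existsP: uv => i /existsP[j /andP[_ /ltnW]].
Qed.

(** Ensures that the sum in [IsE] does not disturb the leading coefficient 1. The shortest
    permutation is unique and each Bruhat step raises the number of inversions. *)
Lemma prec_irr e : prec e e = false.
Proof.
apply/negP => /orP[/and3P[_ _]|/andP[_]]; first by rewrite eqxx.
case/existsP=> w /existsP[w' /and3P[hw hw']].
rewrite (winc_uniq (wmin_winc hw') (wmin_winc hw)).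
case/existsP=> u /andP[/existsP[i /existsP[j /andP[_ h]]] /bstep_connect_ninv].
by rewrite leqNgt h.
Qed.

End Steps.

(** * Monomial expansions of polynomial functions *)

Section Compositions.
Context {n : nat}.
Implicit Types (e x : mi n) (m : nat).

Definition cps m : seq (mi n) := [seq tomi y | y : bnd n m <- enum {: bnd n m} & msize (tomi y) == m].

Lemma tomi_inj m : injective (@tomi n m).
Proof.
move=> x y E; apply/ffunP => i; apply: val_inj.
by have /ffunP/(_ i) := E; rewrite !ffunE.
Qed.

Lemma cps_uniq m : uniq (cps m).
Proof.
rewrite map_inj_uniq; first by rewrite filter_uniq // enum_uniq.
by move=> x y; exact: tomi_inj.
Qed.

Lemma msize0 : msize ([ffun=> 0%N] : mi n) = 0%N.
Proof. by rewrite /msize big1 // => i _; rewrite ffunE. Qed.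

Lemma le_msize e i : (e i <= msize e)%N.
Proof. by rewrite /msize (bigD1 i) //= leq_addr. Qed.

Lemma mem_cps m e : (e \in cps m) = (msize e == m).
Proof.
apply/mapP/idP => [[x]|/eqP em]; first by rewrite mem_filter => /andP[h _] ->.
have E : e = tomi [ffun i => inord (e i) : 'I_m.+1].
  apply/ffunP => i; rewrite !ffunE inordK // ltnS -em; exact: le_msize.
by exists [ffun i => inord (e i)] => //; rewrite mem_filter -E em eqxx mem_enum.
Qed.

Lemma potential_bound m : exists M, forall e, msize e = m -> (potential e <= M)%N.
Proof.
exists (\max_(x <- cps m) potential x)%N => e em.
by apply: (@leq_bigmax_seq _ _ _ (@potential n)) => //; rewrite mem_cps em.
Qed.

Lemma sumdegE (R : realType) m (F : mi n -> R[i]) :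
  sumdeg n m F = \sum_(e <- cps m) F e.
Proof. by rewrite /sumdeg /cps big_map big_filter big_enum_cond. Qed.

Lemma digits_inj (B d : nat) (f g : nat -> nat) :
  (forall i, (f i < B)%N) -> (forall i, (g i < B)%N) ->
  (\sum_(i < d) f i * B ^ i = \sum_(i < d) g i * B ^ i)%N ->
  forall i, (i < d)%N -> f i = g i.
Proof.
elim: d f g => // d IH f g hf hg.
have B0 : (0 < B)%N by exact: leq_ltn_trans (hf 0%N).
have E (h : nat -> nat) : (\sum_(i < d.+1) h i * B ^ i = (\sum_(i < d) h i.+1 * B ^ i) * B + h 0)%N.
  rewrite big_ord_recl /= muln1 addnC; congr (_ + _)%N.
  by rewrite big_distrl /=; apply: eq_bigr => i _; rewrite expnSr mulnA.
rewrite !E => Eq.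
have E0 : f 0%N = g 0%N.
  by have := congr1 (modn^~ B) Eq; rewrite !modnMDl !modn_small.
have Er : (\sum_(i < d) f i.+1 * B ^ i = \sum_(i < d) g i.+1 * B ^ i)%N.
  by have := congr1 (divn^~ B) Eq; rewrite !divnMDl // !divn_small // !addn0.
by case=> // i; rewrite ltnS => /(IH _ _ (fun i => hf i.+1) (fun i => hg i.+1) Er).
Qed.

End Compositions.

Section MonomialExpansions.
Context {R : realType} {n : nat}.
Implicit Types (f g : 'rV[R[i]]_n -> R[i]) (z : 'rV[R[i]]_n) (e x : mi n) (b : mi n -> R[i])
  (P : mi n -> Prop) (m : nat) (l : 'I_n).

Definition peval m b z : R[i] := \sum_(e <- cps m) b e * mono e z.

Lemma pevalE m b z : peval m b z = \sum_(e <- cps m | msize e == m) b e * mono e z.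
Proof.
by rewrite /peval big_seq_cond [RHS]big_seq_cond; apply: eq_bigl => e; rewrite mem_cps andbT andbb.
Qed.

(* Kronecker's substitution [z_i = t ^ (m + 1) ^ i] separates the monomials of degree [m]. *)
Lemma peval_eq0 m b : (forall z, peval m b z = 0) -> forall e, msize e = m -> b e = 0.
Proof.
move=> H e em; pose K x := (\sum_(i < n) x i * m.+1 ^ i)%N.
have Kinj x y : msize x = m -> msize y = m -> K x = K y -> x = y.
  move=> xm ym E.
  pose h (x : mi n) (i : nat) := if (insub i : option 'I_n) is Some j then x j else 0%N.
  have hE (x' : mi n) (i : 'I_n) : h x' i = x' i by rewrite /h valK.
  have hb (x' : mi n) : msize x' = m -> forall i : nat, (h x' i < m.+1)%N.
    by move=> x'm i; rewrite /h; case: insubP => //= u _ _; rewrite ltnS -x'm le_msize.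
  apply/ffunP => i; rewrite -(hE x) -(hE y).
  apply: (@digits_inj m.+1 n _ _ (hb _ xm) (hb _ ym)) => //.
  by under eq_bigr do rewrite hE; under [RHS]eq_bigr do rewrite hE.
pose p : {poly R[i]} := \sum_(x <- cps m) b x *: 'X^(K x).
have pt t : p.[t] = 0.
  rewrite -(H (\row_i t ^+ (m.+1 ^ i))) /p /peval horner_sum.
  apply: eq_bigr => x _; rewrite hornerZ hornerXn; congr (_ * _).
  rewrite /mono /K expr_sum; apply: eq_bigr => i _.
  by rewrite mxE -exprM mulnC.
have p0 : p = 0.
  pose rs : seq R[i] := [seq (a%:R : R[i]) | a : nat <- iota 0 (size p)].
  apply: (@roots_geq_poly_eq0 _ p rs).
  - by apply/allP => t _; rewrite /root pt.
  - rewrite map_inj_uniq ?iota_uniq // => i j /eqP; by rewrite eqr_nat => /eqP.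
  - by rewrite size_map size_iota.
have := congr1 (fun q : {poly R[i]} => q`_(K e)) p0.
rewrite coef0 /p coef_sum (bigD1_seq e) ?cps_uniq ?mem_cps ?em //=.
rewrite coefZ coefXn eqxx mulr1 big_seq_cond big1 ?addr0 // => x.
rewrite mem_cps => /andP[/eqP xm xe]; rewrite coefZ coefXn.
by case: eqP => [/esym/(Kinj _ _ xm em)/eqP|_]; rewrite ?(negPf xe) ?mulr0.
Qed.

Lemma peval_delta e z : peval (msize e) (fun x => (x == e)%:R) z = mono e z.
Proof.
rewrite /peval (bigD1_seq e) ?cps_uniq ?mem_cps //= eqxx mul1r.
by rewrite big1 ?addr0 // => x /negPf ->; rewrite mul0r.
Qed.

Definition pol P m f := exists2 b, (forall e, b e != 0 -> P e) & f =1 peval m b.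

Lemma pol_eq P m f g : f =1 g -> pol P m f -> pol P m g.
Proof. by move=> /funext ->. Qed.

Lemma pol_mono P e : P e -> pol P (msize e) (fun z => mono e z).
Proof.
move=> Pe; exists (fun x => (x == e)%:R) => [x|z].
  by case: (x =P e) => [-> //|_]; rewrite eqxx.
by rewrite peval_delta.
Qed.

Lemma pol0 P m : pol P m (fun=> 0).
Proof.
exists (fun=> 0) => [x|z]; first by rewrite eqxx.
by rewrite /peval big1 // => x _; rewrite mul0r.
Qed.

Lemma polD P m f g : pol P m f -> pol P m g -> pol P m (fun z => f z + g z).
Proof.
move=> [b hb Eb] [c hc Ec]; exists (fun x => b x + c x) => [x h|z].
  have [b0|] := eqVneq (b x) 0; last exact: hb.
  by apply: hc; rewrite b0 add0r in h.
rewrite Eb Ec /peval -big_split; apply: eq_bigr => x _; by rewrite mulrDl.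
Qed.

Lemma polZ P m a f : pol P m f -> pol P m (fun z => a * f z).
Proof.
move=> [b hb Eb]; exists (fun x => a * b x) => [x|z].
  by rewrite mulf_eq0 negb_or => /andP[_]; exact: hb.
by rewrite Eb /peval mulr_sumr; apply: eq_bigr => x _; rewrite mulrA.
Qed.

Lemma pol_sum P m (I : Type) (s : seq I) (Q : pred I) (F : I -> 'rV[R[i]]_n -> R[i]) :
  (forall i, Q i -> pol P m (F i)) -> pol P m (fun z => \sum_(i <- s | Q i) F i z).
Proof. by move=> H; apply: fsum_ind => //; [exact: pol0|move=> f g; exact: polD]. Qed.

Definition anymi : mi n -> Prop := fun=> True.

Lemma mono_coordM l e z : z 0 l * mono e z = mono [ffun i => e i + (i == l)]%N z :> R[i].
Proof.
rewrite /mono (bigD1 l) //= [RHS](bigD1 l) //= ffunE eqxx addn1 exprS mulrA.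
by congr (_ * _); apply: eq_bigr => i /negPf il; rewrite ffunE il addn0.
Qed.

Lemma msize_add1 l e : msize [ffun i => e i + (i == l)]%N = (msize e).+1.
Proof.
rewrite /msize; under eq_bigr do rewrite ffunE.
rewrite big_split /= -[RHS]addn1; congr (_ + _)%N.
by rewrite (bigD1 l) //= eqxx big1 // => i /negPf ->.
Qed.

(** Connects the two descriptions of polynomials: [hp] serves the estimates, explicit coefficients
    serve comparison and linear independence. *)
Lemma hp_pol m (N : R) f : hp m N f -> pol anymi m f.
Proof.
elim=> {m N f} [a|m|l m N f _ [b _ Eb]|m N N' f g _ h1 _ h2|//].
- have := polZ a (@pol_mono anymi [ffun=> 0%N] I); rewrite msize0; apply: pol_eq => z.
  by rewrite /mono big1 ?mulr1 // => i _; rewrite ffunE.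
- exact: pol0.
- apply: (@pol_eq _ _ (fun z => \sum_(e <- cps m | msize e == m) b e * (z 0 l * mono e z))).
    by move=> z; rewrite Eb pevalE mulr_sumr; apply: eq_bigr => e _; rewrite mulrCA.
  apply: pol_sum => e /eqP em; apply: polZ.
  by apply: (@pol_eq _ _ (fun z => mono [ffun i => e i + (i == l)]%N z)) => [z|];
    [rewrite mono_coordM|rewrite -em -(msize_add1 l); exact: pol_mono].
- exact: polD.
Qed.

End MonomialExpansions.

(** * Cherednik operators and their triangularity *)

HB.lock Definition Dch (R : realType) (n : nat) (k : R) (j : 'I_n)
  (f : 'rV[R[i]]_n -> R[i]) (z : 'rV[R[i]]_n) : R[i] := Dcal k j f z.

Section Cherednik.
Context {R : realType} {n : nat}.
Variable k : R.
Implicit Types (f g : 'rV[R[i]]_n -> R[i]) (z : 'rV[R[i]]_n) (e x : mi n) (m : nat)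
  (i j l : 'I_n).

Lemma DchE j f z : Dch k j f z = z 0 j * Td k j f z + rc k * (1 - n%:R) * f z
  + rc k * \sum_(i < n | (j < i)%N) f (swapv i j z).
Proof. by rewrite Dch.unlock Td.unlock. Qed.

Lemma DchD j f g z : sm f -> sm g ->
  Dch k j (fun z => f z + g z) z = Dch k j f z + Dch k j g z.
Proof. by move=> hf hg; rewrite !DchE TjD // big_split /=; ring. Qed.

Lemma DchZ j a f z : sm f -> Dch k j (fun z => a * f z) z = a * Dch k j f z.
Proof. by move=> hf; rewrite !DchE TjZ // -mulr_sumr; ring. Qed.

Lemma Dch0 j z : Dch k j (fun=> 0) z = 0.
Proof. by rewrite DchE Tj_cst big1 // !mulr0 !addr0. Qed.

Lemma sm_sum (I : Type) (s : seq I) (P : pred I) (F : I -> 'rV[R[i]]_n -> R[i]) :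
  (forall a, P a -> sm (F a)) -> sm (fun z => \sum_(a <- s | P a) F a z).
Proof. by move=> H; apply: fsum_ind => //; [exact: sm_cst|exact: smD]. Qed.

Lemma Dch_sum j (I : Type) (s : seq I) (P : pred I) (F : I -> 'rV[R[i]]_n -> R[i]) z :
  (forall a, P a -> sm (F a)) ->
  Dch k j (fun z => \sum_(a <- s | P a) F a z) z = \sum_(a <- s | P a) Dch k j (F a) z.
Proof.
move=> H; apply: (@fsum_additive _ _ _ sm (fun f => Dch k j f z)) => //.
- exact: sm_cst.
- exact: smD.
- exact: Dch0.
- by move=> f g; exact: DchD.
Qed.

Lemma sm_mono e : sm (fun z : 'rV[R[i]]_n => mono e z).
Proof. exact: hp_sm (hp_mono e). Qed.

Lemma euler_mono j e z : z 0 j * Dv (unitv j) (fun z : 'rV[R[i]]_n => mono e z) z =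
  (e j)%:R * mono e z.
Proof.
pose Q c f := sm f /\ forall z, z 0 j * Dv (unitv j) f z = c%:R * f z.
suff : Q (e j) (fun z => mono e z) by case=> _ ->.
have [m] := ubnP (msize e); elim: m e => // m IH e em.
have [l el|e0] := pickP (fun l => 0 < e l)%N; last first.
  have -> : (fun z : 'rV[R[i]]_n => mono e z) = (fun=> 1).
    by apply/funext => y; apply: big1 => i _; move: (e0 i) => /=; case: (e i).
  have -> : e j = 0%N by move: (e0 j) => /=; case: (e j).
  by split=> [|y]; [exact: sm_cst|rewrite derive_cst_sm mulr0 mul0r].
pose e' : mi n := [ffun i => e i - (i == l)]%N.
have Ee : e = [ffun i => e' i + (i == l)]%N.
  by apply/ffunP => i; rewrite !ffunE subnK //; case: eqP => // ->.
have [h1 h2] : Q (e' j) (fun z => mono e' z) by apply: IH; rewrite -ltnS -(msize_add1 l) -Ee.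
have -> : e j = (e' j + (j == l))%N by rewrite {1}Ee ffunE.
have -> : (fun z : 'rV[R[i]]_n => mono e z) = (fun z => z 0 l * mono e' z).
  by apply/funext => y; rewrite mono_coordM -Ee.
split=> [|y]; first exact: sm_coordM.
rewrite derive_coordM // mxE mulrDr [y 0 j * (y 0 l * _)]mulrCA h2 natrD eq_sym.
by case: eqP => [->|_] /=; ring.
Qed.

(** On the hyperplane the symmetry makes the derivative along the difference of the two unit vectors
    equal to its own opposite. *)
Lemma dq_sym0 j i g z : sm g -> (forall z, g (swapv j i z) = g z) -> dq j i g z = 0.
Proof.
move=> hg Eg; have [e|ne] := pselect (z 0 j = z 0 i); last by rewrite dq_ne // Eg subrr mul0r.
rewrite dq_eq //; have := derive_pv (tperm j i) z (udiff j i) hg.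
have -> : (fun z => g (pv (tperm j i) z)) = g by apply/funext => y; exact: Eg.
rewrite pv_udiff tpermV tpermL tpermR -swapvE swapv_eq // udiffN deriveN_sm //.
set d := Dv _ _ _ => E; have : d *+ 2 == 0 by rewrite mulr2n -{1}E addNr.
by rewrite mulrn_eq0 /= => /eqP ->; rewrite ?oppr0.
Qed.

Lemma dq_pow j i c g z : i != j -> sm g -> (forall z, g (swapv j i z) = g z) ->
  sm (fun z => z 0 j ^+ c * g z) /\
  dq j i (fun z => z 0 j ^+ c * g z) z =
   \sum_(t < c) z 0 j ^+ (c - t.+1) * z 0 i ^+ t * g z.
Proof.
move=> ij hg Eg; elim: c => [|c [IH1 IH2]].
  have -> : (fun z => z 0 j ^+ 0 * g z) = g by apply/funext => y; rewrite mul1r.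
  by rewrite big_ord0 dq_sym0.
have -> : (fun z => z 0 j ^+ c.+1 * g z) = (fun z => z 0 j * (z 0 j ^+ c * g z)).
  by apply/funext => y; rewrite exprS mulrA.
split; first exact: sm_coordM.
rewrite dq_mull 1?eq_sym // IH2 big_ord_recr /= subnn expr0 mul1r Eg.
congr (_ + _); last by rewrite mxE tpermL.
rewrite mulr_sumr; apply: eq_bigr => t _.
by rewrite subSn // [_ ^+ (c - t.+1).+1]exprS; ring.
Qed.

Definition upd e j a i b : mi n := [ffun l => if l == j then a else if l == i then b else e l].

Lemma mono_upd e j a i b z : i != j ->
  mono (upd e j a i b) z = z 0 j ^+ a * z 0 i ^+ b * mono (upd e j 0 i 0) z :> R[i].
Proof.
move=> ij; rewrite /mono (bigD1 j) //= (bigD1 i) //= mulrA.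
rewrite [in RHS](bigD1 j) //= [in RHS](bigD1 i) //= !ffunE !eqxx (negPf ij) !expr0 !mul1r.
by congr (_ * _); apply: eq_bigr => l /andP[/negPf lj /negPf li]; rewrite !ffunE lj li.
Qed.

Lemma upd_id e j i : upd e j (e j) i (e i) = e.
Proof. by apply/ffunP => l; rewrite ffunE; case: eqP => [->|_] //; case: eqP => [->|_]. Qed.

Lemma mono_swapv e i j z : mono e (swapv i j z) = mono (pact (tperm i j) e) z :> R[i].
Proof.
rewrite /mono (reindex_inj (@perm_inj _ (tperm i j))) /=.
by apply: eq_bigr => l _; rewrite mxE tpermK pact_tpermE.
Qed.

Lemma mono_pow_sym e j i (b c : nat) z : i != j ->
  mono (upd e j (b + c) i b) z = z 0 j ^+ c * mono (upd e j b i b) z :> R[i].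
Proof. by move=> ij; rewrite mono_upd // [in RHS]mono_upd // exprD; ring. Qed.

Lemma mono_upd_sym e j i b z : i != j ->
  mono (upd e j b i b) (swapv j i z) = mono (upd e j b i b) z :> R[i].
Proof.
move=> ij; rewrite mono_swapv; congr (mono _ z); apply/ffunP => l.
rewrite pact_tpermE !ffunE tpermIf.
case: (altP (l =P j)) => [lj|lj]; [|case: (altP (l =P i)) => [li|li]];
  by rewrite ?eqxx ?(negPf ij) ?(negPf lj) ?(negPf li).
Qed.

Lemma step_upd e j i t : i != j -> (0 < t)%N -> (e i + t < e j)%N ->
  step e (upd e j (e j - t) i (e i + t)).
Proof.
move=> ij t0 h; apply: (@step_squeeze _ e j i t) => //.
- by rewrite ffunE eqxx.
- by rewrite ffunE (negPf ij) eqxx.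
- by move=> l /negPf lj /negPf li; rewrite ffunE lj li.
Qed.

Lemma pol_step e x : step e x -> pol (step e) (msize e) (fun z : 'rV[R[i]]_n => mono x z).
Proof. by move=> h; rewrite -(step_msize h); exact: pol_mono. Qed.

(** Write the monomial as [x_j] to the power [e j - e i] times a monomial symmetric in the two
    variables. In the resulting geometric sum the first term is the monomial itself, and each other
    term moves units from part [j] to part [i], which is a squeeze. *)
Lemma dq_mono_gt j i e : i != j -> (e i < e j)%N ->
  pol (step e) (msize e) (fun z => z 0 j * dq j i (fun z => mono e z) z - mono e z).
Proof.
move=> ij h; pose c := (e j - e i).-1.
have Ec : e j = (e i + c.+1)%N by rewrite /c; lia.
have Ee : (fun z : 'rV[R[i]]_n => mono e z) =
   (fun z => z 0 j ^+ c.+1 * mono (upd e j (e i) i (e i)) z).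
  by apply/funext => z; rewrite -{1}(upd_id e j i) Ec mono_pow_sym.
apply: (@pol_eq _ _ _ _ (fun z => \sum_(t < c | true) mono (upd e j (e j - t.+1) i (e i + t.+1)) z)).
  move=> z; have /= -> := congr1 (fun F => F z) Ee; rewrite Ee.
  have [_ ->] := dq_pow c.+1 z ij (sm_mono (upd e j (e i) i (e i))) (fun z => mono_upd_sym e (e i) z ij).
  rewrite big_ord_recl /= subSS subn0 expr0 mulr1 [z 0 j ^+ c.+1]exprS.
  set S := (X in _ = _ * (_ + X) - _); transitivity (z 0 j * S); last by ring.
  rewrite /S mulr_sumr; apply: eq_bigr => t _ /=.
  rewrite mono_upd // [in RHS]mono_upd // Ec /bump /= add1n.
  have -> : (e i + c.+1 - t.+1 = (c.+1 - t.+2).+1 + e i)%N by have := ltn_ord t; lia.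
  by rewrite !exprD !exprS; ring.
apply: pol_sum => t _; apply: pol_step; apply: step_upd => //.
by rewrite Ec ltn_add2l ltnS.
Qed.

Lemma dq_mono_lt j i e : i != j -> (e j < e i)%N ->
  pol (step e) (msize e)
    (fun z => z 0 j * dq j i (fun z => mono e z) z + mono (pact (tperm i j) e) z).
Proof.
move=> ij h; have ji : j != i by rewrite eq_sym.
apply: pol_eq (polZ (-1) (dq_mono_gt ji h)) => z.
have := mulr_dq i j (fun z => mono e z) z; rewrite mono_swapv mulrBl => /(canRL (subrK _)) E.
by rewrite E (dq_anti i j (sm_mono e z)); ring.
Qed.

Lemma dq_mono_eq j i e z : i != j -> e i = e j -> dq j i (fun z => mono e z) z = 0.
Proof.
move=> ij E; apply: dq_sym0; first exact: sm_mono.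
by move=> y; rewrite mono_swapv pact_tperm_fix.
Qed.

Lemma Dch_mono j e : pol (step e) (msize e)
  (fun z => Dch k j (fun z => mono e z) z - rc (etabar k e j) * mono e z).
Proof.
(* The constant [1 - n] is distributed as [-1] over the [i != j]. Apart from the last summand, the
   diagonal part of [F i] is then [-1] if [i] comes before [j] and [0] otherwise, which adds up to
   [- mrank e j]. A swapped monomial survives only if it moves the larger part to the right; the
   opposite ones cancel or do not occur. *)
pose F i z := z 0 j * dq j i (fun z => mono e z) z +
  (j < i)%N%:R * mono (pact (tperm i j) e) z - mono e z + (before e i j)%:R * mono e z.
have HF i : i != j -> pol (step e) (msize e) (F i).
  move=> ij; have ijv : (i == j :> nat) = false by apply/negbTE.
  case: (ltngtP (e i) (e j)) => eij.
  - have Eb : before e i j = false by rewrite /before; lia.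
    apply: (@pol_eq _ _ _ _ (fun z => (z 0 j * dq j i (fun z => mono e z) z - mono e z) +
      (j < i)%N%:R * mono (pact (tperm i j) e) z)).
      by move=> z; rewrite /F Eb mul0r addr0 addrAC.
    apply: polD; first exact: dq_mono_gt.
    have [ji|_] := boolP (j < i)%N; last by apply: pol_eq (pol0 _ _) => z; rewrite mul0r.
    apply: polZ; apply: pol_step; rewrite tpermC; exact: step_swap.
  - have Eb : before e i j by rewrite /before eij.
    have [ji|ji] := boolP (j < i)%N.
      apply: pol_eq (dq_mono_lt ij eij) => z.
      by rewrite /F Eb ji !mul1r subrK.
    apply: (@pol_eq _ _ _ _ (fun z => (z 0 j * dq j i (fun z => mono e z) z +
       mono (pact (tperm i j) e) z) + -1 * mono (pact (tperm i j) e) z)).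
      by move=> z; rewrite /F Eb (negPf ji) !mul1r mul0r addr0 subrK mulN1r addrK.
    apply: polD; first exact: dq_mono_lt.
    by apply: polZ; apply: pol_step; apply: step_swap => //; lia.
  - apply: pol_eq (pol0 _ _) => z; rewrite /F dq_mono_eq //.
    rewrite (pact_tperm_fix eij).
    have -> : before e i j = ~~ (j < i)%N by rewrite /before eij ltnn eqxx /=; lia.
    by case: (j < i)%N => /=; ring.
apply: (@pol_eq _ _ _ _ (fun z => rc k * \sum_(i < n | i != j) F i z)); last first.
  by apply: polZ; apply: pol_sum => i ij; exact: HF.
move=> z; rewrite DchE TjE; last exact: sm_mono.
rewrite mulrDr euler_mono etabarE rcB rcM !rc_nat.
have E1 : \sum_(i < n | i != j) F i z = z 0 j * \sum_(i < n | i != j) dq j i (fun z => mono e z) z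
  + \sum_(i < n | (j < i)%N) mono e (swapv i j z) - (n%:R - 1) * mono e z
  + (mrank e j)%:R * mono e z.
  rewrite /F !big_split /= mulr_sumr; congr (_ + _ + _ + _).
  - rewrite (eq_bigr (fun i => if (j < i)%N then mono e (swapv i j z) else 0)); last first.
      by move=> i _; rewrite mono_swapv; case: ifP; rewrite ?mul1r ?mul0r.
    rewrite -big_mkcondr /=; apply: eq_bigl => i.
    by rewrite andbC; case: ltngtP (i =P j) => //= h; case: eqP => // E; rewrite E ltnn in h.
  - rewrite sumrN sumr_const -[X in - X = _]mulr_natl; congr (- (_ * _)).
    have : #|[pred i : 'I_n | i != j]| = n.-1.
      have := cardC1 j; rewrite card_ord => <-; exact: eq_card.
    move=> ->; have n0 : (0 < n)%N by exact: leq_ltn_trans (ltn_ord j).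
    by rewrite -{2}(prednK n0) -natr1 addrK.
  - rewrite -mulr_suml; congr (_ * _).
    rewrite /mrank -sum1_card natr_sum big_mkcond /= [RHS]big_mkcond /=.
    apply: eq_bigr => i _; rewrite inE.
    by case: eqP => [->|_] /=; [rewrite before_irr|case: (before e i j)].
rewrite E1; ring.
Qed.

End Cherednik.

Section Triangularity.
Context {R : realType} {n : nat}.
Variable k : R.
Hypothesis k0 : 0 <= k.
Implicit Types (f : 'rV[R[i]]_n -> R[i]) (z : 'rV[R[i]]_n) (e x : mi n) (b : mi n -> R[i])
  (m : nat) (j : 'I_n).

Definition jeig e f := forall j z, Dch k j f z = rc (etabar k e j) * f z.

Lemma polW (P Q : mi n -> Prop) m f : (forall x, P x -> Q x) -> pol P m f -> pol Q m f.
Proof. by move=> PQ [b hb Eb]; exists b => // x /hb/PQ. Qed.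

Lemma peval_sm m b : sm (peval m b).
Proof. by apply: sm_sum => e _; apply: smZ; exact: sm_mono. Qed.

Lemma peval_inj m b b' : peval m b =1 peval m b' ->
  forall e, msize e = m -> b e = b' e.
Proof.
move=> E e em; apply/eqP; rewrite -subr_eq0; apply/eqP.
apply: (@peval_eq0 _ _ m (fun x => b x - b' x)) em => z.
rewrite /peval; under eq_bigr do rewrite mulrBl.
by rewrite sumrB -/(peval m b z) -/(peval m b' z) E subrr.
Qed.

(** Comparison of the coefficients of [x] in the eigenvalue equations: if no exponent of the support
    steps to [x], then [x] has all the eigenvalues of [e], and [etabar_inj] gives [x = e]. *)
Lemma eigen_step m b e x : jeig e (peval m b) -> msize x = m -> b x != 0 -> x <> e ->
  exists y, [/\ msize y = m, b y != 0 & step y x].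
Proof.
move=> hf xm bx xe; apply: contrapT => H.
apply: xe; apply: (@etabar_inj n R k x e k0) => j; apply/eqP; rewrite eq_sym -subr_eq0.
pose c := rc (etabar k e j) - rc (etabar k x j).
suff [b' hb' Eb'] : pol (fun y => y <> x) m (fun z => c * peval m b z).
  have Ec : c * b x = b' x.
    apply: (@peval_inj m (fun y => c * b y) b' _ x xm) => z.
    by rewrite -Eb' /peval mulr_sumr; apply: eq_bigr => y _; rewrite mulrA.
  have b'x : b' x = 0 by apply: contrapT => /eqP/hb'.
  by move/eqP: Ec; rewrite b'x mulf_eq0 (negPf bx) orbF /c -rcB rc_eq0.
pose F y z := b y * ((Dch k j (fun z => mono y z) z - rc (etabar k y j) * mono y z) +
   (rc (etabar k y j) - rc (etabar k x j)) * mono y z).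
apply: (@pol_eq _ _ _ _ (fun z => \sum_(y <- cps m | msize y == m) F y z)).
  move=> z; rewrite /c mulrBl -hf.
  have -> : peval m b = fun z => \sum_(y <- cps m | msize y == m) b y * mono y z.
    by apply/funext => y; exact: pevalE.
  rewrite Dch_sum; last by move=> y _; apply: smZ; exact: sm_mono.
  rewrite mulr_sumr -sumrB; apply: eq_bigr => y _.
  by rewrite DchZ; [rewrite /F; ring|exact: sm_mono].
apply: pol_sum => y /eqP ym; apply: (@pol_eq _ _ _ _ (F y)) => //.
have [by0|by0] := eqVneq (b y) 0.
  by apply: pol_eq (pol0 _ _) => z; rewrite /F by0 mul0r.
apply: polZ; apply: polD.
  rewrite -ym; apply: polW (Dch_mono k j y) => x' hx' E; apply: H.
  by exists y; rewrite -E.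
have [->|/eqP yx] := eqVneq y x.
  by apply: pol_eq (pol0 _ _) => z; rewrite subrr mul0r.
by apply: polZ; rewrite -ym; apply: pol_mono.
Qed.

(** Climbing from [x] along [eigen_step] raises the bounded [potential], so it must stop, and it can
    stop only at [e]. *)
Lemma eigen_below m b e : jeig e (peval m b) ->
  forall x, msize x = m -> b x != 0 -> below e x /\ b e != 0.
Proof.
move=> hf; have [M hM] := @potential_bound n m.
suff H d : forall x, (M - potential x < d)%N -> msize x = m -> b x != 0 -> below e x /\ b e != 0.
  by move=> x; exact: (H (M - potential x).+1).
elim: d => // d IH x xd xm bx.
have [xe|xe] := pselect (x = e); first by subst; split => //; exact: below_refl.
have [y [ym by0 yx]] := eigen_step hf xm bx xe.
have [|h1 h2] := IH y _ ym by0.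
  have := step_potential yx; have := hM _ ym; lia.
by split=> //; exact: below_step h1 yx.
Qed.

Lemma eigen_zero m b e : jeig e (peval m b) -> b e = 0 -> forall z, peval m b z = 0.
Proof.
move=> hf be z; rewrite pevalE big1 // => x /eqP xm.
have [->|bx] := eqVneq (b x) 0; first by rewrite mul0r.
by have [_] := eigen_below hf xm bx; rewrite be eqxx.
Qed.

End Triangularity.

(** * Intertwiners and the construction of the polynomials [E_eta] *)

Section Intertwiners.
Context {R : realType} {n : nat}.
Variable k : R.
Implicit Types (f g : 'rV[R[i]]_n.+1 -> R[i]) (z : 'rV[R[i]]_n.+1) (e : mi n.+1) (m : nat)
  (i j l : 'I_n.+1).

Lemma Dch_pv s j f z : sm f ->
  Dch k j (fun z => f (pv s z)) z =
  z 0 j * Td k (s^-1%g j) f (pv s z) + rc k * (1 - n.+1%:R) * f (pv s z) +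
  rc k * \sum_(i < n.+1 | (j < s i)%N) f (swapv i (s^-1%g j) (pv s z)).
Proof.
move=> hf; rewrite DchE Tj_pv //; congr (_ + _ + _ * _).
rewrite (reindex_inj (@perm_inj _ s)) /=; apply: eq_bigr => i _.
by rewrite pv_swapv permK.
Qed.

Lemma Dch_adj_other i j l f z : sm f -> j = i.+1 :> nat -> l != i -> l != j ->
  Dch k l (fun z => f (swapv i j z)) z = Dch k l f (swapv i j z).
Proof.
move=> hf ij li lj; rewrite (Dch_pv (tperm i j)) // DchE tpermV tpermD 1?eq_sym //.
have -> : z 0 l = swapv i j z 0 l by rewrite mxE tpermD // eq_sym.
congr (_ + _ * _); apply: eq_bigl => a.
move: li lj; rewrite -!val_eqE /=.
by case: tpermP => [->|->|_ _] //; rewrite ij; lia.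
Qed.

(** Together with its two neighbours, the relations of the degenerate affine Hecke algebra between
    Cherednik operators and adjacent transpositions. *)
Lemma Dch_adj_left i j f z : sm f -> j = i.+1 :> nat ->
  Dch k i (fun z => f (swapv i j z)) z = Dch k j f (swapv i j z) + rc k * f z.
Proof.
move=> hf ij; rewrite (Dch_pv (tperm i j)) // DchE tpermV tpermL.
have -> : z 0 i = swapv i j z 0 j by rewrite mxE tpermR.
rewrite -[RHS]addrA -mulrDr; congr (_ + _ * _).
rewrite (bigD1 i) /=; last by rewrite tpermL ij.
rewrite addrC -swapvE swapvK; congr (_ + _); apply: eq_bigl => a.
rewrite -val_eqE /=; case: tpermP => [->|->|/eqP + /eqP +]; rewrite ?ij -?val_eqE /=; lia.
Qed.

Lemma Dch_adj_right i j f z : sm f -> j = i.+1 :> nat ->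
  Dch k j (fun z => f (swapv i j z)) z = Dch k i f (swapv i j z) - rc k * f z.
Proof.
move=> hf ij; have := Dch_adj_left (swapv i j z) (sm_pv (tperm i j) hf) ij.
rewrite -swapvE !swapvK => E; apply: (canRL (addrK _)); apply: etrans (esym E) _.
by congr (Dch k i _ _); apply/funext => y; rewrite -!swapvE swapvK.
Qed.

(** The constant is forced: the terms [k * f] and [- k * f] of the Hecke relations cancel precisely
    when [k] is the constant times the difference of the two eigenvalues. *)
Lemma jeig_adj e i j f : sm f -> j = i.+1 :> nat ->
  etabar k e j != etabar k e i ->
  (forall l, etabar k (pact (tperm i j) e) l = etabar k e (tperm i j l)) ->
  jeig k e f -> jeig k (pact (tperm i j) e)
    (fun z => f (swapv i j z) + rc (k / (etabar k e j - etabar k e i)) * f z).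
Proof.
move=> hf ij ne Ee h l z; have hs := sm_pv (tperm i j) hf.
rewrite (DchD _ _ _ hs (smZ _ hf)) DchZ // h Ee.
have ned : etabar k e j - etabar k e i != 0 by rewrite subr_eq0.
set d := rc (k / _).
have Ed : rc k = d * (rc (etabar k e j) - rc (etabar k e i)).
  by rewrite /d -rcB -rcM divfK.
have [->|li] := eqVneq l i.
  by rewrite tpermL -/(swapv i j _) (Dch_adj_left _ hf ij) h Ed; ring.
have [->|lj] := eqVneq l j.
  by rewrite tpermR (Dch_adj_right _ hf ij) h Ed; ring.
by rewrite tpermD 1?eq_sym // (Dch_adj_other _ hf ij li lj) h; ring.
Qed.

Definition rot z := pv (@cyc n)^-1%g z.

Definition PhiF f z : R[i] := z 0 ord_max * f (rot z).

Lemma PhiF_mono e z : PhiF (fun z => mono e z) z = mono (Phi e) z.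
Proof.
rewrite /PhiF /mono [in RHS](bigD1 ord_max) //= ffunE eqxx addn1 exprS -mulrA.
congr (_ * _); rewrite (reindex_inj (@perm_inj _ (@cyc n))) /= (bigD1 ord_max) //=.
rewrite mxE permK; congr (_ * _); apply: eq_bigr => i /negPf im.
by rewrite mxE permK ffunE im addn0.
Qed.

(** If [j] is not last, the term [- k] times a reflection from [Tj_mul] cancels the summand
    [i = ord_max] of the Cherednik operator. If [j] is last, that sum is empty and the reflections
    from [Tj_mul] supply the sum required at index [0], while the plain copy of [f] shifts the
    eigenvalue by 1. *)
Lemma Dch_PhiF j f z : sm f ->
  Dch k j (PhiF f) z = PhiF (Dch k (cyc j) f) z + (j == ord_max)%:R * PhiF f z.
Proof.
move=> hf; have hr : sm (fun z => f (rot z)) by exact: sm_pv.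
rewrite DchE [Td k j (PhiF f) z]Tj_mul // {1}/rot Tj_pv // invgK -/(rot z).
rewrite /PhiF DchE.
have Er : rot z 0 (cyc j) = z 0 j by rewrite mxE permK.
rewrite Er.
have Es (i : 'I_n.+1) : f (rot (swapv i j z)) = f (swapv (cyc i) (cyc j) (rot z)).
  by rewrite /rot pv_swapv invgK.
have Sr : \sum_(a < n.+1 | (cyc j < a)%N) f (swapv a (cyc j) (rot z)) =
    \sum_(i < n.+1 | (cyc j < cyc i)%N) f (rot (swapv i j z)).
  rewrite (reindex_inj (@perm_inj _ (@cyc n))) /=; apply: eq_bigr => i _.
  by rewrite Es.
rewrite Sr (eq_sym ord_max j); have [->|jm] := eqVneq j ord_max.
  rewrite cyc_max [X in _ + rc k * X = _]big_pred0; last first.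
    by move=> i; apply/negbTE; rewrite -leqNgt -ltnS.
  have -> : \sum_(i < n.+1 | ((ord0 : 'I_n.+1) < cyc i)%N) f (rot (swapv i ord_max z)) =
      \sum_(i < n.+1 | i != ord_max) f (rot (swapv i ord_max z)).
    by apply: eq_bigl => i; rewrite cycE; case: (i == ord_max).
  by rewrite mulr1n mulr0; ring.
have jlt : (j < n)%N by move: jm (ltn_ord j); rewrite -val_eqE /=; lia.
rewrite [X in _ + rc k * X = _](bigD1 ord_max) //=.
rewrite [swapv ord_max j z 0 ord_max]mxE tpermL.
have -> : \sum_(i < n.+1 | (j < i)%N && (i != ord_max))
    swapv i j z 0 ord_max * f (rot (swapv i j z)) =
  z 0 ord_max * \sum_(i < n.+1 | (cyc j < cyc i)%N) f (rot (swapv i j z)).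
  rewrite mulr_sumr; apply: eq_big => [i|i /andP[ji im]]; last first.
    by rewrite mxE tpermD.
  rewrite !cycE (negPf jm); case: (altP (i =P ord_max)) => [->|im] /=; first by rewrite andbF.
  by rewrite andbT ltnS.
by rewrite mulr0n mul0r; ring.
Qed.

Lemma jeig_PhiF e f : sm f -> jeig k e f -> jeig k (Phi e) (PhiF f).
Proof.
move=> hf h j z; rewrite Dch_PhiF // etabar_Phi rcD rc_nat.
by rewrite {1}/PhiF h /PhiF; ring.
Qed.

Lemma hp_PhiF m (N : R) f : hp m N f -> hp m.+1 N (PhiF f).
Proof. by move=> hf; apply: hp_coordM; exact: (hp_pv (@cyc n)^-1%g hf). Qed.

End Intertwiners.

Section Existence.
Context {R : realType} {n : nat}.
Variable k : R.
Hypothesis k0 : 0 <= k.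
Implicit Types (f g : 'rV[R[i]]_n.+1 -> R[i]) (z : 'rV[R[i]]_n.+1) (e x : mi n.+1) (m : nat)
  (N : R) (i j l : 'I_n.+1) (b : mi n.+1 -> R[i]).

Lemma IsE_jeig e f : IsE k e f -> jeig k e f.
Proof. by case=> _ h j z; rewrite Dch.unlock h. Qed.

Lemma IsE_peval e f : IsE k e f -> exists2 b, f =1 peval (msize e) b & b e = 1.
Proof.
case=> [[c hc] _]; exists (fun x => (x == e)%:R + (if prec x e then c x else 0)).
  move=> z; rewrite hc sumdegE -peval_delta /peval -big_split; apply: eq_bigr => x _.
  by rewrite mulrDl; case: ifP; rewrite ?mul0r.
by rewrite eqxx prec_irr addr0.
Qed.

Lemma jeig_eq e f g : f =1 g -> jeig k e f -> jeig k e g.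
Proof. by move=> /funext ->. Qed.

Lemma jeigZD e f g (a : R[i]) : sm f -> sm g -> jeig k e f -> jeig k e g ->
  jeig k e (fun z => f z + a * g z).
Proof.
move=> sf sg hf hg j z; rewrite (DchD _ _ _ sf (smZ a sg)) DchZ // hf hg; ring.
Qed.

Lemma eigen_unique e m b b' : jeig k e (peval m b) -> jeig k e (peval m b') ->
  b e = b' e -> peval m b =1 peval m b'.
Proof.
move=> h h' E.
have Ep z : peval m (fun x => b x - b' x) z = peval m b z + (-1) * peval m b' z.
  by rewrite /peval mulN1r -sumrB; apply: eq_bigr => x _; rewrite mulrBl.
move=> z; apply/eqP; rewrite -subr_eq0 -mulN1r -Ep; apply/eqP.
apply: (eigen_zero k0 (e := e)); last by rewrite E subrr.
apply: jeig_eq (fsym Ep) _; apply: jeigZD => //; exact: peval_sm.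
Qed.

Lemma IsE_unique e f g : IsE k e f -> IsE k e g -> f =1 g.
Proof.
move=> hf hg; have [b Eb b1] := IsE_peval hf; have [b' Eb' b1'] := IsE_peval hg.
move=> z; rewrite Eb Eb'; apply: (@eigen_unique e); last by rewrite b1.
  by apply: jeig_eq Eb _; exact: IsE_jeig.
by apply: jeig_eq Eb' _; exact: IsE_jeig.
Qed.

Lemma eigen_IsE e f b : f =1 peval (msize e) b -> jeig k e f -> b e = 1 -> IsE k e f.
Proof.
move=> Eb hf b1; split; last by move=> j z; rewrite -hf Dch.unlock.
have hb : jeig k e (peval (msize e) b) by exact: jeig_eq hf.
exists b => z; rewrite Eb sumdegE /peval (bigD1_seq e) ?cps_uniq ?mem_cps //= b1 mul1r.
congr (_ + _); rewrite big_seq_cond [RHS](bigD1_seq e) ?cps_uniq ?mem_cps //= prec_irr add0r.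
rewrite [RHS]big_seq_cond; apply: eq_bigr => x.
rewrite mem_cps => /andP[/eqP xm xe]; case: ifPn => // xp.
have [->|bx] := eqVneq (b x) 0; first by rewrite mul0r.
have [/below_prec[/eqP|]] := eigen_below k0 hb xm bx; first by rewrite (negPf xe).
by rewrite (negPf xp).
Qed.

Lemma PhiF_peval m b z : PhiF (peval m b) z =
  \sum_(x <- cps m | msize x == m) b x * mono (Phi x) z.
Proof.
rewrite /PhiF pevalE mulr_sumr; apply: eq_bigr => x _.
by rewrite -PhiF_mono /PhiF mulrCA.
Qed.

Lemma peval_collect m (s : seq (mi n.+1)) (c : mi n.+1 -> R[i]) (t : mi n.+1 -> mi n.+1) :
  (forall x, x \in s -> msize (t x) = m) ->
  exists2 b, (forall z, \sum_(x <- s) c x * mono (t x) z = peval m b z) &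
   forall y, b y = \sum_(x <- s | t x == y) c x.
Proof.
move=> h; exists (fun y => \sum_(x <- s | t x == y) c x) => // z.
rewrite /peval; under [RHS]eq_bigr do rewrite big_mkcond mulr_suml.
rewrite exchange_big /= [LHS]big_seq [RHS]big_seq; apply: eq_bigr => x /h xm.
rewrite (bigD1_seq (t x)) ?cps_uniq ?mem_cps ?xm //= eqxx big1 ?addr0 // => y.
by rewrite eq_sym => /negPf ->; rewrite mul0r.
Qed.

Lemma sum_cps_pact (T : nmodType) s m (F : mi n.+1 -> T) :
  \sum_(x <- cps m) F x = \sum_(x <- cps m) F (pact s x).
Proof.
rewrite -[RHS](big_map (pact s) predT) /=; apply: perm_big; apply: uniq_perm.
- exact: cps_uniq.
- rewrite map_inj_uniq ?cps_uniq //; apply: (can_inj (g := pact s^-1%g)) => x.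
  by rewrite -pactM mulgV; apply/ffunP => i; rewrite ffunE invg1 perm1.
move=> x; rewrite mem_cps; apply/idP/mapP => [xm|[y]]; last first.
  by rewrite mem_cps => ym ->; rewrite msize_pact.
exists (pact s^-1%g x); first by rewrite mem_cps msize_pact.
by rewrite -pactM mulVg; apply/ffunP => i; rewrite ffunE invg1 perm1.
Qed.

Lemma step_adj e i j : j = i.+1 :> nat -> (e i < e j)%N -> step (pact (tperm i j) e) e.
Proof.
move=> ij eij.
have E : e = pact (tperm i j) (pact (tperm i j) e).
  by apply/ffunP => l; rewrite !pact_tpermE tpermK.
rewrite {2}E; apply: step_swap; first by rewrite ij.
by rewrite !pact_tpermE tpermL tpermR.
Qed.

(** What the induction on compositions carries at once. A value at [onesv] equal to the bound [N] of
    [hp] encodes nonnegative coefficients without naming them. *)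
Definition good e f := exists N b, [/\ 0 < N, hp (msize e) N f, f onesv = rc N,
  jeig k e f & f =1 peval (msize e) b /\ b e = 1].

Lemma good0 : good [ffun=> 0%N] (fun z => mono [ffun=> 0%N] z).
Proof.
exists 1, (fun x => (x == [ffun=> 0%N])%:R); split => //.
- exact: hp_mono.
- by rewrite /mono big1 // => i _; rewrite ffunE.
- move=> j z; have [b hb Eb] := Dch_mono k j [ffun=> 0%N].
  apply/eqP; rewrite -subr_eq0 Eb /peval big1 // => x _.
  have [->|/hb] := eqVneq (b x) 0; first by rewrite mul0r.
  case=> [i i' _|i i' t y t0]; first by rewrite !ffunE.
  by rewrite !ffunE.
- by split=> [z|]; rewrite ?peval_delta ?eqxx.
Qed.

Lemma good_Phi e f : good e f -> good (Phi e) (PhiF f).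
Proof.
case=> N [b [N0 hf f1 jf [Eb b1]]].
have sf := hp_sm hf.
have [b' Eb' hb'] := @peval_collect (msize e).+1 [seq x <- cps (msize e) | msize x == msize e] b (@Phi n)
   (fun x => ltac:(by rewrite mem_filter => /andP[/eqP <- _]; rewrite msize_Phi)).
exists N, b'; rewrite msize_Phi; split=> //.
- exact: hp_PhiF.
- by rewrite /PhiF mxE mul1r (_ : rot onesv = onesv) //; apply/rowP => l; rewrite !mxE.
- exact: jeig_PhiF.
split; first by move=> z; rewrite -Eb' big_filter -PhiF_peval /PhiF Eb.
rewrite hb' big_mkcond (bigD1_seq e) ?filter_uniq ?cps_uniq ?mem_filter ?mem_cps ?eqxx //=.
rewrite b1 big1 ?addr0 // => x xe; case: eqP => // /(can_inj PhiK) E.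
by rewrite E eqxx in xe.
Qed.

Lemma good_adj e i j f : j = i.+1 :> nat -> (e i < e j)%N -> good e f ->
  good (pact (tperm i j) e)
    (fun z => f (swapv i j z) + rc (k / (etabar k e j - etabar k e i)) * f z).
Proof.
move=> ij eij [N [b [N0 hf f1 jf [Eb b1]]]].
have sf := hp_sm hf.
have gap := etabar_adj_gap k0 ij eij.
have d0 : 0 < etabar k e j - etabar k e i.
  apply: lt_le_trans gap; rewrite ltr_wpDr // ltr0n subn_gt0 //.
set d := k / _.
have dd0 : 0 <= d by rewrite /d divr_ge0 // ltW.
have hbs : jeig k e (peval (msize e) b) by exact: jeig_eq jf.
(* The swapped exponent has larger [potential] than [e], so it does not occur in [f]; the new
   leading coefficient thus comes from the reflected copy of [f] alone and is 1. *)
have bs0 : b (pact (tperm i j) e) = 0.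
  apply: contrapT => /eqP bs.
  have [h _] := eigen_below k0 hbs (msize_pact _ _) bs.
  have := step_potential (step_adj ij eij).
  case: (below_potential h) => [->|]; first by rewrite ltnn.
  by move=> h1 h2; have := ltn_trans h1 h2; rewrite ltnn.
exists ((1 + d) * N), (fun x => b (pact (tperm i j) x) + rc d * b x); split=> //.
- by rewrite mulr_gt0 // ltr_wpDr.
- rewrite msize_pact mulrDl mul1r; apply: hpD; first exact: (hp_pv (tperm i j)).
  by have := hpZ (rc d) hf; rewrite cabs_rc ger0_norm.
- have -> : swapv i j onesv = onesv :> 'rV[R[i]]_n.+1 by apply/rowP => l; rewrite !mxE.
  by rewrite f1 rcM rcD mulrDl mul1r.
- apply: jeig_adj => //; first by apply: contraTneq d0 => ->; rewrite subrr ltxx.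
  by move=> l; exact: etabar_adj.
split.
  move=> z; rewrite msize_pact !Eb /peval (sum_cps_pact (tperm i j)) /= mulr_sumr -big_split /=.
  apply: eq_bigr => x _; rewrite mono_swapv mulrDl mulrA; congr (_ * mono _ z + _).
  by apply/ffunP => l; rewrite !pact_tpermE tpermK.
have -> : pact (tperm i j) (pact (tperm i j) e) = e.
  by apply/ffunP => l; rewrite !pact_tpermE tpermK.
by rewrite b1 bs0 mulr0 addr0.
Qed.

End Existence.

(** * Nonsymmetric Jack polynomials as a basis *)

HB.lock Definition EF (R : realType) (n : nat) (k : R) (e : mi n) : 'rV[R[i]]_n -> R[i] :=
  fun z => E k e z.

Section NonsymmetricJack.
Context {R : realType} {n : nat}.
Variable k : R.
Hypothesis k0 : 0 <= k.
Implicit Types (f g : 'rV[R[i]]_n.+1 -> R[i]) (z : 'rV[R[i]]_n.+1) (e x y : mi n.+1) (m : nat)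
  (N : R) (i j l : 'I_n.+1) (b c : mi n.+1 -> R[i]).

Lemma IsE_EF e f : IsE k e f -> EF k e = f.
Proof.
move=> hf; rewrite EF.unlock /E; case: pselect => [h|[]]; last by exists f.
by apply/funext => z; apply: (IsE_unique k0 _ hf); exact: (proj2_sig (cid h)).
Qed.

Lemma good_EF_eq e f : good k e f -> EF k e = f.
Proof. by case=> N [b [_ _ _ jf [Eb b1]]]; apply: IsE_EF; exact: eigen_IsE Eb jf b1. Qed.

Lemma good_EF e : good k e (EF k e).
Proof.
move: e; apply: (@mi_ind n) => [|e h|e i j ij eij h].
- by rewrite (good_EF_eq (good0 k)); exact: good0.
- by have h' := good_Phi h; rewrite (good_EF_eq h').
- by have h' := good_adj k0 ij eij h; rewrite (good_EF_eq h').
Qed.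

Lemma EF_Phi e : EF k (Phi e) = PhiF (EF k e).
Proof. exact: good_EF_eq (good_Phi (good_EF e)). Qed.

Definition adjd e i j := k / (etabar k e j - etabar k e i).

Lemma EF_adj e i j : j = i.+1 :> nat -> (e i < e j)%N ->
  EF k (pact (tperm i j) e) = fun z => EF k e (swapv i j z) + rc (adjd e i j) * EF k e z.
Proof. by move=> ij eij; exact: good_EF_eq (good_adj k0 ij eij (good_EF e)). Qed.

Definition EN e : R := complex.Re (EF k e onesv).

Lemma EF_facts e : [/\ 0 < EN e, hp (msize e) (EN e) (EF k e), EF k e onesv = rc (EN e)
  & jeig k e (EF k e)].
Proof. by have [N [b [N0 hN E1 jE _]]] := good_EF e; rewrite /EN E1. Qed.

Lemma EF_coef e : exists b, [/\ EF k e =1 peval (msize e) b, b e = 1 &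
  forall x, msize x = msize e -> b x != 0 -> below e x].
Proof.
have [N [b [_ _ _ jE [Eb b1]]]] := good_EF e; exists b; split=> // x xm bx.
by have [] := eigen_below k0 (jeig_eq Eb jE) xm bx.
Qed.

Lemma EF_sm e : sm (EF k e).
Proof. by have [_ h _ _] := EF_facts e; exact: hp_sm h. Qed.

Lemma EF0 z : EF k [ffun=> 0%N] z = 1.
Proof.
by rewrite (good_EF_eq (good0 k)) /mono big1 // => i _; rewrite ffunE.
Qed.

Definition evalE m c z : R[i] := \sum_(e <- cps m | msize e == m) c e * EF k e z.

(** Descent from the largest [potential]: once the coefficients of larger potential vanish, the
    coefficient of the monomial [e] in the sum is [c e] alone. *)
Lemma EF_indep m c : (forall z, evalE m c z = 0) -> forall e, msize e = m -> c e = 0.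
Proof.
move=> H; have [B hB] := choice EF_coef.
have HB : forall z, peval m (fun x => \sum_(y <- cps m | msize y == m) c y * B y x) z = 0.
  move=> z; transitivity (evalE m c z); last exact: H.
  rewrite /evalE /peval; under eq_bigr do rewrite mulr_suml.
  rewrite exchange_big /=; apply: eq_bigr => y /eqP ym.
  have [-> _ _] := hB y; rewrite ym /peval mulr_sumr; apply: eq_bigr => x _.
  by rewrite mulrA.
have [M hM] := @potential_bound n.+1 m.
suff K d : forall e, (M - potential e < d)%N -> msize e = m -> c e = 0.
  by move=> e; exact: (K (M - potential e).+1).
elim: d => // d IH e ed em.
have := peval_eq0 HB em.
rewrite big_mkcond (bigD1_seq e) ?cps_uniq ?mem_cps ?em ?eqxx //= big_seq_cond big1 ?addr0.
  by have [_ -> _] := hB e; rewrite mulr1.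
move=> y; rewrite mem_cps => /andP[/eqP ym ye]; rewrite ym eqxx.
have [->|Bye] := eqVneq (B y e) 0; first by rewrite mulr0.
have [_ _ /(_ e)] := hB y; rewrite em ym => /(_ erefl Bye)/below_potential[E|lt].
  by rewrite E eqxx in ye.
by rewrite IH ?mul0r //; have := hM _ ym; lia.
Qed.

Lemma evalE_inj m c c' : (forall z, evalE m c z = evalE m c' z) ->
  forall e, msize e = m -> c e = c' e.
Proof.
move=> H e em; apply/eqP; rewrite -subr_eq0; apply/eqP.
apply: (@EF_indep m (fun x => c x - c' x)) em => z.
rewrite /evalE; under eq_bigr do rewrite mulrBl.
by rewrite sumrB -!/(evalE m _ z) H subrr.
Qed.

Lemma evalED m c c' z : evalE m (fun x => c x + c' x) z = evalE m c z + evalE m c' z.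
Proof. by rewrite /evalE -big_split; apply: eq_bigr => x _; rewrite mulrDl. Qed.

Lemma evalEZ m (t : R[i]) c z : evalE m (fun x => t * c x) z = t * evalE m c z.
Proof. by rewrite /evalE mulr_sumr; apply: eq_bigr => x _; rewrite mulrA. Qed.

Lemma evalE_delta m e z : msize e = m -> evalE m (fun x => (x == e)%:R) z = EF k e z.
Proof.
move=> em; rewrite /evalE big_mkcond (bigD1_seq e) ?cps_uniq ?mem_cps ?em ?eqxx //= mul1r.
by rewrite big1 ?addr0 // => x /negPf ->; rewrite mul0r if_same.
Qed.

Lemma evalE_0 m z : evalE m (fun=> 0) z = 0.
Proof. by rewrite /evalE big1 // => x _; rewrite mul0r. Qed.

Definition espan m f := exists c, f =1 evalE m c.

Lemma espan_sum m (I : Type) (s : seq I) (Q : pred I) (F : I -> 'rV[R[i]]_n.+1 -> R[i]) :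
  (forall t, Q t -> espan m (F t)) -> espan m (fun z => \sum_(t <- s | Q t) F t z).
Proof.
move=> H; apply: fsum_ind => // [|f g [c Ec] [c' Ec']].
  by exists (fun=> 0) => z; rewrite evalE_0.
by exists (fun x => c x + c' x) => z; rewrite evalED Ec Ec'.
Qed.

Lemma espanZ m (t : R[i]) f : espan m f -> espan m (fun z => t * f z).
Proof. by move=> [c Ec]; exists (fun x => t * c x) => z; rewrite evalEZ Ec. Qed.

Lemma mono_espan e : espan (msize e) (fun z => mono e z).
Proof.
have [d] := ubnP (potential e); elim: d e => // d IH e ed.
have [b [Eb b1 hb]] := EF_coef e.
have H : espan (msize e) (fun z => \sum_(x <- cps (msize e) | (msize x == msize e) && (x != e)) b x * mono x z).
  apply: espan_sum => x /andP[/eqP xm xe].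
  have [bx|bx] := eqVneq (b x) 0.
    by exists (fun=> 0) => z; rewrite bx mul0r evalE_0.
  apply: espanZ; rewrite -xm; apply: IH.
  case: (below_potential (hb x xm bx)) => [E|lt]; first by rewrite E eqxx in xe.
  exact: leq_trans lt _.
have [c Ec] := H; exists (fun x => (x == e)%:R + -1 * c x) => z.
rewrite evalED evalEZ evalE_delta // -Ec Eb mulN1r.
rewrite /peval (bigD1_seq e) ?cps_uniq ?mem_cps //= b1 mul1r.
rewrite big_seq_cond [X in _ + X - _](_ : _ = \sum_(x <- cps (msize e) | (msize x == msize e) && (x != e)) b x * mono x z) ?addrK //.
by rewrite [RHS]big_seq_cond; apply: eq_bigl => x; rewrite mem_cps andbA andbb.
Qed.

Lemma pol_espan (P : mi n.+1 -> Prop) m f : pol P m f -> espan m f.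
Proof.
move=> [b _ Eb]; have [c Ec] : espan m (peval m b).
  have [c Ec] : espan m (fun z => \sum_(e <- cps m | msize e == m) b e * mono e z).
    by apply: espan_sum => e /eqP em; apply: espanZ; rewrite -em; exact: mono_espan.
  by exists c => z; rewrite pevalE Ec.
by exists c => z; rewrite Eb Ec.
Qed.

Lemma hp_espan m N f : hp m N f -> espan m f.
Proof. by move/hp_pol/pol_espan. Qed.

Definition p1 z : R[i] := \sum_(i < n.+1) z 0 i.

Lemma hp_p1X m : hp m ((n.+1)%:R ^+ m) (fun z => p1 z ^+ m).
Proof.
elim: m => [|m IH].
  by rewrite expr0 -(@cabs1 R); exact: hp_cst.
apply: (@hp_eq _ _ _ _ (fun z => \sum_(i < n.+1) z 0 i * p1 z ^+ m)).
  by move=> z; rewrite exprS -mulr_suml.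
have -> : (n.+1)%:R ^+ m.+1 = \sum_(i < n.+1) (n.+1)%:R ^+ m :> R.
  by rewrite sumr_const card_ord exprS mulr_natl.
by apply: hp_sum => i _; exact: hp_coordM.
Qed.

(** Every power of [p1] lies in the span of the [E_e] of its degree, so coefficients can be chosen
    degree by degree and [cco] is not its default value. *)
Lemma cco_spec m z : p1 z ^+ m = evalE m (cco k) z.
Proof.
rewrite /cco; case: pselect => [h|[]].
  have := proj2_sig (cid h) m z; rewrite sumdegE -/(p1 z) => ->.
  rewrite /evalE big_seq_cond [RHS]big_seq_cond EF.unlock; apply: eq_bigl => e.
  by rewrite mem_cps andbT andbb.
have [C hC] := choice (fun m => hp_espan (hp_p1X m)).
exists (fun e => C (msize e) e) => m' z'; rewrite sumdegE -/(p1 z') hC.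
rewrite /evalE big_seq_cond [RHS]big_seq EF.unlock; apply: eq_big => [e|e].
  by rewrite mem_cps andbb.
by move=> /andP[_ /eqP ->].
Qed.

Lemma sm_p1X m : sm (fun z => p1 z ^+ m).
Proof. exact: hp_sm (hp_p1X m). Qed.

Lemma Td_p1X j m z : Td k j (fun z => p1 z ^+ m.+1) z = m.+1%:R * p1 z ^+ m.
Proof.
have Ep d : (fun z => p1 z ^+ d.+1) = (fun z => (\sum_(l < n.+1) z 0 l) * p1 z ^+ d).
  by apply/funext => y; rewrite exprS.
elim: m => [|m IH]; rewrite Ep Tj_mulp1; try exact: sm_p1X.
  have -> : (fun z => p1 z ^+ 0) = (fun=> 1) by apply/funext => y; rewrite expr0.
  by rewrite Tj_cst mulr0 add0r mul1r.
by rewrite IH -/(p1 z) !exprS -natr1; ring.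
Qed.

(** Allows division by [z_n], so that knowing [z_n T_n f] determines [T_n f] also where [z_n = 0];
    coefficients are compared, without a continuity argument. *)
Lemma coordM_eq0 l m N g : hp m N g -> (forall z, z 0 l * g z = 0) -> forall z, g z = 0.
Proof.
move=> /hp_pol[b _ Eb] H z.
have [b' Eb' hb'] := @peval_collect R n m.+1 [seq x <- cps m | msize x == m] b
   (fun x => [ffun i => x i + (i == l)]%N)
   (fun x => ltac:(by rewrite mem_filter => /andP[/eqP <- _]; rewrite msize_add1)).
have Z (y : 'rV[R[i]]_n.+1) : peval m.+1 b' y = 0.
  rewrite -Eb' big_filter; transitivity (y 0 l * g y); last exact: H.
  rewrite Eb pevalE mulr_sumr; apply: eq_bigr => x _.
  by rewrite -mono_coordM mulrCA.
rewrite Eb pevalE big1 // => x /eqP xm.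
suff -> : b x = 0 by rewrite mul0r.
have := peval_eq0 Z (e := [ffun i => x i + (i == l)]%N); rewrite msize_add1 xm => /(_ erefl).
rewrite hb' big_mkcond (bigD1_seq x) ?filter_uniq ?cps_uniq ?mem_filter ?mem_cps ?xm ?eqxx //=.
rewrite big1 ?addr0 // => y yx; case: eqP => // E.
by case/eqP: yx; apply/ffunP => i; move/ffunP/(_ i): E; rewrite !ffunE => /addIn.
Qed.

(* Inverse of the raising operator [PhiF] up to scalars; [DeltaT] is its [n.+1]-st iterate. *)
Definition PsiF f z : R[i] := Td k ord_max f (pv (@cyc n) z).

(* The eigenvalue of [z_n T_n = D_n + k (n - 1)] on [E_e], in [n.+1] variables. *)
Definition pf e : R := etabar k e ord_max + k * n%:R.

Lemma mrank_le e j : (mrank e j <= n)%N.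
Proof. by rewrite -ltnS mrank_bound. Qed.

(** A zero in the last place comes after every other part, so its rank is [n] and the eigenvalue is
    [- k * n]. *)
Lemma pf_zero e : e ord_max = 0%N -> pf e = 0.
Proof.
move=> e0; rewrite /pf etabarE e0.
suff -> : mrank e ord_max = n by ring.
have := cardC1 (ord_max : 'I_n.+1); rewrite card_ord /= => En; rewrite -[RHS]En.
apply: eq_card => i; rewrite !inE /before e0.
case: (altP (i =P ord_max)) => [->|im] /=; first by rewrite e0 !ltnn.
by move: im (ltn_ord i); rewrite -val_eqE /=; lia.
Qed.

Lemma pf_Phi e : pf (Phi e) = etabar k e ord0 + 1 + k * n%:R.
Proof. by rewrite /pf etabar_Phi cyc_max eqxx. Qed.

Lemma etabar_ge e j : (e j)%:R <= etabar k e j + k * n%:R.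
Proof.
rewrite etabarE; have : k * (mrank e j)%:R <= k * n%:R.
  by rewrite ler_wpM2l // ler_nat mrank_le.
lra.
Qed.

Lemma pf_Phi_gt0 e : 0 < pf (Phi e).
Proof. by rewrite pf_Phi; have := etabar_ge e ord0; have : 0 <= (e ord0)%:R :> R by []; lra. Qed.

Lemma PsiF_EF e z : PsiF (EF k e) z = rc (pf e) * EF k (down e) z.
Proof.
have [_ he _ je] := EF_facts e.
have [N hT] : exists N, hp (msize e).-1 N (Td k ord_max (EF k e)).
  by have [_ h] := hp_Td k ord_max he; eexists; exact: h.
have key (y : 'rV[R[i]]_n.+1) : y 0 ord_max * Td k ord_max (EF k e) y = rc (pf e) * EF k e y.
  have := je ord_max y; rewrite DchE big_pred0; last first.
    by move=> i; apply/negbTE; rewrite -leqNgt -ltnS.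
  rewrite mulr0 addr0 => /(canRL (addrK _)) ->.
  by rewrite /pf rcD rcM rc_nat -natr1; ring.
have [e0|e0] := posnP (e ord_max).
  by rewrite /PsiF pf_zero // mul0r; apply: (coordM_eq0 hT (l := ord_max)) => y; rewrite key pf_zero // mul0r.
have Ee := downK e0.
have hd : hp (msize e).-1 (EN (down e)) (fun y : 'rV[R[i]]_n.+1 => EF k (down e) (rot y)).
  rewrite (msize_down e0) /=; have [_ h _ _] := EF_facts (down e).
  exact: (hp_pv (@cyc n)^-1%g h).
rewrite /PsiF; set y := pv _ z.
have <- : rot y = z by rewrite /rot /y pvK.
apply/eqP; rewrite -subr_eq0; apply/eqP; move: y.
apply: (coordM_eq0 (hpB hT (hpZ (rc (pf e)) hd)) (l := ord_max)) => y.
by rewrite mulrBr key -{2}Ee EF_Phi /PhiF; ring.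
Qed.

End NonsymmetricJack.

(** * The scalars [c_eta] and the values [L_eta(1)] *)

Section Coefficients.
Context {R : realType} {n : nat}.
Variable k : R.
Hypothesis k0 : 0 <= k.
Implicit Types (f g : 'rV[R[i]]_n.+1 -> R[i]) (z : 'rV[R[i]]_n.+1) (e x y : mi n.+1) (m : nat)
  (N : R) (i j l : 'I_n.+1) (a c : mi n.+1 -> R[i]).

Lemma Td_sum j (I : Type) (s : seq I) (P : pred I) (F : I -> 'rV[R[i]]_n.+1 -> R[i]) z :
  (forall t, P t -> sm (F t)) ->
  Td k j (fun z => \sum_(t <- s | P t) F t z) z = \sum_(t <- s | P t) Td k j (F t) z.
Proof.
move=> H; apply: (@fsum_additive _ _ _ sm (fun f => Td k j f z)) => //.
- exact: sm_cst.
- exact: smD.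
- exact: Tj_cst.
- by move=> f g; exact: TjD.
Qed.

Lemma PsiF_evalE m c z : PsiF k (evalE k m c) z =
  \sum_(e <- cps m | msize e == m) c e * (rc (pf k e) * EF k (down e) z).
Proof.
rewrite /PsiF Td_sum; last by move=> e _; apply: smZ; exact: EF_sm.
apply: eq_bigr => e _; rewrite TjZ; last exact: EF_sm.
by rewrite -/(PsiF k (EF k e) z) PsiF_EF.
Qed.

Lemma sum_cps_Phi m (F : mi n.+1 -> R[i]) : (forall e, e ord_max = 0%N -> F e = 0) ->
  \sum_(e <- cps m.+1 | msize e == m.+1) F e = \sum_(x <- cps m | msize x == m) F (Phi x).
Proof.
move=> H; rewrite (bigID (fun e : mi n.+1 => 0 < e ord_max)%N) /=.
rewrite [X in _ + X = _]big1 ?addr0; last by move=> e /andP[_]; rewrite -eqn0Ngt => /eqP/H.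
rewrite -[RHS]big_filter -(big_map (@Phi n) predT) -big_filter; apply: perm_big.
apply: uniq_perm.
- by rewrite filter_uniq ?cps_uniq.
- by rewrite map_inj_uniq ?filter_uniq ?cps_uniq //; exact: can_inj (@PhiK n).
move=> e; rewrite mem_filter mem_cps; apply/idP/mapP => [|[x]].
  case/andP => /andP[/eqP em e0] _; exists (down e); last by rewrite downK.
  by rewrite mem_filter mem_cps; move: em; rewrite (msize_down e0) => -[->]; rewrite eqxx.
rewrite mem_filter => /andP[/eqP xm _ ->].
by rewrite msize_Phi xm eqxx /= ffunE eqxx addn1.
Qed.

Lemma p1_pv s z : p1 (pv s z) = p1 z.
Proof.
by rewrite /p1 [RHS](reindex_inj (@perm_inj _ s)) /=; apply: eq_bigr => i _; rewrite mxE.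
Qed.

(* Compares coefficients in [PsiF (p1 ^+ m.+1) = m.+1 * p1 ^+ m]. *)
Lemma cco_Phi x : cco k (Phi x) * rc (pf k (Phi x)) = (msize x).+1%:R * cco k x.
Proof.
set m := msize x.
apply: (@evalE_inj R n k k0 m (fun x => cco k (Phi x) * rc (pf k (Phi x)))
  (fun x => m.+1%:R * cco k x)) => // z.
rewrite evalEZ -cco_spec // -(p1_pv (@cyc n)) -(Td_p1X k ord_max) -/(PsiF k _ z).
have -> : (fun z => p1 z ^+ m.+1) = evalE k m.+1 (cco k).
  by apply/funext => y; exact: cco_spec.
rewrite PsiF_evalE sum_cps_Phi => [|e e0]; last by rewrite pf_zero // mul0r mulr0.
by apply: eq_bigr => y _; rewrite PhiK mulrA.
Qed.

Lemma adjd_bounds e i j : j = i.+1 :> nat -> (e i < e j)%N -> 0 <= adjd k e i j < 1.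
Proof.
move=> ij eij; have gap := etabar_adj_gap k0 ij eij.
have d1 : 1 <= (e j - e i)%N%:R :> R by rewrite ler1n subn_gt0.
have d0 : 0 < etabar k e j - etabar k e i.
  by apply: lt_le_trans gap; rewrite ltr_wpDr // (lt_le_trans ltr01).
apply/andP; split; first by apply: divr_ge0 => //; exact: ltW.
rewrite /adjd ltr_pdivrMr // mul1r; apply: lt_le_trans gap.
by rewrite ltrDr (lt_le_trans ltr01).
Qed.

Lemma pact_tpermK i j e : pact (tperm i j) (pact (tperm i j) e) = e.
Proof. by apply/ffunP => l; rewrite !pact_tpermE tpermK. Qed.

Lemma EF_swapv_lt e i j z : j = i.+1 :> nat -> (e i < e j)%N ->
  EF k e (swapv i j z) = EF k (pact (tperm i j) e) z - rc (adjd k e i j) * EF k e z.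
Proof. by move=> ij eij; rewrite EF_adj // addrK. Qed.

Lemma EF_swapv_gt e i j z : j = i.+1 :> nat -> (e j < e i)%N ->
  let d := rc (adjd k (pact (tperm i j) e) i j) in
  EF k e (swapv i j z) = (1 - d ^+ 2) * EF k (pact (tperm i j) e) z + d * EF k e z.
Proof.
move=> ij eij d; set x := pact (tperm i j) e in d *.
have xij : (x i < x j)%N by rewrite /x !pact_tpermE tpermL tpermR.
have Ee : EF k e = fun z => EF k x (swapv i j z) + d * EF k x z.
  by rewrite -(EF_adj k0 ij xij) /x pact_tpermK.
have -> : EF k e (swapv i j z) = EF k x z + d * EF k x (swapv i j z).
  by rewrite Ee swapvK.
have -> : EF k e z = EF k x (swapv i j z) + d * EF k x z by rewrite Ee.
by ring.
Qed.

(** The difference [s_i E_e - E_e] is an eigenfunction with the eigenvalues of [e] at [i] and [j]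
    exchanged. Since equal adjacent parts have consecutive ranks, any [y] in its expansion satisfies
    [etabar k y i = etabar k y j - k], whereas [y j < y i] forces [etabar k y i] to be the strictly
    larger one. *)
Lemma EF_swapv_eq e i j y : j = i.+1 :> nat -> e i = e j -> (y j < y i)%N -> msize y = msize e ->
  exists2 a, (forall z, EF k e (swapv i j z) = evalE k (msize e) a z) & a y = 0.
Proof.
move=> ij eij yij ym.
have [_ he _ je] := EF_facts k0 e; have se := hp_sm he.
have hs : hp (msize e) (EN k e) (fun z => EF k e (swapv i j z)) by exact: (hp_pv (tperm i j) he).
have [a Ea] := hp_espan k0 (hpB hs he).
exists (fun x => a x + (x == e)%:R) => [z|].
  by rewrite evalED evalE_delta // -Ea subrK.
have ye : (y == e) = false by apply/eqP => E; move: yij; rewrite E eij ltnn.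
rewrite ye addr0.
have eval_eig l (lam : R) : (forall z, Dch k l (fun z => EF k e (swapv i j z) - EF k e z) z =
     rc lam * (EF k e (swapv i j z) - EF k e z)) -> a y * (rc (etabar k y l) - rc lam) = 0.
  move=> H; apply: (@EF_indep R n k k0 (msize e)
    (fun x => a x * (rc (etabar k x l) - rc lam))) => // z.
  have Ea' : (fun z => EF k e (swapv i j z) - EF k e z) = evalE k (msize e) a.
    by apply/funext => z'; exact: Ea.
  have := H z; rewrite Ea' Ea /evalE Dch_sum; last first.
    by move=> x _; apply: smZ; exact: EF_sm.
  move/eqP; rewrite -subr_eq0 mulr_sumr -sumrB => /eqP E; rewrite -[RHS]E.
  apply: eq_bigr => x _; rewrite DchZ; last exact: EF_sm.
  have [_ _ _ jx] := EF_facts k0 x; rewrite jx; ring.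
have bij : etabar k e i = etabar k e j + k.
  have bef : before e i j by rewrite /before eij eqxx ij ltnn /=.
  have Er : mrank e j = (mrank e i).+1.
    rewrite /mrank (cardsD1 i) inE bef add1n; congr _.+1; apply: eq_card => l.
    rewrite !inE /before eij; case: (altP (l =P i)) => [->|li] /=; first by rewrite ?eij !ltnn ?andbF.
    by rewrite ij ltnS [(l <= i)%N]leq_eqVlt val_eqE (negPf li).
  by rewrite !etabarE Er eij -natr1; ring.
have sg (t : R[i]) : sm (fun z => t * EF k e z) by exact: smZ.
have ss : sm (fun z => EF k e (swapv i j z)) by exact: (sm_pv (tperm i j)).
have E1 z : (fun z => EF k e (swapv i j z) - EF k e z) =
    (fun z => EF k e (swapv i j z) + -1 * EF k e z).
  by apply/funext => z'; rewrite mulN1r.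
have Hi : a y * (rc (etabar k y i) - rc (etabar k e j)) = 0.
  apply: eval_eig => z; rewrite E1 // DchD // DchZ // (Dch_adj_left k z se ij) !je.
  by rewrite bij rcD; ring.
have Hj : a y * (rc (etabar k y j) - rc (etabar k e i)) = 0.
  apply: eval_eig => z; rewrite E1 // DchD // DchZ // (Dch_adj_right k z se ij) !je.
  by rewrite bij rcD; ring.
have [->//|ay] := eqVneq (a y) 0.
have Z lam l : a y * (rc (etabar k y l) - rc lam) = 0 -> etabar k y l = lam.
  by move/eqP; rewrite mulf_eq0 (negPf ay) /= subr_eq0 => /eqP/rc_inj.
have bef : before y i j by rewrite /before yij.
have := etabar_before k0 bef; rewrite (Z _ _ Hi) (Z _ _ Hj) bij => h1.
exfalso; have : (y j)%:R + 1 <= (y i)%:R :> R by rewrite natr1 ler_nat.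
move: h1 k0; clear; move=> h1 h2 h3; lra.
Qed.

(* Compares coefficients in the invariance of [p1 ^+ m] under [swapv i j]. *)
Lemma cco_adj e i j : j = i.+1 :> nat -> (e i < e j)%N ->
  cco k e = rc (1 - adjd k e i j) * cco k (pact (tperm i j) e).
Proof.
move=> ij eij; set w := pact (tperm i j) e; set m := msize e; set d := rc (adjd k e i j).
have wm : msize w = m by exact: msize_pact.
have wij : (w j < w i)%N by rewrite /w !pact_tpermE tpermL tpermR.
have we : w != e by apply: contraTneq eij => E; move: wij; rewrite E -leqNgt => /ltnW.
(* Only the coefficient at [w] of each reflected [E_y] matters. The case distinction follows the
   order of [y i] and [y j]: one contribution comes from [y = e], one from [y = w], and equal parts
   give none. *)
have HA y : exists a, msize y = m -> (forall z, EF k y (swapv i j z) = evalE k m a z) /\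
    a w = (if y == e then 1 else if y == w then d else 0).
  have [ym|ym] := eqVneq (msize y) m; last by exists (fun=> 0) => E; rewrite E eqxx in ym.
  case: (ltngtP (y i) (y j)) => yij.
  - exists (fun x => (x == pact (tperm i j) y)%:R + (- rc (adjd k y i j)) * (x == y)%:R) => _; split=> [z|].
      by rewrite evalED evalEZ !evalE_delta ?msize_pact // EF_swapv_lt // mulNr.
    have -> : (w == pact (tperm i j) y) = (y == e).
      rewrite /w; apply/eqP/eqP => [/(congr1 (pact (tperm i j)))|-> //].
      by rewrite !pact_tpermK.
    have -> : (w == y) = false by apply/eqP => E; move: wij; rewrite E; lia.
    have -> : (y == w) = false by apply/eqP => E; move: wij; rewrite -E; lia.
    by rewrite mulr0 addr0; case: (y == e).
  - pose d' := rc (adjd k (pact (tperm i j) y) i j).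
    exists (fun x => (1 - d' ^+ 2) * (x == pact (tperm i j) y)%:R + d' * (x == y)%:R) => _; split=> [z|].
      by rewrite evalED !evalEZ !evalE_delta ?msize_pact // EF_swapv_gt.
    have -> : (w == pact (tperm i j) y) = false.
      apply/eqP => /(congr1 (pact (tperm i j))); rewrite !pact_tpermK => E.
      by move: yij; rewrite -E; lia.
    have -> : (y == e) = false by apply/eqP => E; move: yij; rewrite E; lia.
    rewrite mulr0 add0r eq_sym; case: eqP => [E|_]; last by rewrite mulr0.
    by rewrite mulr1 /d' E /w pact_tpermK.
  - have [a Ha a0] := EF_swapv_eq ij yij wij (etrans wm (esym ym)).
    exists a => _; split; first by rewrite -ym.
    rewrite a0; case: eqP => [E|_]; first by move: eij; rewrite -E yij ltnn.
    by case: eqP => [E|//]; move: wij; rewrite -E yij ltnn.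
have [A hA] := choice HA.
have Ew : cco k w = \sum_(y <- cps m | msize y == m) cco k y * A y w.
  apply: (@evalE_inj R n k k0 m (cco k) (fun x => \sum_(y <- cps m | msize y == m) cco k y * A y x)) => // z.
  rewrite -(cco_spec k0) -(p1_pv (tperm i j)) (cco_spec k0).
  rewrite /evalE [RHS]big_mkcond; under [RHS]eq_bigr do rewrite mulr_suml.
  transitivity (\sum_(y <- cps m | msize y == m) \sum_(x <- cps m | msize x == m) cco k y * A y x * EF k x z).
    apply: eq_bigr => y /eqP ym; have [-> _] := hA y ym.
    by rewrite /evalE mulr_sumr; apply: eq_bigr => x _; rewrite mulrA.
  by rewrite exchange_big /= big_mkcond.
have hAw y : msize y = m -> A y w = if y == e then 1 else if y == w then d else 0.
  by move=> /(hA y)[].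
have Es : \sum_(y <- cps m | msize y == m) cco k y * A y w = cco k e + cco k w * d.
  rewrite big_mkcond (bigD1_seq e) ?cps_uniq ?mem_cps ?eqxx //= hAw // eqxx mulr1.
  congr (_ + _); rewrite big_mkcond (bigD1_seq w) ?cps_uniq ?mem_cps ?wm ?eqxx //= we.
  rewrite hAw // (negPf we) eqxx big1 ?addr0 // => y yw.
  case: ifP => // ye; case: eqP => // ym.
  by rewrite hAw // (negPf ye) (negPf yw) mulr0.
rewrite rcB -/d mulrBl mul1r {1}Ew Es; ring.
Qed.

Lemma cco_pos e : exists2 r : R, 0 < r & cco k e = rc r.
Proof.
move: e; apply: (@mi_ind n) => [|e [r r0 Er]|e i j ij eij [r r0 Er]].
- exists 1 => //.
  rewrite (@evalE_inj R n k k0 0 (cco k) (fun x => (x == [ffun=> 0%N])%:R) _ [ffun=> 0%N]) ?eqxx ?msize0 // => z.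
  by rewrite evalE_delta ?msize0 // EF0 // -cco_spec // expr0.
- have p0 := pf_Phi_gt0 k0 e.
  exists ((msize e).+1%:R * r / pf k (Phi e)); first by rewrite divr_gt0 // mulr_gt0.
  rewrite !rcM rc_nat rcV -Er -cco_Phi mulfK // rc_eq0 gt_eqF //.
- have /andP[d0 d1] := adjd_bounds ij eij.
  have d1' : 0 < 1 - adjd k e i j by rewrite subr_gt0.
  exists (r / (1 - adjd k e i j)); first by rewrite divr_gt0.
  by rewrite rcM rcV -Er (cco_adj ij eij) mulrC mulKf // rc_eq0 gt_eqF.
Qed.

Definition LF e z : R[i] := cco k e * EF k e z.

Definition cr e : R := complex.Re (cco k e).

Definition LN e : R := cr e * EN k e.

Lemma crP e : 0 < cr e /\ cco k e = rc (cr e).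
Proof. by have [r r0 E] := cco_pos e; rewrite /cr E. Qed.

Lemma LN_gt0 e : 0 < LN e.
Proof. by have [h _] := crP e; have [h' _ _ _] := EF_facts k0 e; exact: mulr_gt0. Qed.

Lemma LF1 e : LF e onesv = rc (LN e).
Proof. by have [_ E] := crP e; have [_ _ E' _] := EF_facts k0 e; rewrite /LF E E' -rcM. Qed.

Lemma hp_LF e : hp (msize e) (LN e) (LF e).
Proof.
have [r0 E] := crP e; have [_ h _ _] := EF_facts k0 e.
by have := hpZ (cco k e) h; rewrite {1}E cabs_rc gtr0_norm.
Qed.

Lemma LN_Phi e : LN (Phi e) * (etabar k e ord0 + 1 + k * n%:R) = (msize e).+1%:R * LN e.
Proof.
apply: rc_inj; rewrite [LHS]rcM [RHS]rcM rc_nat -!LF1 -pf_Phi /LF mulrAC cco_Phi EF_Phi //.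
have -> : PhiF (EF k e) onesv = EF k e onesv.
  by rewrite /PhiF mxE mul1r; congr (EF k e _); apply/rowP => l; rewrite !mxE.
by rewrite mulrA.
Qed.

(** The factor [1 + d] is the intertwiner evaluated at [onesv], the factor [1 - d] comes from
    [cco_adj]. *)
Lemma LN_adj e i j : j = i.+1 :> nat -> (e i < e j)%N ->
  (1 - adjd k e i j) * LN (pact (tperm i j) e) = (1 + adjd k e i j) * LN e.
Proof.
move=> ij eij; apply: rc_inj; rewrite [LHS]rcM [RHS]rcM -!LF1 /LF mulrA -cco_adj // EF_adj //.
have -> : swapv i j onesv = onesv :> 'rV[R[i]]_n.+1 by apply/rowP => l; rewrite !mxE.
by rewrite rcD; ring.
Qed.

Lemma PsiF_LF e z : PsiF k (LF e) z =
  if (0 < e ord_max)%N then (msize e)%:R * LF (down e) z else 0.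
Proof.
rewrite /PsiF TjZ; last exact: EF_sm.
rewrite -/(PsiF k (EF k e) z) PsiF_EF //; case: posnP => [e0|e0].
  by rewrite pf_zero // mul0r mulr0.
rewrite mulrA -{1 2}(downK e0) cco_Phi /LF mulrA; congr (_ * _ * _).
by rewrite (msize_down e0).
Qed.

End Coefficients.

(** * The product of all Dunkl operators *)

Lemma DeltaTE (R : realType) (n : nat) (k : R) (f : 'rV[R[i]]_n -> R[i]) (z : 'rV[R[i]]_n) :
  DeltaT k f z = foldr (fun j g => Td k j g) f (enum 'I_n) z.
Proof.
rewrite /DeltaT; congr (_ z); elim: (enum _) => //= j s ->.
by apply/funext => y; rewrite Td.unlock.
Qed.

Section Orbits.
Context {n : nat}.
Implicit Types (e x : mi n).

Lemma allpos_pact s e : allpos (pact s e) = allpos e.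
Proof.
apply/forallP/forallP => h i; first by rewrite -(pactE s); exact: h.
by rewrite ffunE; exact: h.
Qed.

Lemma inorbitP e x : reflect (exists s, e = pact s x) (inorbit e x).
Proof. by apply: (iffP existsP) => -[s] => [/eqP|->]; exists s. Qed.

Lemma minus1_pact s e : minus1 (pact s e) = pact s (minus1 e).
Proof. by apply/ffunP => i; rewrite !ffunE. Qed.

Lemma minus1_inj e x : allpos e -> allpos x -> minus1 e = minus1 x -> e = x.
Proof.
move=> /forallP he /forallP hx E; apply/ffunP => i.
move/ffunP/(_ i): E (he i) (hx i); rewrite !ffunE /=; lia.
Qed.

End Orbits.

Section DeltaT.
Context {R : realType} {n : nat}.
Variable k : R.
Hypothesis k0 : 0 <= k.
Implicit Types (f g : 'rV[R[i]]_n.+1 -> R[i]) (z : 'rV[R[i]]_n.+1) (e x y : mi n.+1)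
  (m t : nat) (N : R) (i j : 'I_n.+1) (a : mi n.+1 -> R[i]).

Lemma hp_PsiF m N f : hp m N f -> exists N', hp m.-1 N' (PsiF k f).
Proof.
move=> hf; have [_ h] := hp_Td k ord_max hf; eexists; exact: (hp_pv (@cyc n) h).
Qed.

Lemma hp_iter_PsiF t m N f : hp m N f -> exists N', hp (m - t) N' (iter t (PsiF k) f).
Proof.
move=> hf; elim: t => [|t [N' IH]]; first by exists N; rewrite subn0.
by rewrite subnS iterS; exact: hp_PsiF IH.
Qed.

Lemma iter_cyc t i : iter t (@cyc n) i = ((i + t) %% n.+1)%N :> nat.
Proof.
elim: t => [|t IH]; first by rewrite addn0 modn_small.
by rewrite iterS permE /= IH -addn1 modnDml addn1 addnS.
Qed.

Lemma DeltaT_PsiF m N f z : hp m N f -> DeltaT k f z = iter n.+1 (PsiF k) f z.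
Proof.
move=> hf; rewrite DeltaTE.
pose s t := ((@cyc n)^-1 ^+ t)%g.
(* The fold applies the last operator first. Each [T_j] is a conjugate of the last one by a power of
   the cycle, so the operators of the last [t] indices amount to [t] applications of [PsiF] up to a
   power of the cycle, which is trivial at [t = n.+1]. *)
have H t : (t <= n.+1)%N -> foldr (fun j g => Td k j g) f (drop (n.+1 - t) (enum 'I_n.+1)) =
    fun z => iter t (PsiF k) f (pv (s t) z).
  elim: t => [|t IH] tn.
    rewrite subn0 drop_oversize ?size_enum_ord //; apply/funext => y.
    by rewrite /s expg0 pv1.
  have [N' ht] := hp_iter_PsiF t hf.
  rewrite (drop_nth ord0) ?size_enum_ord ?subnSK //; last by lia.
  rewrite /= IH; last exact: ltnW.
  apply/funext => y; rewrite (Tj_pv k (s t)); last exact: hp_sm ht.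
  rewrite /s expgS -pvM /PsiF pvKV; congr (Td k _ _ _).
  rewrite expVgn invgK permX; apply: val_inj.
  apply: etrans (iter_cyc _ _) _; rewrite /= nth_enum_ord; last by lia.
  by rewrite subSS subnK // modn_small.
have := H n.+1 (leqnn _); rewrite subnn drop0 => ->.
suff -> : s n.+1 = 1%g by rewrite pv1.
apply/eqP; rewrite /s expVgn invg_eq1; apply/eqP/permP => j.
apply: val_inj; rewrite permX perm1; apply: etrans (iter_cyc _ _) _.
by rewrite modnDr modn_small.
Qed.

Lemma PsiFZ (a : R[i]) f z : sm f -> PsiF k (fun z => a * f z) z = a * PsiF k f z.
Proof. by move=> hf; rewrite /PsiF TjZ. Qed.

Lemma iter_PsiFZ s (a : R[i]) m N f z : hp m N f ->
  iter s (PsiF k) (fun z => a * f z) z = a * iter s (PsiF k) f z.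
Proof.
move=> hf; elim: s z => // s IH z; rewrite !iterS.
have -> : iter s (PsiF k) (fun z => a * f z) = fun z => a * iter s (PsiF k) f z.
  by apply/funext.
by have [N' h] := hp_iter_PsiF s hf; rewrite PsiFZ //; exact: hp_sm h.
Qed.

Lemma iter_PsiF_sum s (I : Type) (r : seq I) (P : pred I) (F : I -> 'rV[R[i]]_n.+1 -> R[i]) m (N : I -> R) z :
  (forall d, P d -> hp m (N d) (F d)) ->
  iter s (PsiF k) (fun z => \sum_(d <- r | P d) F d z) z = \sum_(d <- r | P d) iter s (PsiF k) (F d) z.
Proof.
move=> hF; elim: s z => // s IH z; rewrite !iterS.
have -> : iter s (PsiF k) (fun z => \sum_(d <- r | P d) F d z) =
  fun z => \sum_(d <- r | P d) iter s (PsiF k) (F d) z by apply/funext.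
rewrite {1}/PsiF Td_sum // => d Pd.
by have [N' h] := hp_iter_PsiF s (hF d Pd); exact: hp_sm h.
Qed.

Definition acoef e : R := \prod_(s < n.+1) pf k (iter s (@down n) e).

Lemma DeltaT_EF e z : DeltaT k (EF k e) z = rc (acoef e) * EF k (minus1 e) z.
Proof.
have [_ he _ _] := EF_facts k0 e.
rewrite (DeltaT_PsiF z he) /acoef -iter_down_minus1.
suff H t : forall z, iter t (PsiF k) (EF k e) z =
  rc (\prod_(s < t) pf k (iter s (@down n) e)) * EF k (iter t (@down n) e) z by exact: H.
elim: t => [|t IH] y; first by rewrite big_ord0 mul1r.
rewrite iterS big_ord_recr /= rcM -mulrA.
have -> : iter t (PsiF k) (EF k e) = fun z =>
  rc (\prod_(s < t) pf k (iter s (@down n) e)) * EF k (iter t (@down n) e) z by apply/funext.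
by rewrite PsiFZ; [rewrite PsiF_EF|exact: EF_sm].
Qed.

(** After [n - j] lowerings the part [j] stands last, and a zero there makes that factor vanish. *)
Lemma acoef_zero e : ~~ allpos e -> acoef e = 0.
Proof.
move=> /forallPn[j ej]; have e0 : e j = 0%N by move: ej; rewrite -eqn0Ngt => /eqP.
have hs : (n - j < n.+1)%N by rewrite ltnS leq_subr.
rewrite /acoef (bigD1 (Ordinal hs)) //= pf_zero ?mul0r //.
by rewrite iter_down_max ?leq_subr // subKn ?inord_val // -ltnS.
Qed.

Lemma etabar_iter_down e t j : allpos e -> (t <= j)%N ->
  etabar k (iter t (@down n) e) j = etabar k e (inord (j - t)).
Proof.
move=> /forallP he; elim: t j => [|t IH] j tj; first by rewrite subn0 inord_val.
have jn := ltn_ord j.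
rewrite iterS etabar_down; last by rewrite iter_down_max //; lia.
have j0 : (j == ord0) = false by rewrite -val_eqE /=; lia.
have cv := cycV_val j; rewrite j0 in cv.
rewrite j0 subr0 IH; last by rewrite cv; lia.
by congr (etabar k e (inord _)); rewrite cv; lia.
Qed.

(** Lowering does not change the eigenvalue of a part whose turn has not come, so every factor is an
    eigenvalue of the original [e] shifted by [k * n]. Listed by rank, the product depends on
    [etaplus e] only, whence the symmetry of [acoef]. *)
Lemma acoef_allpos e : allpos e -> acoef e = \prod_(i < n.+1) ((etaplus e i)%:R - k * (i : nat)%:R + k * n%:R).
Proof.
move=> he.
rewrite -(@big_mrank _ _ _ _ (fun r m => m%:R - k * r%:R + k * n%:R) e).
rewrite /acoef (reindex_inj rev_ord_inj) /=; apply: eq_bigr => i _.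
have := ltn_ord i => hi.
rewrite /pf etabar_iter_down //=; last by lia.
by rewrite -etabarE; congr (etabar k e _ + _); apply: val_inj; rewrite /= inordK; lia.
Qed.

Lemma acoef_pact s e : acoef (pact s e) = acoef e.
Proof.
have [he|he] := boolP (allpos e); last by rewrite !acoef_zero ?allpos_pact.
by rewrite !acoef_allpos ?allpos_pact // etaplus_pact.
Qed.

Lemma msize_iter_down e t : allpos e -> (t <= n.+1)%N ->
  msize (iter t (@down n) e) = (msize e - t)%N.
Proof.
move=> /forallP he; elim: t => [|t IH] tn; first by rewrite subn0.
have e0 : (0 < iter t (@down n) e ord_max)%N by rewrite iter_down_max.
by have := msize_down e0; rewrite IH ?(ltnW tn) // iterS subnS => ->.
Qed.

Lemma dcoefE e : allpos e -> dcoef e = (msize e ^_ n.+1)%:R :> R[i].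
Proof.
move=> he; rewrite /dcoef he -iter_down_minus1 msize_iter_down //.
have hn : (n.+1 <= msize e)%N.
  rewrite -[X in (X <= _)%N](card_ord n.+1) -sum1_card; apply: leq_sum => i _.
  by move/forallP: he.
by rewrite -(ffact_fact hn) natrM mulfK // pnatr_eq0 -lt0n fact_gt0.
Qed.

Lemma DeltaT_LF e z : DeltaT k (LF k e) z = dcoef e * LF k (minus1 e) z.
Proof.
have [_ he _ _] := EF_facts k0 e.
have [pe|pe] := boolP (allpos e); last first.
  rewrite /dcoef (negPf pe) mul0r (DeltaT_PsiF z (hp_LF k0 e)) /LF (iter_PsiFZ _ _ _ he).
  by rewrite -(DeltaT_PsiF z he) DeltaT_EF acoef_zero // mul0r mulr0.
rewrite dcoefE // (DeltaT_PsiF z (hp_LF k0 e)) -iter_down_minus1.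
have H t : (t <= n.+1)%N -> forall z, iter t (PsiF k) (LF k e) z = (msize e ^_ t)%:R * LF k (iter t (@down n) e) z.
  elim: t => [|t IH] tn y; first by rewrite ffactn0 mul1r.
  rewrite iterS.
  have -> : iter t (PsiF k) (LF k e) = fun z => (msize e ^_ t)%:R * LF k (iter t (@down n) e) z.
    by apply/funext => y'; rewrite IH // ltnW.
  rewrite PsiFZ; last exact: hp_sm (hp_LF k0 _).
  rewrite PsiF_LF // iter_down_max // (forallP pe) msize_iter_down ?(ltnW tn) //.
  by rewrite ffactnSr natrM mulrA.
exact: H.
Qed.

Lemma L_LF e : L k e = LF k e.
Proof. by apply/funext => z; rewrite /L /LF EF.unlock. Qed.

Definition CF x z : R[i] := \sum_(e <- cps (msize x) | inorbit e x) LF k e z.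

Lemma Cl_CF x : Cl k x = CF x.
Proof.
by apply/funext => z; rewrite /Cl sumdegE /CF [RHS]big_mkcond; apply: eq_bigr => e _; rewrite L_LF.
Qed.

Lemma hp_CF x : hp (msize x) (\sum_(e <- cps (msize x) | inorbit e x) LN k e) (CF x).
Proof. by apply: hp_sum => e /inorbitP[s ->]; rewrite -(msize_pact s); exact: hp_LF. Qed.

Lemma dcoef_pact s e : dcoef (pact s e) = dcoef e :> R[i].
Proof.
have [he|he] := boolP (allpos e); last by rewrite /dcoef allpos_pact (negPf he).
by rewrite !dcoefE ?allpos_pact // msize_pact.
Qed.

Lemma sum_orbit_minus1 x (F : mi n.+1 -> R[i]) : allpos x ->
  \sum_(e <- cps (msize x) | inorbit e x) F (minus1 e) =
  \sum_(e <- cps (msize (minus1 x)) | inorbit e (minus1 x)) F e.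
Proof.
move=> hx; rewrite -[LHS]big_filter -(big_map (@minus1 n.+1) predT) -[RHS]big_filter.
apply: perm_big; apply: uniq_perm.
- rewrite map_inj_in_uniq ?filter_uniq ?cps_uniq // => e y.
  rewrite !mem_filter => /andP[/inorbitP[s ->] _] /andP[/inorbitP[s' ->] _].
  by apply: minus1_inj; rewrite allpos_pact.
- by rewrite filter_uniq ?cps_uniq.
move=> y; rewrite mem_filter mem_cps; apply/mapP/andP => [[e]|[/inorbitP[s ->] _]].
  rewrite mem_filter => /andP[/inorbitP[s ->] _ ->]; rewrite minus1_pact.
  by split; [apply/inorbitP; exists s|rewrite msize_pact].
exists (pact s x); last by rewrite minus1_pact.
by rewrite mem_filter mem_cps msize_pact eqxx andbT; apply/inorbitP; exists s.
Qed.

Lemma DeltaT_CF x z : DeltaT k (CF x) z = dcoef x * CF (minus1 x) z.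
Proof.
rewrite (DeltaT_PsiF z (hp_CF x)) (@iter_PsiF_sum _ _ _ _ _ (msize x) (LN k)); last first.
  by move=> e /inorbitP[s ->]; rewrite -(msize_pact s); exact: hp_LF.
transitivity (\sum_(e <- cps (msize x) | inorbit e x) dcoef x * LF k (minus1 e) z).
  apply: eq_bigr => e /inorbitP[s ->].
  by rewrite -(DeltaT_PsiF z (hp_LF k0 _)) DeltaT_LF dcoef_pact.
rewrite -mulr_sumr; have [hx|hx] := boolP (allpos x); last by rewrite /dcoef (negPf hx) !mul0r.
by rewrite (sum_orbit_minus1 (fun e => LF k e z)).
Qed.

Lemma iter_rot t z : iter t (@rot R n) z = pv ((@cyc n)^-1 ^+ t)%g z.
Proof.
elim: t => [|t IH]; first by rewrite expg0 pv1.
by rewrite iterS IH /rot pvM -expgS.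
Qed.

(** Undoing [n.+1] raisings extracts the last coordinate of [z] and of its successive rotations;
    these run through all coordinates, and the last rotation returns to [z]. *)
Lemma EF_minus1 e z : allpos e -> EF k e z = (\prod_(j < n.+1) z 0 j) * EF k (minus1 e) z.
Proof.
move=> he.
have H t : (t <= n.+1)%N -> EF k e z =
   (\prod_(s < t) iter s (@rot R n) z 0 ord_max) * EF k (iter t (@down n) e) (iter t (@rot R n) z).
  elim: t => [|t IH] tn; first by rewrite big_ord0 mul1r.
  rewrite IH ?(ltnW tn) // big_ord_recr /= -mulrA; congr (_ * _).
  rewrite -{1}(@downK n (iter t (@down n) e)); last by rewrite iter_down_max // (forallP he).
  by rewrite EF_Phi.
have Ez : iter n.+1 (@rot R n) z = z.
  rewrite iter_rot expVgn (_ : cyc ^+ n.+1 = 1)%g ?invg1 ?pv1 //.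
  apply/permP => j; apply: val_inj; rewrite permX perm1; apply: etrans (iter_cyc _ _) _.
  by rewrite modnDr modn_small.
rewrite (H n.+1 (leqnn _)) iter_down_minus1 Ez; congr (_ * _).
rewrite [RHS](reindex_inj rev_ord_inj) /=; apply: eq_bigr => s _.
rewrite iter_rot mxE; congr (z 0 _).
apply: (@perm_inj _ ((@cyc n) ^+ s)%g); rewrite expVgn permKV permX.
apply: val_inj; apply: etrans (esym (iter_cyc _ _)).
by rewrite /= subSS subnK ?modn_small // -ltnS.
Qed.

Lemma cco_neq0 e : cco k e != 0.
Proof. by have [h ->] := crP k0 e; rewrite rc_eq0 gt_eqF. Qed.

Lemma EF1_neq0 e : EF k e onesv != 0.
Proof. by have [h _ -> _] := EF_facts k0 e; rewrite rc_eq0 gt_eqF. Qed.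

Lemma LF1_neq0 e : LF k e onesv != 0.
Proof. by rewrite LF1 // rc_eq0 gt_eqF // LN_gt0. Qed.

(** Both sides express the action of the product of Dunkl operators on [L_e], through [E_e] and
    directly; the value at [onesv] is nonzero and can be cancelled. *)
Lemma cco_acoef e : cco k e * rc (acoef e) = dcoef e * cco k (minus1 e).
Proof.
apply: (mulIf (EF1_neq0 (minus1 e))); rewrite -!mulrA -DeltaT_EF.
rewrite -[RHS]DeltaT_LF; have [_ he _ _] := EF_facts k0 e.
by rewrite (DeltaT_PsiF _ he) (DeltaT_PsiF _ (hp_LF k0 e)) /LF (iter_PsiFZ _ _ _ he).
Qed.

Lemma dcoef_neq0 e : allpos e -> dcoef e != 0 :> R[i].
Proof.
move=> he; rewrite /dcoef he mulf_neq0 ?invr_eq0 // pnatr_eq0 -lt0n fact_gt0 //.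
Qed.

Lemma acoef_neq0 e : allpos e -> rc (acoef e) != 0.
Proof.
move=> he; apply/eqP => E; have := cco_acoef e; rewrite E mulr0 => /esym/eqP.
by rewrite mulf_eq0 (negPf (cco_neq0 _)) orbF (negPf (dcoef_neq0 he)).
Qed.

Lemma LF_minus1 e z : allpos e ->
  LF k e z = dcoef e / rc (acoef e) * (\prod_(j < n.+1) z 0 j) * LF k (minus1 e) z.
Proof.
move=> he; rewrite /LF EF_minus1 //.
have -> : cco k e = dcoef e / rc (acoef e) * cco k (minus1 e).
  by rewrite mulrAC -cco_acoef mulfK // acoef_neq0.
by ring.
Qed.

Lemma CF_minus1 x z : allpos x ->
  CF x z = dcoef x / rc (acoef x) * (\prod_(j < n.+1) z 0 j) * CF (minus1 x) z.
Proof.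
move=> hx; rewrite /CF mulr_sumr -(sum_orbit_minus1 (fun e => _ * LF k e z) hx).
apply: eq_bigr => e /inorbitP[s ->].
by rewrite LF_minus1 ?allpos_pact // dcoef_pact acoef_pact.
Qed.

Lemma CF1 x : exists2 N : R, 0 < N & CF x onesv = rc N /\ hp (msize x) N (CF x).
Proof.
exists (\sum_(e <- cps (msize x) | inorbit e x) LN k e); last first.
  split; last exact: hp_CF.
  rewrite /CF; transitivity (\sum_(e <- cps (msize x) | inorbit e x) rc (LN k e)).
    by apply: eq_bigr => e _; exact: LF1.
  by rewrite -(big_morph _ rcD rc0).
rewrite big_mkcond (bigD1_seq x) ?cps_uniq ?mem_cps //=.
have -> : inorbit x x.
  by apply/inorbitP; exists 1%g; apply/ffunP => i; rewrite ffunE invg1 perm1.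
rewrite ltr_pwDl ?LN_gt0 //; apply: sumr_ge0 => e _; case: ifP => // _.
exact: ltW (LN_gt0 k0 e).
Qed.

End DeltaT.

(** * Growth of [L_eta(1)] *)

Section Growth.
Context {R : realType} {n : nat}.
Variable k : R.
Hypothesis k0 : 0 <= k.
Implicit Types (e : mi n.+1) (m t d : nat) (i j : 'I_n.+1) (F : nat -> nat -> R).

Definition rprod F e : R := \prod_(j < n.+1) \prod_(t < e j) F (mrank e j) t.

Lemma rprodE F e : rprod F e = \prod_(i < n.+1) \prod_(t < etaplus e i) F i t.
Proof. exact: (@big_mrank _ _ _ _ (fun r d => \prod_(t < d) F r t) e). Qed.

Lemma rprod_pact F s e : rprod F (pact s e) = rprod F e.
Proof. by rewrite !rprodE etaplus_pact. Qed.

Lemma rprod_Phi F e : rprod F (Phi e) = rprod F e * F (mrank e ord0) (e ord0).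
Proof.
rewrite /rprod [in RHS](reindex_inj (@perm_inj _ (@cyc n))) /=.
rewrite (bigD1 (ord_max : 'I_n.+1)) //= [in RHS](bigD1 (ord_max : 'I_n.+1)) //= mrank_Phi cyc_max ffunE cyc_max eqxx addn1 big_ord_recr /=.
rewrite mulrAC; congr (_ * _ * _); apply: eq_bigr => j /negPf jm.
by rewrite mrank_Phi ffunE jm addn0.
Qed.

(** With it [rprod] becomes the generalized Pochhammer symbol of [1 + k * n] at the sorted
    composition. The factor of the box added by [Phi] is exactly the one dividing in [LN_Phi]. *)
Definition a0fac (r t : nat) : R := 1 + k * n%:R - k * r%:R + t%:R.

Lemma a0fac_gt0 r t : (r <= n)%N -> 0 < a0fac r t.
Proof.
move=> rn; rewrite /a0fac; have : k * r%:R <= k * n%:R by rewrite ler_wpM2l // ler_nat.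
have : 0 <= t%:R :> R by []; lra.
Qed.

Lemma rprod_a0_gt0 e : 0 < rprod a0fac e.
Proof.
by apply: prodr_gt0 => j _; apply: prodr_gt0 => t _; apply: a0fac_gt0; exact: mrank_le.
Qed.

(** The extra unit for a larger part standing on the left compensates the unit that [Phi] adds when
    the first part moves to the end. An adjacent swap of [e i < e j] changes a single gap, from
    [e j - e i] to one more. *)
Definition gap e (ab : 'I_n.+1 * 'I_n.+1) : nat := (e ab.1 - e ab.2 + (ab.1 < ab.2)%N)%N.

Definition gaps M e : R := \prod_(ab | before e ab.1 ab.2) (gap e ab)%:R ^+ M.

Lemma before_Phi e i j : before (Phi e) i j = before e (cyc i) (cyc j).
Proof. by rewrite !before_mrank !mrank_Phi. Qed.

Lemma gaps_Phi M e : gaps M (Phi e) = gaps M e.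
Proof.
rewrite /gaps [RHS](reindex (fun ab : 'I_n.+1 * 'I_n.+1 => (cyc ab.1, cyc ab.2))) /=; last first.
  exists (fun ab => (cyc^-1%g ab.1, cyc^-1%g ab.2)) => -[a b] _ /=; by rewrite ?permK ?permKV.
apply: eq_big => [[a b]|[a b]] /=; first by rewrite before_Phi.
rewrite before_Phi /gap /before /= !ffunE !cycE => h; congr (_%:R ^+ _).
move: h; have := ltn_ord a; have := ltn_ord b.
have -> : (a == ord_max) = (nat_of_ord a == n) by [].
have -> : (b == ord_max) = (nat_of_ord b == n) by [].
by case: (nat_of_ord a =P n); case: (nat_of_ord b =P n) => /=; lia.
Qed.

Lemma gaps_adj M e i j : j = i.+1 :> nat -> (e i < e j)%N ->
  gaps M (pact (tperm i j) e) * (e j - e i)%N%:R ^+ M = gaps M e * (e j - e i).+1%:R ^+ M.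
Proof.
move=> ij eij; set s := tperm i j; set w := pact s e.
have bw a b : before w (s a) (s b) = before e a b.
  by rewrite !before_mrank /w !mrank_adj // !tpermK.
have bji : before e j i by rewrite /before eij.
have -> : gaps M w = \prod_(ab | before e ab.1 ab.2) (gap w (s ab.1, s ab.2))%:R ^+ M.
  rewrite /gaps (reindex (fun ab : 'I_n.+1 * 'I_n.+1 => (s ab.1, s ab.2))) /=; last first.
    exists (fun ab => (s ab.1, s ab.2)) => -[a b] _ /=; by rewrite ?tpermK.
  by apply: eq_bigl => -[a b] /=.
rewrite /gaps (bigD1 (j, i)) //= [in RHS](bigD1 (j, i)) //=.
have -> : gap w (s j, s i) = (e j - e i).+1.
  by rewrite /gap /= /w !pactE /s tpermR tpermL ij ltnSn addn1.
have -> : gap e (j, i) = (e j - e i)%N by rewrite /gap /= ij; lia.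
have -> : \prod_(ab | before e ab.1 ab.2 && (ab != (j, i))) (gap w (s ab.1, s ab.2))%:R ^+ M =
   \prod_(ab | before e ab.1 ab.2 && (ab != (j, i))) (gap e ab)%:R ^+ M :> R.
  apply: eq_bigr => -[a b] /= /andP[ab abne]; congr (_%:R ^+ _).
  rewrite /gap /= /w !pactE adj_tperm_lt //.
  by apply/eqP => -[ai bj]; move: ab; rewrite ai bj /before; lia.
by ring.
Qed.

Lemma bernoulli M (u : R) : 0 <= u -> 1 + M%:R * u <= (1 + u) ^+ M.
Proof.
move=> u0; elim: M => [|M IH]; first by rewrite mul0r addr0.
rewrite exprS; apply: le_trans (ler_wpM2l _ IH); last by rewrite addr_ge0.
rewrite -natr1; have : 0 <= M%:R * u * u by rewrite !mulr_ge0.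
lra.
Qed.

(* Invariant under [Phi]; an adjacent swap multiplies it by [(1 + d) / (1 - d)], which the
   change of [gaps M] absorbs as soon as [2 * k <= M]. *)
Definition Gval e : R := rprod a0fac e * LN k e / (msize e)`!%:R.

Lemma Gval_ge0 e : 0 <= Gval e.
Proof.
apply: divr_ge0 => //; apply: mulr_ge0; apply: ltW; first exact: rprod_a0_gt0.
exact: LN_gt0.
Qed.

Lemma Gval_Phi e : Gval (Phi e) = Gval e.
Proof.
rewrite /Gval rprod_Phi msize_Phi factS natrM.
have -> : a0fac (mrank e ord0) (e ord0) = etabar k e ord0 + 1 + k * n%:R.
  by rewrite /a0fac etabarE; ring.
have p0 := pf_Phi_gt0 k0 e; rewrite pf_Phi in p0.
have f0 : (msize e)`!%:R != 0 :> R by rewrite pnatr_eq0 -lt0n fact_gt0.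
have m0 : (msize e).+1%:R != 0 :> R by rewrite pnatr_eq0.
have := LN_Phi k0 e; set b := etabar k e ord0 + 1 + k * n%:R in p0 * => E.
have -> : rprod a0fac e * b * LN k (Phi e) = rprod a0fac e * (LN k (Phi e) * b) by ring.
rewrite E; move: ((msize e).+1%:R) ((msize e)`!%:R) m0 f0 => u v u0 v0.
by field; rewrite u0 v0.
Qed.

Lemma Gval_adj M e i j : 2 * k <= M%:R -> j = i.+1 :> nat -> (e i < e j)%N ->
  Gval (pact (tperm i j) e) * (e j - e i)%N%:R ^+ M <= Gval e * (e j - e i).+1%:R ^+ M.
Proof.
move=> kM ij eij; set d := (e j - e i)%N.
have d1 : (0 < d)%N by rewrite subn_gt0.
have gapb : d%:R + k <= etabar k e j - etabar k e i by exact: etabar_adj_gap.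
set g := etabar k e j - etabar k e i in gapb.
have dR : 1 <= d%:R :> R by rewrite ler1n.
have g0 : 0 < g by apply: lt_le_trans gapb; apply: ltr_wpDr => //; apply: lt_le_trans dR.
have gk : 0 < g - k by rewrite subr_gt0; apply: lt_le_trans gapb; rewrite ltrDr; apply: lt_le_trans dR.
rewrite /Gval rprod_pact msize_pact.
have LNw : LN k (pact (tperm i j) e) = (g + k) / (g - k) * LN k e.
  have := LN_adj k0 ij eij; rewrite /adjd -/g => E.
  have -> : (g + k) / (g - k) * LN k e = (1 + k / g) * LN k e * (g / (g - k)).
    by field; rewrite !gt_eqF.
  by rewrite -E; field; rewrite !gt_eqF.
rewrite LNw.
have -> : rprod a0fac e * ((g + k) / (g - k) * LN k e) / (msize e)`!%:R * d%:R ^+ M =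
  rprod a0fac e * LN k e / (msize e)`!%:R * ((g + k) / (g - k) * d%:R ^+ M) by ring.
rewrite ler_wpM2l ?(Gval_ge0 e) //.
have dp : 0 < d%:R :> R by apply: lt_le_trans dR.
(* The left side is [1 + 2 * k / (g - k)], where [g - k >= d] and [2 * k <= M]. Bernoulli then
   bounds it by the [M]-th power of [(d + 1) / d], which is the change of [gaps]. *)
have h1 : (g + k) / (g - k) <= 1 + M%:R * d%:R^-1.
  rewrite ler_pdivrMr // -subr_ge0.
  have -> : (1 + M%:R * d%:R^-1) * (g - k) - (g + k) = (M%:R * (g - k) - 2 * k * d%:R) / d%:R.
    by field; rewrite gt_eqF.
  rewrite divr_ge0 // subr_ge0; apply: ler_pM => //; first by rewrite mulr_ge0.
  by rewrite lerBrDr.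
apply: le_trans (ler_wpM2r (exprn_ge0 M (ltW dp)) (le_trans h1 (bernoulli M _))) _.
  by rewrite invr_ge0 ltW.
rewrite -exprMn mulrDl mul1r mulVf ?gt_eqF // natr1.
exact: lexx.
Qed.

Lemma Gval_bound M e : 2 * k <= M%:R -> Gval e <= Gval [ffun=> 0%N] * gaps M e.
Proof.
move=> kM; move: e; apply: (@mi_ind n) => [|e IH|e i j ij eij IH].
- suff -> : gaps M [ffun=> 0%N] = 1 by rewrite mulr1.
  apply: big1 => -[a b] /=; rewrite /before /gap !ffunE ltnn /= => ->.
  by rewrite expr1n.
- by rewrite Gval_Phi gaps_Phi.
have dp : 0 < (e j - e i)%N%:R ^+ M :> R by rewrite exprn_gt0 // ltr0n subn_gt0.
rewrite -(ler_pM2r dp) -[leRHS]mulrA gaps_adj // [leRHS]mulrA.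
apply: le_trans (Gval_adj kM ij eij) _.
by rewrite ler_wpM2r // exprn_ge0.
Qed.

Lemma gaps_le M e : gaps M e <= (msize e).+1%:R ^+ (M * (n.+1 * n.+1)).
Proof.
rewrite exprM /gaps big_mkcond /=.
have -> : ((msize e).+1%:R ^+ M) ^+ (n.+1 * n.+1) =
   \prod_(ab : 'I_n.+1 * 'I_n.+1) (msize e).+1%:R ^+ M :> R.
  by rewrite prodr_const card_prod card_ord.
apply: ler_prod => -[a b] _ /=; case: ifP => _.
  rewrite exprn_ge0 //= lerXn2r ?nnegrE // ler_nat /gap /=.
  have := le_msize e a; case: (a < b)%N; lia.
by rewrite ler01 exprn_ege1 // ler1n.
Qed.

(** Up to a polynomial factor, [L_e(1) / |e|!] is at most the inverse of a generalized Pochhammer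
    symbol. The latter acts as one more denominator parameter, playing the part of the factorial in
    a one-variable hypergeometric series. *)
Lemma LN_bound : exists C Q, 0 <= C /\ forall e,
  LN k e / (msize e)`!%:R <= C * (msize e).+1%:R ^+ Q / rprod a0fac e.
Proof.
have [M kM] : exists M : nat, 2 * k <= M%:R.
  exists (Num.bound (2 * k)); apply: ltW; apply: archi_boundP.
  exact: mulr_ge0.
exists (Gval [ffun=> 0%N]), (M * (n.+1 * n.+1))%N; split.
  exact: Gval_ge0.
move=> e; rewrite ler_pdivlMr ?rprod_a0_gt0 //.
have -> : LN k e / (msize e)`!%:R * rprod a0fac e = Gval e by rewrite /Gval; ring.
apply: le_trans (Gval_bound e kM) _; by rewrite ler_wpM2l ?gaps_le // Gval_ge0.
Qed.

End Growth.

(** * Growth of quotients of Pochhammer symbols *)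

Section EventualBounds.
Context {R : realType}.
Implicit Types (u : nat -> R) (c : R[i]) (eps th K s : R) (t d m M Q T : nat).

Lemma evprod u th T : (forall t, 0 <= u t) -> 0 < th -> (forall t, (T <= t)%N -> u t <= th) ->
  exists2 C : R, 0 <= C & forall d, \prod_(t < d) u t <= C * th ^+ d.
Proof.
move=> u0 th0 H; pose P d := \prod_(t < d) u t.
have P0 d : 0 <= P d by apply: prodr_ge0.
have C0 : 0 <= \sum_(d < T.+1) P d / th ^+ d.
  by apply: sumr_ge0 => d _; rewrite divr_ge0 // exprn_ge0 // ltW.
(* A sum over the initial range dominates each of its nonnegative terms, which covers [d <= T];
   beyond [T] each new factor is at most [th]. *)
exists (\sum_(d < T.+1) P d / th ^+ d) => // d; rewrite -/(P d).
elim: d => [|d IH].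
  rewrite expr0 mulr1 (bigD1 ord0) //= expr0 divr1 lerDl.
  by apply: sumr_ge0 => d _; rewrite divr_ge0 // exprn_ge0 // ltW.
have [dT|dT] := leqP T d.
  rewrite /P big_ord_recr /= exprSr mulrA.
  by apply: ler_pM; [exact: P0|exact: u0|exact: IH|exact: H].
have hd : (d.+1 < T.+1)%N by [].
rewrite -ler_pdivrMr ?exprn_gt0 // (bigD1 (Ordinal hd)) //= lerDl.
by apply: sumr_ge0 => i _; rewrite divr_ge0 // exprn_ge0 // ltW.
Qed.

Lemma pow_eps th M : 1 < th -> exists2 eps, 0 < eps & (1 + eps) ^+ M <= th.
Proof.
elim: M th => [|M IH] th th1; first by exists 1 => //; rewrite expr0 ltW.
pose th' := (1 + th) / 2.
have th'1 : 1 < th' by rewrite /th'; lra.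
have [e e0 He] := IH _ th'1.
have th'0 : 0 < th' by lra.
have q1 : 1 < th / th' by rewrite ltr_pdivlMr // mul1r /th'; lra.
exists (Num.min e (th / th' - 1)); first by rewrite lt_min e0 subr_gt0.
set m := Num.min _ _.
have m0 : 0 <= m by rewrite /m le_min (ltW e0) subr_ge0 ltW.
have me : m <= e by rewrite /m ge_min lexx.
have mq : 1 + m <= th / th' by rewrite -lerBrDl /m ge_min lexx orbT.
rewrite exprSr; have -> : th = th' * (th / th') by rewrite mulrC divfK // gt_eqF.
apply: ler_pM => //; rewrite ?exprn_ge0 ?addr_ge0 //.
by apply: le_trans He; rewrite lerXn2r ?nnegrE ?addr_ge0 ?lerD2l // ltW.
Qed.

Lemma nat_ge (r : R) : exists T : nat, forall t, (T <= t)%N -> r <= t%:R.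
Proof.
exists (Num.bound `|r|) => t h; apply: le_trans (ler_norm r) _.
by apply: le_trans (ltW (archi_boundP (normr_ge0 r))) _; rewrite ler_nat.
Qed.

Lemma cplus_upper c eps : 0 < eps -> exists T, forall t, (T <= t)%N ->
  cabs (c + t%:R) <= (1 + eps) * (t%:R + 1).
Proof.
move=> e0; have [T HT] := nat_ge (cabs c / eps).
exists T => t /HT; rewrite ler_pdivrMr // => h.
apply: le_trans (cabsD _ _) _; rewrite cabs_nat.
have : 0 <= t%:R :> R by []; nra.
Qed.

Lemma cplus_lower c eps : 0 < eps -> exists T, forall t, (T <= t)%N ->
  t%:R + 1 <= (1 + eps) * cabs (c + t%:R).
Proof.
move=> e0; have [T HT] := nat_ge ((1 + (1 + eps) * cabs c) / eps).
exists T => t /HT; rewrite ler_pdivrMr // => h.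
have : t%:R <= cabs c + cabs (c + t%:R).
  rewrite -{1}(@cabs_nat R t); have -> : t%:R = - c + (c + t%:R) :> R[i] by ring.
  by apply: le_trans (cabsD _ _) _; rewrite cabsN -[X in cabs X + _]/c; rewrite addKr.
by have := cabs_ge0 c; nra.
Qed.

Lemma unif_T (I : finType) (P : I -> nat -> Prop) :
  (forall i, exists T, forall t, (T <= t)%N -> P i t) ->
  exists T, forall t, (T <= t)%N -> forall i, P i t.
Proof.
move=> /choice[T HT]; exists (\max_i T i)%N => t h i; apply: HT.
by apply: leq_trans h; exact: leq_bigmax.
Qed.

End EventualBounds.

Section Ratios.
Context {R : realType} {n p q : nat}.
Variables (k : R) (mu : 'I_p -> R[i]) (nu : 'I_q -> R[i]).
Hypothesis k0 : 0 <= k.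
Implicit Types (e : mi n.+1) (th : R) (t r : nat).

(* The factor by which the [t]-th box of the part of rank [r] multiplies a term. *)
Definition rho (r t : nat) : R :=
  (\prod_l cabs (mu l - rc k * r%:R + t%:R)) / (\prod_l cabs (nu l - rc k * r%:R + t%:R))
  / a0fac (n := n) k r t.

(* [th] eventually bounds the ratios [rho]. *)
Definition adm th := 0 < th /\ ((p <= q)%N \/ (p <= q.+1)%N /\ 1 < th).

Lemma rho_ge0 r t : (r <= n)%N -> 0 <= rho r t.
Proof.
move=> rn; rewrite /rho divr_ge0 //; last exact: ltW (a0fac_gt0 k0 t rn).
by apply: divr_ge0; apply: prodr_ge0 => l _; exact: cabs_ge0.
Qed.

(** Each of the [p + q] linear factors is comparable to [t + 1] within [1 + eps], and the remaining
    denominator is at least [t + 1]. If [p <= q] a negative power of [t + 1] is left and [eps = 1]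
    will do; if [p = q + 1] the powers balance and [eps] must be small enough for [th > 1]. *)
Lemma rho_eventually th r : adm th -> (r <= n)%N ->
  exists T, forall t, (T <= t)%N -> rho r t <= th.
Proof.
move=> [th0 had] rn.
have [eps e0 [T0 HT0]] : exists2 eps : R, 0 < eps & exists T0 : nat, forall t, (T0 <= t)%N ->
    (1 + eps) ^+ (p + q) * (t%:R + 1) ^+ p / (t%:R + 1) ^+ q.+1 <= th.
  case: had => [pq|[pq th1]]; last first.
    have [eps e0 He] := pow_eps (p + q) th1; exists eps => //; exists 0%N => t _.
    have t0 : 0 < t%:R + 1 :> R by rewrite ltr_wpDl.
    apply: le_trans He; rewrite -mulrA ler_piMr ?exprn_ge0 ?addr_ge0 ?(ltW e0) //.
    rewrite ler_pdivrMr ?exprn_gt0 // mul1r.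
    by apply: ler_weXn2l => //; rewrite lerDr.
  exists 1 => //; have [T HT] := nat_ge ((1 + 1) ^+ (p + q) / th).
  exists T => t /HT h; have t0 : 0 < t%:R + 1 :> R by rewrite ltr_wpDl.
  rewrite ler_pdivrMr ?exprn_gt0 // exprS mulrA.
  apply: ler_pM; rewrite ?exprn_ge0 ?(ltW t0) //.
    move: h; rewrite ler_pdivrMr // => h; nra.
  by apply: ler_weXn2l => //; rewrite lerDr.
have [T1 HT1] := unif_T (fun l => cplus_upper (mu l - rc k * r%:R) e0).
have [T2 HT2] := unif_T (fun l => cplus_lower (nu l - rc k * r%:R) e0).
exists (maxn T0 (maxn T1 T2)) => t; rewrite !geq_max => /and3P[h0 h1 h2].
apply: le_trans (HT0 t h0).
have t0 : 0 < t%:R + 1 :> R by rewrite ltr_wpDl.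
have e1 : 0 < 1 + eps by rewrite addr_gt0.
rewrite /rho exprSr invfM [leRHS]mulrA; apply: ler_pM.
- by apply: divr_ge0; apply: prodr_ge0 => l _; exact: cabs_ge0.
- by rewrite invr_ge0 ltW // a0fac_gt0.
- have -> : (1 + eps) ^+ (p + q) * (t%:R + 1) ^+ p / (t%:R + 1) ^+ q =
    ((1 + eps) * (t%:R + 1)) ^+ p * ((1 + eps) / (t%:R + 1)) ^+ q.
    by rewrite exprD !exprMn exprVn; ring.
  apply: ler_pM.
  + by apply: prodr_ge0 => l _; exact: cabs_ge0.
  + by rewrite invr_ge0; apply: prodr_ge0 => l _; exact: cabs_ge0.
  + rewrite -[X in _ ^+ X](card_ord p) -prodr_const; apply: ler_prod => l _.
    by rewrite cabs_ge0 HT1.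
  + rewrite -[X in _ ^+ X](card_ord q) -prodr_const -prodfV; apply: ler_prod => l _.
    rewrite invr_ge0 cabs_ge0 /=.
    have h := HT2 t h2 l.
    have c0 : 0 < cabs (nu l - rc k * r%:R + t%:R).
      by rewrite -(pmulr_rgt0 _ e1); apply: lt_le_trans h.
    by rewrite ler_pdivlMr // mulrC ler_pdivrMr.
rewrite lef_pV2 ?posrE // ?a0fac_gt0 // /a0fac.
have : k * r%:R <= k * n%:R by rewrite ler_wpM2l // ler_nat.
lra.
Qed.

Lemma cabs_vpoch (m : nat) (a : 'I_m -> R[i]) (e : mi n.+1) :
  cabs (vpoch k a e) = \prod_(j < n.+1) \prod_(t < e j) \prod_l cabs (a l - rc k * j%:R + t%:R).
Proof.
rewrite /vpoch cabs_prod.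
transitivity (\prod_(l < m) \prod_(j < n.+1) \prod_(t < e j) cabs (a l - rc k * j%:R + t%:R)).
  apply: eq_bigr => l _; rewrite /gpoch cabs_prod; apply: eq_bigr => j _.
  by rewrite /poch cabs_prod.
rewrite exchange_big /=; apply: eq_bigr => j _; exact: exchange_big.
Qed.

Lemma ratio_bound th : adm th -> exists2 C : R, 0 <= C & forall e,
  cabs (vpoch k mu (etaplus e) / vpoch k nu (etaplus e)) / rprod (a0fac (n := n) k) e
    <= C * th ^+ msize e.
Proof.
move=> hth; have [th0 _] := hth.
have H (j : 'I_n.+1) : exists C, 0 <= C /\ forall d, \prod_(t < d) rho j t <= C * th ^+ d.
  have jn : (j <= n)%N by rewrite -ltnS.
  have [T HT] := rho_eventually hth jn.
  have [C C0 HC] := evprod (fun t => rho_ge0 t jn) th0 HT.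
  by exists C.
have [C HC] := choice H.
exists (\prod_j C j) => [|e]; first by apply: prodr_ge0 => j _; case: (HC j).
have -> : cabs (vpoch k mu (etaplus e) / vpoch k nu (etaplus e)) / rprod (a0fac (n := n) k) e =
   \prod_(j < n.+1) \prod_(t < etaplus e j) rho j t.
  rewrite cabsM cabsV !cabs_vpoch rprodE -!prodf_div; apply: eq_bigr => j _.
  by rewrite -!prodf_div.
rewrite -msize_etaplus /msize -prodrXr -big_split /=; apply: ler_prod => j _.
case: (HC j) => _ ->; rewrite andbT; apply: prodr_ge0 => t _; apply: rho_ge0.
by rewrite -ltnS.
Qed.

End Ratios.

(** * The two hypergeometric series *)

Section Shift.
Context {R : realType}.

Lemma csum_shift (N : nat) (v : nat -> R[i]) : gb v ->
  csum (fun m => if (N <= m)%N then v (m - N)%N else 0) = csum v.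
Proof.
move=> [C [t hv]]; apply: csum_unique.
have h := cvg_csum hv.
set u : nat -> Co R := fun m => if (N <= m)%N then v (m - N)%N else 0.
rewrite -(cvg_shiftn N).
suff -> : (fun m => series u (m + N)%N) = series (v : nat -> Co R) by exact: h.
apply/funext => m; rewrite /series /= (@big_cat_nat _ _ _ N) ?leq_addl //=.
rewrite big_nat_cond big1 ?add0r; last first.
  by move=> i /andP[/andP[_ iN] _]; rewrite /u leqNgt iN.
rewrite -{1}(add0n N) big_addn addnK; apply: eq_bigr => i _.
by rewrite /u leq_addl addnK.
Qed.

End Shift.

Section MinusOne.
Context {n : nat}.
Implicit Types (e : mi n) (j : 'I_n) (m : nat).

Lemma size_cps m : (size (@cps n m) <= m.+1 ^ n)%N.
Proof.
rewrite /cps size_map size_filter; apply: leq_trans (count_size _ _) _.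
by rewrite -cardE card_ffun !card_ord.
Qed.

Lemma mrank_minus1 e j : allpos e -> mrank (minus1 e) j = mrank e j.
Proof.
move=> /forallP he; apply: eq_card => i; rewrite !inE /before !ffunE.
by have := he i; have := he j => /=; lia.
Qed.

Lemma etaplus_minus1 e : allpos e -> etaplus (minus1 e) = minus1 (etaplus e).
Proof.
move=> he; rewrite !etaplus_rperm minus1_pact; congr (pact _ _).
by apply/permP => j; apply: val_inj; rewrite /= !rpermE mrank_minus1.
Qed.

Lemma allpos_etaplus e : allpos (etaplus e) = allpos e.
Proof. by rewrite etaplus_rperm allpos_pact. Qed.

End MinusOne.

Section Series.
Context {R : realType} {n : nat}.
Variable k : R.
Hypothesis k0 : 0 <= k.
Implicit Types (e x y : mi n.+1) (z : 'rV[R[i]]_n.+1) (m t : nat).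

Lemma poch_shift (a : R[i]) t : (0 < t)%N -> poch a t = poch a 1 * poch (a + 1) (t - 1).
Proof.
case: t => // t _; rewrite /poch big_ord_recl big_ord1 subn1 /=; congr (_ * _).
by apply: eq_bigr => i _; rewrite /bump /= natrD addrA.
Qed.

Lemma vpoch_shift (p : nat) (mu : 'I_p -> R[i]) e : allpos e ->
  vpoch k mu e = vpoch k mu (@ones n.+1) * vpoch k (shift1 mu) (minus1 e).
Proof.
move=> /forallP he; rewrite /vpoch -big_split; apply: eq_bigr => l _ /=.
rewrite /gpoch -big_split; apply: eq_bigr => j _ /=; rewrite !ffunE (poch_shift _ (he j)).
by rewrite /shift1 addrAC.
Qed.

Definition Acoef p q (mu : 'I_p -> R[i]) (nu : 'I_q -> R[i]) e : R[i] :=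
  vpoch k mu (etaplus e) / vpoch k nu (etaplus e).

Lemma Acoef_shift p q (mu : 'I_p -> R[i]) (nu : 'I_q -> R[i]) e : allpos e ->
  Acoef mu nu e = vpoch k mu (@ones n.+1) / vpoch k nu (@ones n.+1) *
    Acoef (shift1 mu) (shift1 nu) (minus1 e).
Proof.
move=> he; rewrite /Acoef etaplus_minus1 //.
have he' : allpos (etaplus e) by rewrite allpos_etaplus.
rewrite (vpoch_shift mu he') (vpoch_shift nu he') invfM; ring.
Qed.

(** Degree [m] part of either series in the variable [z]. Opening each [C_lambda(z)] into its
    [L_eta(z)] puts both series in this shape, with only [chi] differing. *)
Definition sterm p q (mu : 'I_p -> R[i]) (nu : 'I_q -> R[i]) (chi : mi n.+1 -> R[i]) m z : R[i] :=
  \sum_(e <- cps m | msize e == m) (Acoef mu nu e * chi e / m`!%:R) * LF k e z.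

Lemma hp_sterm p q (mu : 'I_p -> R[i]) (nu : 'I_q -> R[i]) chi m :
  hp m (\sum_(e <- cps m | msize e == m) cabs (Acoef mu nu e * chi e / m`!%:R) * LN k e)
    (sterm mu nu chi m).
Proof. by apply: hp_sum => e /eqP em; apply: hpZ; rewrite -em; exact: hp_LF. Qed.

(** The symbol [rprod a0fac] cancels between [ratio_bound] and [LN_bound]. What remains is
    [(th * W) ^ m] times a power of [m + 1], which also counts the compositions of [m]; the gap
    between [th * W] and [K'] absorbs that power. *)
Lemma pser_sterm p q (mu : 'I_p -> R[i]) (nu : 'I_q -> R[i]) chi (W K : R) :
  0 <= W -> 0 <= K -> (forall e, cabs (chi e) <= W ^+ msize e) ->
  (forall K', K < K' -> exists2 th, @adm R p q th & th * W < K') ->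
  pser 0 K (sterm mu nu chi).
Proof.
move=> W0 K0 hchi hK K' /hK[th hth thK'].
have [th0 _] := hth.
have [C1 C10 H1] := ratio_bound (n := n) mu nu k0 hth.
have [C2 [Q [C20 H2]]] := LN_bound (n := n) k0.
have s0 : 0 <= th * W by rewrite mulr_ge0 // ltW.
have [C3 C30 H3] := natpow_geometric (n.+1 + Q) s0 thK'.
exists (C1 * C2 * C3) => [|m]; first by rewrite !mulr_ge0.
rewrite subn0; apply: hp_le (hp_sterm mu nu chi m).
have m1 : 0 <= m.+1%:R :> R by [].
apply: (@le_trans _ _ (\sum_(e <- cps m | msize e == m) C1 * C2 * (m.+1%:R ^+ Q * (th * W) ^+ m))).
  apply: ler_sum => e /eqP em.
  have f0 : 0 <= (m`!%:R : R)^-1 by rewrite invr_ge0.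
  rewrite (cabsM (Acoef mu nu e * chi e)) (cabsM (Acoef mu nu e)) (cabsV (m`!%:R)) cabs_nat.
  have r0 := rprod_a0_gt0 (n := n) k0 e.
  have h1 := H1 e; rewrite ler_pdivrMr // em in h1.
  have h2 := H2 e; rewrite em ler_pdivlMr // in h2.
  have h3 := hchi e; rewrite em in h3.
  set A := cabs (Acoef mu nu e) in h1 *; set X := cabs (chi e) in h3 *.
  set rp := rprod _ e in r0 h1 h2; set ln := LN k e in h2 *.
  have A0 : 0 <= A by exact: cabs_ge0.
  have X0 : 0 <= X by exact: cabs_ge0.
  have ln0 : 0 <= ln by exact: ltW (LN_gt0 k0 e).
  have -> : A * X / m`!%:R * ln = A * (X * (ln / m`!%:R)) by ring.
  apply: le_trans (ler_wpM2r _ h1) _; first by rewrite mulr_ge0 // mulr_ge0.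
  have -> : C1 * th ^+ m * rp * (X * (ln / m`!%:R)) = C1 * th ^+ m * (X * (ln / m`!%:R * rp)) by ring.
  have -> : C1 * C2 * (m.+1%:R ^+ Q * (th * W) ^+ m) = C1 * th ^+ m * (W ^+ m * (C2 * m.+1%:R ^+ Q)).
    by rewrite exprMn; ring.
  apply: ler_wpM2l; first by rewrite mulr_ge0 // exprn_ge0 // ltW.
  by apply: ler_pM => //; rewrite mulr_ge0 // ?(ltW r0) // mulr_ge0.
have T0 : 0 <= C1 * C2 * (m.+1%:R ^+ Q * (th * W) ^+ m) by rewrite !mulr_ge0 // exprn_ge0.
rewrite big_const_seq iter_addr addr0 -[leLHS]mulr_natr.
apply: (@le_trans _ _ (C1 * C2 * (m.+1%:R ^+ Q * (th * W) ^+ m) * m.+1%:R ^+ n.+1)).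
  apply: ler_wpM2l => //; rewrite -natrX ler_nat; apply: leq_trans (size_cps m); exact: count_size.
have -> : C1 * C2 * (m.+1%:R ^+ Q * (th * W) ^+ m) * m.+1%:R ^+ n.+1 =
  C1 * C2 * (m.+1%:R ^+ (n.+1 + Q) * (th * W) ^+ m) by rewrite exprD; ring.
by rewrite -[leRHS]mulrA ler_wpM2l // mulr_ge0.
Qed.

Lemma sum_allpos_minus1 m (F : mi n.+1 -> R[i]) :
  \sum_(e <- cps m | (msize e == m) && allpos e) F (minus1 e) =
  if (n.+1 <= m)%N then \sum_(x <- cps (m - n.+1) | msize x == (m - n.+1)%N) F x else 0.
Proof.
have sz e : allpos e -> msize e = (msize (minus1 e) + n.+1)%N.
  move=> /forallP he; rewrite -[X in (_ + X)%N](card_ord n.+1) -sum1_card -big_split /=.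
  by apply: eq_bigr => i _; rewrite ffunE subnK.
case: (leqP n.+1 m) => hm; last first.
  by rewrite big1 // => e /andP[/eqP em /sz]; lia.
rewrite -[LHS]big_filter -(big_map (@minus1 n.+1) predT) -[RHS]big_filter.
apply: perm_big; apply: uniq_perm.
- rewrite map_inj_in_uniq ?filter_uniq ?cps_uniq // => e y.
  by rewrite !mem_filter => /andP[/andP[_ he] _] /andP[/andP[_ hy] _]; exact: minus1_inj.
- by rewrite filter_uniq ?cps_uniq.
move=> y; rewrite mem_filter mem_cps andbb; apply/mapP/eqP => [[e]|ym].
  by rewrite mem_filter => /andP[/andP[/eqP em /sz he] _ ->]; lia.
pose e : mi n.+1 := [ffun i => (y i).+1].
have ye : y = minus1 e by apply/ffunP => i; rewrite !ffunE subn1.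
have he : allpos e by apply/forallP => i; rewrite ffunE.
exists e => //; rewrite mem_filter mem_cps he andbT andbb.
by rewrite sz // -ye ym subnK.
Qed.

(** Compositions with a zero part disappear. For the others [dcoef] turns [1 / m!] into
    [1 / (m - n.+1)!], the coefficient and [chi] are constants times their values at [minus1 e], and
    [minus1 e] becomes the new index. *)
Lemma DeltaT_sterm p q (mu : 'I_p -> R[i]) (nu : 'I_q -> R[i]) chi (D : R[i]) m z :
  (forall e, allpos e -> chi e = D * chi (minus1 e)) ->
  DeltaT k (sterm mu nu chi m) z =
  if (n.+1 <= m)%N then
    vpoch k mu (@ones n.+1) / vpoch k nu (@ones n.+1) * D *
      sterm (shift1 mu) (shift1 nu) chi (m - n.+1) z
  else 0.
Proof.
move=> hD.
rewrite (DeltaT_PsiF k0 z (hp_sterm mu nu chi m)).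
rewrite (@iter_PsiF_sum _ _ _ _ _ _ _ _ m (fun e => cabs (Acoef mu nu e * chi e / m`!%:R) * LN k e)); last first.
  by move=> e /eqP em; apply: hpZ; rewrite -em; exact: hp_LF.
pose G x := vpoch k mu (@ones n.+1) / vpoch k nu (@ones n.+1) * D *
   ((Acoef (shift1 mu) (shift1 nu) x * chi x / (m - n.+1)`!%:R) * LF k x z).
transitivity (\sum_(e <- cps m | (msize e == m) && allpos e) G (minus1 e)).
  rewrite big_mkcondr; apply: eq_bigr => e /eqP em.
  rewrite (iter_PsiFZ _ _ _ _ (hp_LF k0 e)) -(DeltaT_PsiF k0 z (hp_LF k0 e)) DeltaT_LF //.
  case: ifPn => he; last by rewrite /dcoef (negPf he) mul0r mulr0.
  rewrite /G Acoef_shift // hD // dcoefE // em.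
  have hn : (n.+1 <= m)%N.
    rewrite -em -[X in (X <= _)%N](card_ord n.+1) -sum1_card; apply: leq_sum => i _.
    by move/forallP: he.
  have f1 : (m - n.+1)`!%:R != 0 :> R[i] by rewrite pnatr_eq0 -lt0n fact_gt0.
  have f2 : (m ^_ n.+1)%:R != 0 :> R[i] by rewrite pnatr_eq0 -lt0n ffact_gt0.
  rewrite -(ffact_fact hn) natrM.
  move: ((m - n.+1)`!%:R) (((m ^_ n.+1))%:R) f1 f2 => u v u0 v0.
  rewrite invfM -[RHS]mulr1 -[X in _ = _ * X](mulVf v0).
  move: (Acoef _ _ _) (chi _) (LF _ _ _) (_ / vpoch _ _ _) => A X F c; ring.
rewrite sum_allpos_minus1; case: ifP => // _.
by rewrite /G -mulr_sumr.
Qed.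

Lemma DeltaT_series p q (mu : 'I_p -> R[i]) (nu : 'I_q -> R[i]) chi (D : R[i]) (K : R) z :
  0 <= K -> (forall e, allpos e -> chi e = D * chi (minus1 e)) ->
  pser 0 K (sterm mu nu chi) -> pser 0 K (sterm (shift1 mu) (shift1 nu) chi) ->
  pdom K z ->
  DeltaT k (fun z => csum (fun m => sterm mu nu chi m z)) z =
  vpoch k mu (@ones n.+1) / vpoch k nu (@ones n.+1) * D *
    csum (fun m => sterm (shift1 mu) (shift1 nu) chi m z).
Proof.
move=> K0 hD h1 h2 hz.
have [_ H] := foldr_Td_csum k (enum 'I_n.+1) K0 h1 (fun z _ => erefl (csum (fun m => sterm mu nu chi m z))).
rewrite DeltaTE (H z hz).
have g2 : gb (fun m => sterm (shift1 mu) (shift1 nu) chi m z).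
  have [K' [r [r1 [KK' /andP[r0 rr1] hzr K'r1 K'0]]]] := pdom_nbhs K0 hz.
  have r10 : 0 < r1 by exact: lt_trans rr1.
  by apply: (pser_term_bound h2 KK' K'0 r10 K'r1) => l; apply: le_trans (hzr l) (ltW rr1).
set c := _ * D; rewrite -(csumZg c g2) -(csum_shift n.+1 (gbZ c g2)).
by apply: eq_csum => m; rewrite -DeltaTE (DeltaT_sterm _ _ _ _ hD).
Qed.

End Series.

Section Partitions.
Context {n : nat}.
Implicit Types (e l : mi n).

Lemma ispart_etaplus e : ispart (etaplus e).
Proof. by apply/forallP => i; apply/forallP => j; apply/implyP; exact: etaplus_noninc. Qed.

Lemma etaplus_part l : ispart l -> etaplus l = l.
Proof.
move=> /forallP hl; apply: etaplus_id => i j ij.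
by have /forallP/(_ j)/implyP := hl i; apply; exact: ltnW.
Qed.

Lemma inorbit_part e l : ispart l && inorbit e l = (l == etaplus e).
Proof.
apply/andP/eqP => [[hl /inorbitP[s ->]]|->]; first by rewrite etaplus_pact etaplus_part.
split; first exact: ispart_etaplus.
apply/inorbitP; exists (rperm e)^-1%g; rewrite etaplus_rperm.
by apply/ffunP => i; rewrite ffunE invgK pactE.
Qed.

End Partitions.

Section SupNorm.
Context {R : realType} {n : nat}.
Implicit Types z w : 'rV[R[i]]_n.

Definition snr z : R := \big[Num.max/0]_i cabs (z 0 i).

Lemma supnE z : supn z = rc (snr z).
Proof.
have rcmax : {morph @rc R : x y / Num.max x y}.
  by move=> x y; rewrite /Order.max -[rc x < rc y]/((x%:C)%C < (y%:C)%C) ltcR; case: ifP.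
by rewrite /snr (big_morph _ rcmax rc0); apply: eq_bigr => i _; rewrite cabsE.
Qed.

Lemma snr_ge0 z : 0 <= snr z.
Proof. by rewrite /snr; elim/big_ind: _ => // [x y x0 y0|i _]; rewrite ?le_max ?x0 ?cabs_ge0. Qed.

Lemma zbnd_snr z : zbnd z (snr z).
Proof. by move=> l; exact: le_bigmax. Qed.

Lemma supn_lt1 z w : (supn z * supn w < 1) = (snr w * snr z < 1).
Proof. by rewrite !supnE -rcM -rc1 mulrC ltcR. Qed.

End SupNorm.

Section HypergeometricSeries.
Context {R : realType} {n : nat}.
Variable k : R.
Hypothesis k0 : 0 <= k.
Implicit Types (e : mi n.+1) (z w : 'rV[R[i]]_n.+1) (m : nat).

Lemma DeltaT_csum_sterm p q (mu : 'I_p -> R[i]) (nu : 'I_q -> R[i]) (chi : mi n.+1 -> R[i]) w z :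
  (p <= q.+1)%N -> (p <= q)%N \/ supn z * supn w < 1 ->
  (forall e, cabs (chi e) <= snr w ^+ msize e) ->
  (forall e, allpos e -> chi e = (\prod_(j < n.+1) w 0 j) * chi (minus1 e)) ->
  DeltaT k (fun z => csum (fun m => sterm k mu nu chi m z)) z =
  vpoch k mu (@ones n.+1) / vpoch k nu (@ones n.+1) * (\prod_(j < n.+1) w 0 j) *
    csum (fun m => sterm k (shift1 mu) (shift1 nu) chi m z).
Proof.
move=> pq hz hchi hD; rewrite supn_lt1 in hz.
have W0 := snr_ge0 w; have Z0 := snr_ge0 z; set W := snr w in W0 hz hchi *.
have W1 : 0 < 2 * (W + 1) by lra.
(* If [p <= q] every positive [th] is admissible, so [K = 0] and any polydisc is allowed. If
   [p = q + 1] then [th] must exceed 1 and [K] is the norm of [w]; the assumption on the norms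
   leaves room for a radius slightly above that of [z]. *)
have [K [K0 hK [r [r0 Zr Kr]]]] : exists K : R, [/\ 0 <= K,
   forall K', K < K' -> exists2 th, @adm R p q th & th * W < K' &
   exists r, [/\ 0 < r, snr z <= r & K * r < 1]].
  have [pq'|pq'] := leqP p q.
    exists 0; split=> // [K' K'0|]; last by exists (snr z + 1); rewrite mul0r lerDl; split=> //; lra.
    exists (K' / (2 * (W + 1))); first by split; [rewrite divr_gt0|left].
    by rewrite mulrAC ltr_pdivrMr //; nra.
  have {}hz : W * snr z < 1 by case: hz => //; rewrite leqNgt pq'.
  exists W; split=> // [K' WK'|].
    have h : 0 < (K' - W) / (2 * (W + 1)) by rewrite divr_gt0 // subr_gt0.
    exists (1 + (K' - W) / (2 * (W + 1))); first by split; [lra|right; split=> //; lra].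
    rewrite mulrDl mul1r -ltrBrDl mulrAC ltr_pdivrMr //; nra.
  have h : 0 < (1 - W * snr z) / (2 * (W + 1)) by rewrite divr_gt0 // subr_gt0.
  exists (snr z + (1 - W * snr z) / (2 * (W + 1))); split; [lra|lra|].
  by rewrite mulrDr -ltrBrDl mulrA ltr_pdivrMr //; nra.
apply: (DeltaT_series k0 K0 hD) => //.
- exact: (pser_sterm k0 _ _ W0 K0 hchi hK).
- exact: (pser_sterm k0 _ _ W0 K0 hchi hK).
- by exists r; split=> // l; apply: le_trans (zbnd_snr z l) Zr.
Qed.

Definition Kchi w e : R[i] := LF k e w / LF k e onesv.
Definition Fchi w e : R[i] := CF k (etaplus e) w / CF k (etaplus e) onesv.

Lemma KserE p q (mu : 'I_p -> R[i]) (nu : 'I_q -> R[i]) w z :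
  Kser k mu nu w z = csum (fun m => sterm k mu nu (Kchi w) m z).
Proof.
apply: eq_csum => m; rewrite sumdegE /sterm [RHS]big_mkcond big_seq [RHS]big_seq.
apply: eq_bigr => e; rewrite mem_cps => /eqP em; rewrite em eqxx !L_LF /Acoef /Kchi invfM.
by ring.
Qed.

(** The sums over partitions and over their orbits merge into one sum over compositions, because
    [etaplus e] is the only partition in the orbit of [e]. *)
Lemma FserE p q (mu : 'I_p -> R[i]) (nu : 'I_q -> R[i]) w z :
  Fser k mu nu w z = csum (fun m => sterm k mu nu (Fchi w) m z).
Proof.
apply: eq_csum => m; rewrite sumdegE /sterm.
pose c l : R[i] := vpoch k mu l / vpoch k nu l * (CF k l w / CF k l onesv) / m`!%:R.
transitivity (\sum_(l <- cps m) \sum_(e <- cps m) if l == etaplus e then c l * LF k e z else 0).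
  rewrite big_seq [RHS]big_seq; apply: eq_bigr => l; rewrite mem_cps => /eqP lm.
  under [RHS]eq_bigr do rewrite -inorbit_part.
  case: ifP => hl; last by rewrite big1.
  rewrite !Cl_CF -big_mkcond -mulr_sumr /= lm [X in _ * (_ * X)]/CF lm invfM /c.
  by ring.
rewrite exchange_big [RHS]big_mkcond big_seq [RHS]big_seq; apply: eq_bigr => e.
rewrite mem_cps => /eqP em; rewrite em eqxx.
rewrite (bigD1_seq (etaplus e)) ?cps_uniq ?mem_cps ?msize_etaplus ?em //= eqxx.
by rewrite big1 ?addr0 // => l /negPf ->.
Qed.

Lemma prod_onesv : \prod_(j < n.+1) (onesv : 'rV[R[i]]_n.+1) 0 j = 1.
Proof. by rewrite big1 // => j _; rewrite mxE. Qed.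

Lemma Kchi_le w e : cabs (Kchi w e) <= snr w ^+ msize e.
Proof.
have N0 := LN_gt0 k0 e.
rewrite /Kchi cabsM cabsV LF1 // cabs_rc gtr0_norm // ler_pdivrMr // mulrC.
exact: (hp_bound (hp_LF k0 e) (snr_ge0 w) (zbnd_snr w)).
Qed.

Lemma Fchi_le w e : cabs (Fchi w e) <= snr w ^+ msize e.
Proof.
have [N N0 [h1 h2]] := CF1 k0 (etaplus e).
rewrite /Fchi cabsM cabsV h1 // cabs_rc gtr0_norm // ler_pdivrMr // mulrC.
by have := hp_bound h2 (snr_ge0 w) (zbnd_snr w); rewrite msize_etaplus.
Qed.

(** The scalar in [LF_minus1] is the same at [w] and at [onesv], so the quotient removes it and only
    the product of the coordinates of [w] is left. *)
Lemma Kchi_minus1 w e : allpos e -> Kchi w e = (\prod_(j < n.+1) w 0 j) * Kchi w (minus1 e).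
Proof.
move=> he; rewrite /Kchi !(LF_minus1 k0 _ he) prod_onesv mulr1.
have h1 := dcoef_neq0 he; have h2 := acoef_neq0 k0 he.
have h3 := LF1_neq0 k0 (minus1 e); by field; rewrite h1 h2 h3.
Qed.

Lemma Fchi_minus1 w e : allpos e -> Fchi w e = (\prod_(j < n.+1) w 0 j) * Fchi w (minus1 e).
Proof.
move=> he; have he' : allpos (etaplus e) by rewrite allpos_etaplus.
rewrite /Fchi etaplus_minus1 // !(CF_minus1 k0 _ he') prod_onesv mulr1.
have h1 := dcoef_neq0 he'; have h2 := acoef_neq0 k0 he'.
have [N N0 [h3 _]] := CF1 k0 (minus1 (etaplus e)).
have h4 : CF k (minus1 (etaplus e)) onesv != 0 by rewrite h3 rc_eq0 gt_eqF.
by field; rewrite h1 h2 h4.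
Qed.

Lemma DeltaT_Kser p q (mu : 'I_p -> R[i]) (nu : 'I_q -> R[i]) w z :
  (p <= q.+1)%N -> (p <= q)%N \/ supn z * supn w < 1 ->
  DeltaT k (Kser k mu nu w) z =
  vpoch k mu (@ones n.+1) / vpoch k nu (@ones n.+1) * (\prod_(j < n.+1) w 0 j) *
    Kser k (shift1 mu) (shift1 nu) w z.
Proof.
move=> pq hz; have -> : Kser k mu nu w = fun z => csum (fun m => sterm k mu nu (Kchi w) m z).
  by apply/funext => y; exact: KserE.
by rewrite KserE; apply: DeltaT_csum_sterm => // e; [exact: Kchi_le|exact: Kchi_minus1].
Qed.

Lemma DeltaT_Fser p q (mu : 'I_p -> R[i]) (nu : 'I_q -> R[i]) w z :
  (p <= q.+1)%N -> (p <= q)%N \/ supn z * supn w < 1 ->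
  DeltaT k (Fser k mu nu w) z =
  vpoch k mu (@ones n.+1) / vpoch k nu (@ones n.+1) * (\prod_(j < n.+1) w 0 j) *
    Fser k (shift1 mu) (shift1 nu) w z.
Proof.
move=> pq hz; have -> : Fser k mu nu w = fun z => csum (fun m => sterm k mu nu (Fchi w) m z).
  by apply/funext => y; exact: FserE.
by rewrite FserE; apply: DeltaT_csum_sterm => // e; [exact: Fchi_le|exact: Fchi_minus1].
Qed.

End HypergeometricSeries.

(** * The case of no variables *)

Section RankZero.
Context {R : realType}.
Variable k : R.
Implicit Types (e : mi 0) (f : Fn R 0) (z : 'rV[R[i]]_0).

Lemma DeltaT_rank0 f : DeltaT k f = f.
Proof. by rewrite /DeltaT; case: (enum 'I_0) => // -[]. Qed.

Lemma mi_rank0 e x : e = x.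
Proof. by apply/ffunP => -[]. Qed.

Lemma allpos_rank0 e : allpos e.
Proof. by apply/forallP => -[]. Qed.

Lemma dcoef_rank0 e : dcoef e = 1 :> R[i].
Proof. by rewrite /dcoef allpos_rank0 (mi_rank0 (minus1 e) e) divff // pnatr_eq0 -lt0n fact_gt0. Qed.

Lemma vpoch_rank0 p (mu : 'I_p -> R[i]) e : vpoch k mu e = 1.
Proof. by rewrite /vpoch big1 // => l _; rewrite /gpoch big_ord0. Qed.

Lemma Kser_rank0 p q (mu mu' : 'I_p -> R[i]) (nu nu' : 'I_q -> R[i]) (w z : 'rV[R[i]]_0) :
  Kser k mu nu w z = Kser k mu' nu' w z.
Proof. by apply: eq_csum => m; apply: eq_bigr => e _; rewrite !vpoch_rank0. Qed.

Lemma Fser_rank0 p q (mu mu' : 'I_p -> R[i]) (nu nu' : 'I_q -> R[i]) (w z : 'rV[R[i]]_0) :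
  Fser k mu nu w z = Fser k mu' nu' w z.
Proof. by apply: eq_csum => m; apply: eq_bigr => e _; rewrite !vpoch_rank0. Qed.

End RankZero.

Theorem theorem6p10 (R : realType) (n : nat) (k : R) (hk : 0 <= k) :
  (* (1) and (2) *)
  (exists a : mi n -> R,
     (forall e : mi n,
        (allpos e ->
           forall z, DeltaT k (E k e) z = rc (a e) * E k (minus1 e) z) /\
        (~~ allpos e -> a e = 0 /\ forall z, DeltaT k (E k e) z = 0)) /\
     (forall (e : mi n) (s : 'S_n), a (pact s e) = a e)) /\
  (* (3) *)
  (forall (e : mi n) z, DeltaT k (L k e) z = dcoef e * L k (minus1 e) z) /\
  (forall (l : mi n), ispart l ->
     forall z, DeltaT k (Cl k l) z = dcoef l * Cl k (minus1 l) z) /\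
  (* (4) *)
  (forall (p q : nat) (mu : 'I_p -> R[i]) (nu : 'I_q -> R[i]) (w : 'rV[R[i]]_n),
     (p <= q.+1)%N ->
     (forall (l : 'I_q) (j : 'I_n) (t : nat), nu l != rc k * j%:R - t%:R) ->
     forall z : 'rV[R[i]]_n, ((p <= q)%N \/ supn z * supn w < 1) ->
       DeltaT k (Kser k mu nu w) z
         = vpoch k mu (@ones n) / vpoch k nu (@ones n) * (\prod_(j < n) w 0 j)
           * Kser k (shift1 mu) (shift1 nu) w z /\
       DeltaT k (Fser k mu nu w) z
         = vpoch k mu (@ones n) / vpoch k nu (@ones n) * (\prod_(j < n) w 0 j)
           * Fser k (shift1 mu) (shift1 nu) w z).
Proof.
case: n => [|n].
  (* Without variables the product of Dunkl operators is the identity, there is a single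
     composition, and all the Pochhammer symbols are 1. *)
  split; last split; last split.
  - exists (fun=> 1); split=> [e|e s] //; rewrite allpos_rank0; split=> // _ z.
    by rewrite DeltaT_rank0 (mi_rank0 (minus1 e) e) mul1r.
  - by move=> e z; rewrite DeltaT_rank0 dcoef_rank0 mul1r (mi_rank0 (minus1 e) e).
  - by move=> l _ z; rewrite DeltaT_rank0 dcoef_rank0 mul1r (mi_rank0 (minus1 l) l).
  move=> p q mu nu w _ _ z _; rewrite !DeltaT_rank0 !vpoch_rank0 big_ord0 divr1 !mul1r.
  by split; [exact: Kser_rank0|exact: Fser_rank0].
split; last split; last split.
- exists (acoef k); split=> [e|e s]; last exact: acoef_pact.
  split=> [_ z|he]; first by have := DeltaT_EF hk e z; rewrite EF.unlock.
  split=> [|z]; first exact: acoef_zero.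
  by have := DeltaT_EF hk e z; rewrite EF.unlock acoef_zero // mul0r.
- by move=> e z; rewrite !L_LF DeltaT_LF.
- by move=> l _ z; rewrite !Cl_CF DeltaT_CF.
move=> p q mu nu w pq _ z hz.
by split; [exact: DeltaT_Kser|exact: DeltaT_Fser].
Qed.
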